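(* Let $A_0,A_1,A_2\subseteq\mathbb{R}^2$ be convex bodies with $|A_0|+|A_1|+|A_2|=1$ and $\frac12(A_0+A_2)\subseteq A_1$, and put $S=\bigcup_{i=0}^{2}(\{i\}\times A_i)\subseteq\mathbb{R}^3$. Then there exists $\mathbf{y}\in S$ such that $h_S(\mathbf{y})\ge \frac29$, i.e. every closed halfspace $H\subseteq\mathbb{R}^3$ containing $\mathbf{y}$ satisfies $\mu(S\cap H)\ge\frac29$. In particular, if $C\subseteq\mathbb{R}^3$ is a compact convex set whose slices $C\cap(\{z\}\times\mathbb{R}^2)$ have positive area for exactly three integers $z$, then $C\cap(\mathbb{Z}\times\mathbb{R}^2)$ contains a point such that every closed halfspace $H\subseteq\mathbb{R}^3$ containing it satisfies $\mu(C\cap H)\ge\frac29\,\mu(C)$.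
   Context: A convex body is a nonempty compact convex set (it is not required to have nonempty interior). $|\cdot|$ denotes area (two-dimensional Lebesgue measure) in $\mathbb{R}^2$, and $A_0+A_2$ is the Minkowski sum. For a Borel set $E\subseteq\mathbb{R}^{3}=\mathbb{R}\times\mathbb{R}^2$, the mixed-integer volume is $\mu(E)=\sum_{z\in\mathbb{Z}}|\{\mathbf{x}\in\mathbb{R}^2:(z,\mathbf{x})\in E\}|$. For $S=\bigcup_{i=0}^{2}(\{i\}\times A_i)$ and $\mathbf{y}\in\mathbb{R}^3$, the halfspace depth is $h_S(\mathbf{y})=\inf_{H\ni\mathbf{y}}\mu(S\cap H)$, where $H$ ranges over the closed halfspaces of $\mathbb{R}^3$ containing $\mathbf{y}$ (with arbitrary boundary planes). *)

(* Defs.v *)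
From HB Require Import structures.
From mathcomp Require Import all_boot all_order all_algebra.
From mathcomp Require Import all_classical all_reals all_analysis.

Set Implicit Arguments.
Unset Strict Implicit.
Unset Printing Implicit Defensive.

Import Order.TTheory GRing.Theory Num.Theory.
Import numFieldNormedType.Exports.

Local Open Scope classical_set_scope.
Local Open Scope ring_scope.
Local Open Scope ereal_scope.

(* R^2 is R * R and R^3 is R * R^2, with their product module structures and
   product topologies; the first coordinate of R^3 is the discrete direction. *)

(* A convex body may have empty interior. *)
Definition convex_body (R : realType) (A : set (R * R)) : Prop :=
  [/\ A !=set0, compact A & convex_set A].

Definition area (R : realType) (A : set (R * R)) : \bar R :=
  (lebesgue_measure \x lebesgue_measure) A.

Definition half_minkowski_sum (R : realType) (A B : set (R * R)) :
    set (R * R) :=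
  [set (2^-1 : R) *: (a + b) | a in A & b in B]%R.

Definition int_slice (R : realType) (E : set (R * (R * R))) (z : int) :
    set (R * R) :=
  [set x | E ((z%:~R)%R, x)].

Definition mixed_integer_volume (R : realType) (E : set (R * (R * R))) :
    \bar R :=
  \esum_(z in [set: int]) area (int_slice E z).

Definition closed_halfspace (R : realType) (H : set (R * (R * R))) : Prop :=
  exists u : R * (R * R), exists c : R, u != 0%R /\
    H = [set y | (u.1 * y.1 + u.2.1 * y.2.1 + u.2.2 * y.2.2 <= c)%R].

Definition halfspace_depth (R : realType) (S : set (R * (R * R)))
    (y : R * (R * R)) : \bar R :=
  ereal_inf [set mixed_integer_volume (S `&` H) |
              H in [set H | closed_halfspace H /\ H y]].

Definition three_layers (R : realType) (A0 A1 A2 : set (R * R)) :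
    set (R * (R * R)) :=
  [set 0%R] `*` A0 `|` [set 1%R] `*` A1 `|` [set 2%R] `*` A2.

(* Main.v *)
(** If one layer carries half of the mass, a planar centerpoint of depth 4/9 of that
    layer works. Otherwise suppose that every point of [A1] lies in a half-space of
    mass less than 2/9. Compactness, Radon's theorem and a min-max choice yield
    three such half-spaces whose traces K1, K2, K3 on the plane of [A1] pass through
    a common point v of [A1] and have normals summing to zero. They cut [A1] into
    three cells of area s_i contained in K_i only, and three cells of area d_i
    outside K_i only. Midpoints of [A0] and [A2] lie in [A1], and averaging the
    masses of the half-spaces yields s_i > 3D/4 or s_i > d_i + D/3 for every i, where
    D = d_1 + d_2 + d_3. On the other hand let 1/A_k be the extents of [A1] from v
    along the six boundary rays. By convexity the d_i are at least the areas of
    triangles, and the s_i at most those of quadrilaterals, given by the A_k, and these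
    bounds contradict the previous inequalities. The planar centerpoint is
    obtained in the same way. *)

Require Import Defs.
From mathcomp Require Import all_boot all_order all_algebra finmap.
From mathcomp Require Import all_classical all_reals all_analysis.
From mathcomp Require Import measurable_realfun ring lra zify.

Set Implicit Arguments.
Unset Strict Implicit.
Unset Printing Implicit Defensive.

Import Order.TTheory GRing.Theory Num.Theory.
Import numFieldNormedType.Exports.

Local Open Scope classical_set_scope.
Local Open Scope ring_scope.

(** * Algebra of the six-sector area system *)

(** The constants come from one extremal figure: a triangle cut by the parallels to its sides
    through its centroid. With total area 9 it has d_i = 1 and s_i = 2, each half-plane carries 4/9
    of it, and s_i = d_i + D / 3 holds with equality. This gives planar depth 4/9, halved when the
    layer carries only half of the mass. At this figure 3D/4 exceeds s_i, which leaves room for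
    crude rational estimates.

    A half-space meets the three planes in half-planes with bounds c + t, c, c - t. If p in [A0] and
    q in [A2] avoid it, so does their midpoint. As the bad traces cover the plane of [A1], the
    traces on one of the outer planes cover its layer, say [A2]. If two of them already suffice, a
    linear combination of the masses gives s_i > d_i + D / 3. Otherwise some q in [A2] lies in one
    trace only, and halving towards q sends the part of [A0] outside the other two traces into one
    cell of [A1], dividing its area by 4. *)

Lemma weighted_amgm (R : realFieldType) (X Y a b p g : R) :
  0 <= X -> 0 <= Y -> 0 <= a -> 0 <= b -> 0 <= p -> a * b = p ^+ 2 ->
  g ^+ 2 <= 4 * (X * Y) -> g * p <= X * a + Y * b.
Proof.
move=> X0 Y0 a0 b0 p0 abp gXY.
have S0 : 0 <= X * a + Y * b by rewrite addr_ge0// mulr_ge0.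
case: (leP (g * p) 0) => [|gp0]; first by move=> /le_trans; apply.
rewrite -(ler_pXn2r (n := 2))// ?nnegrE ?(ltW gp0)//.
apply: (@le_trans _ _ (4 * (X * Y) * p ^+ 2)).
  by rewrite exprMn ler_wpM2r// sqr_ge0.
rewrite -abp; have := sqr_ge0 (X * a - Y * b); nra.
Qed.

(** Provides nonlinear facts for [lra]: products of two edge slacks of a polygon. *)
Lemma mulrBB_ge0 (R : numDomainType) (a b c d : R) :
  a <= b -> c <= d -> 0 <= (b - a) * (d - c).
Proof. by move=> ab cd; rewrite mulr_ge0// subr_ge0. Qed.

Lemma corner_region (R : realFieldType) (p q : R) :
  0 <= q -> q <= p -> p <= 1 -> 866 / 1000 < p + q ->
  0 < 7 / 4 * (p ^+ 2 + q ^+ 2) + p * q / 2 - 229 / 100 * (p + q) + 3 / 4 ->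
  (3 / 7 <= p ^+ 2 ->
    0 < 121 / 100 * p ^+ 2 + 2 * p - 379 / 100 + q * (1 + 7 / 4 * p ^+ 2)) ->
  93 / 100 <= p /\ 88 / 100 <= q.
Proof.
move=> q0 qp p1 sl f0 br.
have p2 : 3 / 7 <= p ^+ 2.
  rewrite leNgt; apply/negP => h.
  have hp : p < 655 / 1000 by nra.
  clear -q0 qp hp sl f0.
  have h1 : 0 <= (655 / 1000 - p) * (p - q) by apply: mulrBB_ge0 => //; exact: ltW.
  have sl' := ltW sl.
  have h2 : 0 <= (655 / 1000 - p) * (p + q - 866 / 1000) by apply: mulrBB_ge0 => //; exact: ltW.
  have h3 : 0 <= (p - q) * (p + q - 866 / 1000) by apply: mulrBB_ge0 => //; exact: ltW.
  have q65 := le_trans qp (ltW hp).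
  have h4 : 0 <= (655 / 1000 - q) * (p + q - 866 / 1000) by apply: mulrBB_ge0 => //; exact: ltW.
  clear -h1 h2 h3 h4 f0 hp qp sl; lra.
have {}br := br p2.
(* At p = 1 the hypothesis [br] reads 2.75 q > 0.58, whence the threshold. *)
have q21 : 21 / 100 < q.
  have p0 : 0 <= p := le_trans q0 qp.
  have h2 : p * p <= 1 * 1 by rewrite ler_pM.
  have h1 : q * (p * p) <= q * (1 * 1) by rewrite ler_wpM2l.
  clear -h1 h2 br p1.
  lra.
have p75 : 75 / 100 < p.
  rewrite ltNge; apply/negP => h.
  have p0 : 0 <= p := le_trans q0 qp.
  have h2 : p * p <= 75 / 100 * (75 / 100) by rewrite ler_pM.
  have h1 : q * (p * p) <= 75 / 100 * (75 / 100 * (75 / 100)).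
    by rewrite ler_pM ?mulr_ge0// (le_trans qp).
  clear -h1 h2 br h qp.
  lra.
have q88 : 88 / 100 <= q.
  rewrite leNgt; apply/negP => h; clear -q21 p75 h p1 f0.
  have h1 : 0 <= (p - 75 / 100) * (1 - p) by apply: mulrBB_ge0 => //; exact: ltW.
  have h2 : 0 <= (q - 21 / 100) * (88 / 100 - q) by apply: mulrBB_ge0 => //; exact: ltW.
  have h3 : 0 <= (p - 75 / 100) * (88 / 100 - q) by apply: mulrBB_ge0 => //; exact: ltW.
  have h4 : 0 <= (1 - p) * (q - 21 / 100) by apply: mulrBB_ge0 => //; exact: ltW.
  lra.
split => //; rewrite leNgt; apply/negP => h.
have p88 := le_trans q88 qp; have q93 := le_trans qp (ltW h).
have h1 : 0 <= (p - 88 / 100) * (93 / 100 - p) by apply: mulrBB_ge0 => //; exact: ltW.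
have h2 : 0 <= (q - 88 / 100) * (93 / 100 - q) by apply: mulrBB_ge0 => //; exact: ltW.
have h3 : 0 <= (p - 88 / 100) * (93 / 100 - q) by apply: mulrBB_ge0 => //; exact: ltW.
clear -h1 h2 h3 f0 p88 q88 h q93; lra.
Qed.

(** One quadratic for each choice of alternatives for [s2] and [s3], once [s1 > 3 D / 4] is known.
    All four are negative at (1, 1), and the region is small enough for this to persist. Swapping
    [p] and [q] exchanges the second and the third. *)
Lemma center_region (R : realFieldType) (p q : R) :
  p <= 1 -> q <= 1 ->
  ((93 / 100 <= p) && (88 / 100 <= q)) \/ ((93 / 100 <= q) && (88 / 100 <= p)) ->
  [/\ (p + q) ^+ 2 + (1 + q) ^+ 2 + (1 + p) ^+ 2
        + 17 / 12 * (1 + p ^+ 2 + q ^+ 2) + p ^+ 2 + q ^+ 2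
        - 5746 / 1000 * (p + q) - 41 / 6 * (p * q) < 0,
      (p + q) ^+ 2 + (1 + q) ^+ 2 + (1 + p) ^+ 2
        + 11 / 6 * (1 + p ^+ 2 + q ^+ 2) + q ^+ 2
        - 659 / 100 * (p * q) - 659 / 100 * q - 17 / 3 * p < 0,
      (p + q) ^+ 2 + (1 + q) ^+ 2 + (1 + p) ^+ 2
        + 11 / 6 * (1 + p ^+ 2 + q ^+ 2) + p ^+ 2
        - 659 / 100 * (p * q) - 659 / 100 * p - 17 / 3 * q < 0 &
      (p + q) ^+ 2 + (1 + q) ^+ 2 + (1 + p) ^+ 2
        + 9 / 4 * (1 + p ^+ 2 + q ^+ 2) - 13 / 2 * (p * q + p + q) < 0].
Proof.
move=> p1 q1 pq.
wlog /andP[p93 q88] : p q p1 q1 pq / (93 / 100 <= p) && (88 / 100 <= q).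
  move=> H; case: pq => pq; first by apply: H => //; left.
  have [C1 C2 C3 C4] := H q p q1 p1 (or_introl pq) pq.
  by split; [clear -C1|clear -C3|clear -C2|clear -C4]; lra.
clear pq.
have h1 : 0 <= (p - 93 / 100) * (1 - p) by apply: mulrBB_ge0.
have h2 : 0 <= (q - 88 / 100) * (1 - q) by apply: mulrBB_ge0.
have h3 : 0 <= (p - 93 / 100) * (q - 88 / 100) by apply: mulrBB_ge0.
have h4 : 0 <= (1 - p) * (1 - q) by apply: mulrBB_ge0.
split; lra.
Qed.

(* The system is tight at p = q = 1, a_ij = 1, where s_i = d_i + D / 3 = 2; the
   terms a_ij only enter through the prescribed products, by weighted AM-GM. *)
Lemma sector_normalized_false (R : realFieldType)
    (p q a12 a13 a21 a23 a31 a32 s1 s2 s3 d1 d2 d3 D : R) :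
  0 < p -> 0 < q -> p <= 1 -> q <= 1 ->
  0 <= a12 -> 0 <= a13 -> 0 <= a21 -> 0 <= a23 -> 0 <= a31 -> 0 <= a32 ->
  a12 * a13 = (p * q) ^+ 2 -> a21 * a23 = q ^+ 2 -> a31 * a32 = p ^+ 2 ->
  s1 = (p + q) ^+ 2 - a21 - a31 -> s2 = (1 + q) ^+ 2 - a12 - a32 ->
  s3 = (1 + p) ^+ 2 - a13 - a23 ->
  d1 = a23 + a32 - 1 -> d2 = a13 + a31 - p ^+ 2 -> d3 = a12 + a21 - q ^+ 2 ->
  D = d1 + d2 + d3 -> 0 < d1 -> 0 < d2 -> 0 < d3 ->
  3 / 4 * D < s1 \/ d1 + D / 3 < s1 ->
  3 / 4 * D < s2 \/ d2 + D / 3 < s2 ->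
  3 / 4 * D < s3 \/ d3 + D / 3 < s3 -> False.
Proof.
move=> p0 q0 p1 q1 a12_0 a13_0 a21_0 a23_0 a31_0 a32_0 P1 P2 P3.
move=> s1E s2E s3E d1E d2E d3E DE d1_0 d2_0 d3_0 N1 N2 N3.
have pq0 : 0 <= p * q by rewrite mulr_ge0 ?ltW.
(* The factor [g] is a rational lower bound of 2 sqrt(X Y), which keeps square roots out of the
   estimates. *)
have amgm1 X Y g : 0 <= X -> 0 <= Y -> g ^+ 2 <= 4 * (X * Y) ->
    g * (p * q) <= X * a12 + Y * a13.
  by move=> X0 Y0 gXY; apply: weighted_amgm.
have amgm2 X Y g : 0 <= X -> 0 <= Y -> g ^+ 2 <= 4 * (X * Y) ->
    g * q <= X * a21 + Y * a23.
  by move=> X0 Y0 gXY; apply: weighted_amgm => //; exact: ltW.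
have amgm3 X Y g : 0 <= X -> 0 <= Y -> g ^+ 2 <= 4 * (X * Y) ->
    g * p <= X * a31 + Y * a32.
  by move=> X0 Y0 gXY; apply: weighted_amgm => //; exact: ltW.
have s1_0 : 0 <= s1 by case: N1; lra.
have s2_0 : 0 <= s2 by case: N2; lra.
have s3_0 : 0 <= s3 by case: N3; lra.
(* Cauchy-Schwarz: (p + q)^2 <= (a21 + a31) (a23 + a32) = ((p + q)^2 - s1) (d1 + 1). *)
have cauchy : s1 <= (p + q) ^+ 2 * d1.
  have c : (p + q) ^+ 2 <= (a21 + a31) * (a23 + a32).
    have H : 2 * (p * q) <= 1 * (a21 * a32) + 1 * (a31 * a23).
      apply: weighted_amgm => //; rewrite ?mulr_ge0//; last by lra.
      have -> : a21 * a32 * (a31 * a23) = (a21 * a23) * (a31 * a32) by ring.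
      by rewrite P2 P3; ring.
    clear -P2 P3 H; lra.
  have h : s1 * (d1 + 1) <= (p + q) ^+ 2 * d1 by clear -c s1E d1E; subst s1 d1; lra.
  have h2 : 0 <= s1 * d1 by rewrite mulr_ge0// ltW.
  lra.
(* Index 1 belongs to the largest scale, and there the second alternative fails. For p + q <= 1 the
   preceding bound gives s1 <= d1; otherwise AM-GM bounds 3 (s1 - d1) - D by 4 ((p + q - 1)^2 - p
   q), which is nonpositive because p, q <= 1. *)
have {N1}G1 : 3 / 4 * D < s1.
  case: N1 => // h; exfalso; case: (leP (p + q) 1) => pq1.
    have : (p + q) ^+ 2 * d1 <= 1 * d1.
      by rewrite ler_wpM2r ?(ltW d1_0)// expr_le1// addr_ge0 ?ltW.
    lra.
  have e1 : 2 * (p * q) <= 1 * a12 + 1 * a13 by apply: amgm1; clear; lra.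
  have e2 : 8 * q <= 4 * a21 + 4 * a23 by apply: amgm2; clear; lra.
  have e3 : 8 * p <= 4 * a31 + 4 * a32 by apply: amgm3; clear; lra.
  have e4 : (p + q - 1) * (p + q - 1) <= p * q by apply: ler_pM; clear -p1 q1 pq1; lra.
  clear -h e1 e2 e3 e4 s1E d1E d2E d3E DE.
  lra.
clear P1 P2 P3.
(* 0.866 is just below sqrt(3) / 2, where (p + q)^2 reaches 3 / 4. *)
have sum_lb : 866 / 1000 < p + q.
  rewrite ltNge; apply/negP => h2.
  have h3 : (p + q) ^+ 2 <= 3 / 4 by clear -h2 p0 q0; nra.
  have : (p + q) ^+ 2 * d1 <= 3 / 4 * d1 by rewrite ler_wpM2r// ltW.
  lra.
have e1 : 3 / 2 * (p * q) <= 3 / 4 * a12 + 3 / 4 * a13.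
  by apply: amgm1; clear; lra.
(* 229 / 100 is just below 2 sqrt(21 / 16). *)
have e2 : 229 / 100 * q <= 7 / 4 * a21 + 3 / 4 * a23.
  by apply: amgm2; clear; lra.
have e3 : 229 / 100 * p <= 7 / 4 * a31 + 3 / 4 * a32.
  by apply: amgm3; clear; lra.
have S1 : s1 - 3 / 4 * D = (p + q) ^+ 2 + 3 / 4 * (1 + p ^+ 2 + q ^+ 2)
    - 7 / 4 * (a21 + a31) - 3 / 4 * (a23 + a32 + a12 + a13).
  by rewrite DE s1E d1E d2E d3E; field.
have f_gt0 : 0 < 7 / 4 * (p ^+ 2 + q ^+ 2) + p * q / 2
    - 229 / 100 * (p + q) + 3 / 4.
  clear -e1 e2 e3 S1 G1; lra.
have pq88 :
    ((93 / 100 <= p) && (88 / 100 <= q)) \/ ((93 / 100 <= q) && (88 / 100 <= p)).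
  have [qp|/ltW pq] := leP q p; [left|right]; apply/andP.
    apply: (corner_region (ltW q0) qp p1 sum_lb f_gt0) => p37.
    have e4 : (7 / 2 * p) * p <= 7 / 4 * a31 + (7 / 4 * p ^+ 2) * a32.
      by apply: amgm3; clear -p37; nra.
    have e5 : (229 / 100 * p) * (p * q) <= (7 / 4 * p ^+ 2) * a12 + 3 / 4 * a13.
      by apply: amgm1; clear -p37; nra.
    (* The multiple of [s2] added to [s1 - 3 D / 4] is chosen so that after AM-GM all terms free of
       [q] cancel; dividing by [q] leaves the last hypothesis of [corner_region]. *)
    have e6 : 0 <= (7 / 4 * p ^+ 2 - 3 / 4) * s2.
      by rewrite mulr_ge0//; clear -p37; lra.
    rewrite -(pmulr_rgt0 _ q0); rewrite s2E in e6.
    clear -e2 e4 e5 e6 S1 G1; lra.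
  rewrite addrC in sum_lb.
  have f_gt0' : 0 < 7 / 4 * (q ^+ 2 + p ^+ 2) + q * p / 2
      - 229 / 100 * (q + p) + 3 / 4 by clear -f_gt0; lra.
  apply: (corner_region (ltW p0) pq q1 sum_lb f_gt0') => q37.
  have e4 : (7 / 2 * q) * q <= 7 / 4 * a21 + (7 / 4 * q ^+ 2) * a23.
    by apply: amgm2; clear -q37; nra.
  have e5 : (229 / 100 * q) * (p * q) <= 3 / 4 * a12 + (7 / 4 * q ^+ 2) * a13.
    by apply: amgm1; clear -q37; nra.
  have e6 : 0 <= (7 / 4 * q ^+ 2 - 3 / 4) * s3.
    by rewrite mulr_ge0//; clear -q37; lra.
  rewrite -(pmulr_rgt0 _ p0); rewrite s3E in e6.
  clear -e3 e4 e5 e6 S1 G1; lra.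
clear S1 sum_lb f_gt0 e1 e2 e3 cauchy.
have [C1 C2 C3 C4] := center_region p1 q1 pq88.
clear -amgm1 amgm2 amgm3 s1E s2E s3E d1E d2E d3E DE G1 N2 N3 C1 C2 C3 C4.
(* In each case the three strict inequalities are added, and AM-GM eliminates the [a_ij]. *)
case: N2 => N2; case: N3 => N3.
- have e1 : 13 / 2 * (p * q) <= 13 / 4 * a12 + 13 / 4 * a13.
    by apply: amgm1; clear; lra.
  have e2 : 13 / 2 * q <= 13 / 4 * a21 + 13 / 4 * a23.
    by apply: amgm2; clear; lra.
  have e3 : 13 / 2 * p <= 13 / 4 * a31 + 13 / 4 * a32.
    by apply: amgm3; clear; lra.
  have : (s1 - 3 / 4 * D) + (s2 - 3 / 4 * D) + (s3 - 3 / 4 * D) =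
    (p + q) ^+ 2 + (1 + q) ^+ 2 + (1 + p) ^+ 2 + 9 / 4 * (1 + p ^+ 2 + q ^+ 2)
    - 13 / 4 * (a12 + a13 + a21 + a23 + a31 + a32).
    by rewrite DE s1E s2E s3E d1E d2E d3E; field.
  clear -e1 e2 e3 G1 N2 N3 C4; lra.
- have e1 : 659 / 100 * (p * q) <= 23 / 6 * a12 + 17 / 6 * a13.
    by apply: amgm1; clear; lra.
  have e2 : 659 / 100 * q <= 23 / 6 * a21 + 17 / 6 * a23.
    by apply: amgm2; clear; lra.
  have e3 : 17 / 3 * p <= 17 / 6 * a31 + 17 / 6 * a32.
    by apply: amgm3; clear; lra.
  have : (s1 - 3 / 4 * D) + (s2 - 3 / 4 * D) + (s3 - d3 - D / 3) =
    (p + q) ^+ 2 + (1 + q) ^+ 2 + (1 + p) ^+ 2 + 11 / 6 * (1 + p ^+ 2 + q ^+ 2)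
    + q ^+ 2 - 23 / 6 * (a12 + a21) - 17 / 6 * (a13 + a23 + a31 + a32).
    by rewrite DE s1E s2E s3E d1E d2E d3E; field.
  clear -e1 e2 e3 G1 N2 N3 C2; lra.
- have e1 : 659 / 100 * (p * q) <= 17 / 6 * a12 + 23 / 6 * a13.
    by apply: amgm1; clear; lra.
  have e2 : 17 / 3 * q <= 17 / 6 * a21 + 17 / 6 * a23.
    by apply: amgm2; clear; lra.
  have e3 : 659 / 100 * p <= 23 / 6 * a31 + 17 / 6 * a32.
    by apply: amgm3; clear; lra.
  have : (s1 - 3 / 4 * D) + (s2 - d2 - D / 3) + (s3 - 3 / 4 * D) =
    (p + q) ^+ 2 + (1 + q) ^+ 2 + (1 + p) ^+ 2 + 11 / 6 * (1 + p ^+ 2 + q ^+ 2)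
    + p ^+ 2 - 23 / 6 * (a13 + a31) - 17 / 6 * (a12 + a32 + a21 + a23).
    by rewrite DE s1E s2E s3E d1E d2E d3E; field.
  clear -e1 e2 e3 G1 N2 N3 C3; lra.
- have e1 : 41 / 6 * (p * q) <= 41 / 12 * a12 + 41 / 12 * a13.
    by apply: amgm1; clear; lra.
  have e2 : 5746 / 1000 * q <= 41 / 12 * a21 + 29 / 12 * a23.
    by apply: amgm2; clear; lra.
  have e3 : 5746 / 1000 * p <= 41 / 12 * a31 + 29 / 12 * a32.
    by apply: amgm3; clear; lra.
  have : (s1 - 3 / 4 * D) + (s2 - d2 - D / 3) + (s3 - d3 - D / 3) =
    (p + q) ^+ 2 + (1 + q) ^+ 2 + (1 + p) ^+ 2 + 17 / 12 * (1 + p ^+ 2 + q ^+ 2)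
    + p ^+ 2 + q ^+ 2 - 41 / 12 * (a12 + a13 + a21 + a31) - 29 / 12 * (a23 + a32).
    by rewrite DE s1E s2E s3E d1E d2E d3E; field.
  clear -e1 e2 e3 G1 N2 N3 C1; lra.
Qed.

(* [s] is the area of a region lying in one bad half-plane only, [d] that of the
   opposite region, lying in the two other bad half-planes, and [D] the total
   area of the three regions of the latter kind. *)
Definition exceeds (R : realFieldType) (s d D : R) :=
  3 / 4 * D < s \/ d + D / 3 < s.

Lemma exceedsW (R : realFieldType) (s s' d d' D D' : R) :
  s <= s' -> d' <= d -> D' <= D -> exceeds s d D -> exceeds s' d' D'.
Proof. by move=> ss dd DD [h|h]; [left|right]; lra. Qed.

Lemma exceedsZ (R : realFieldType) (k s d D : R) :
  0 < k -> exceeds s d D -> exceeds (k * s) (k * d) (k * D).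
Proof.
move=> k0 [h|h]; [left|right].
  by rewrite mulrCA ltr_pM2l.
by rewrite -mulrA -mulrDr ltr_pM2l.
Qed.

(** The system is homogeneous of degree two in the scales, so dividing by the largest one, [t1],
    normalises it. *)
Lemma sector_false_max (R : realFieldType)
    (t1 t2 t3 a12 a13 a21 a23 a31 a32 s1 s2 s3 d1 d2 d3 D : R) :
  0 < t1 -> 0 < t2 -> 0 < t3 -> t2 <= t1 -> t3 <= t1 ->
  0 <= a12 -> 0 <= a13 -> 0 <= a21 -> 0 <= a23 -> 0 <= a31 -> 0 <= a32 ->
  a12 * a13 = (t2 * t3) ^+ 2 -> a21 * a23 = (t1 * t3) ^+ 2 ->
  a31 * a32 = (t1 * t2) ^+ 2 ->
  s1 = (t2 + t3) ^+ 2 - a21 - a31 -> s2 = (t1 + t3) ^+ 2 - a12 - a32 ->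
  s3 = (t1 + t2) ^+ 2 - a13 - a23 ->
  d1 = a23 + a32 - t1 ^+ 2 -> d2 = a13 + a31 - t2 ^+ 2 ->
  d3 = a12 + a21 - t3 ^+ 2 ->
  D = d1 + d2 + d3 -> 0 < d1 -> 0 < d2 -> 0 < d3 ->
  exceeds s1 d1 D -> exceeds s2 d2 D -> exceeds s3 d3 D -> False.
Proof.
move=> t1_0 t2_0 t3_0 t21 t31 a12_0 a13_0 a21_0 a23_0 a31_0 a32_0 P1 P2 P3.
move=> s1E s2E s3E d1E d2E d3E DE d1_0 d2_0 d3_0 N1 N2 N3.
pose k := (t1 ^+ 2)^-1.
have k0 : 0 < k by rewrite invr_gt0 exprn_gt0.
have tn : t1 != 0 by rewrite gt_eqF.
apply: (@sector_normalized_false R (t2 / t1) (t3 / t1) (k * a12) (k * a13)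
  (k * a21) (k * a23) (k * a31) (k * a32) (k * s1) (k * s2) (k * s3)
  (k * d1) (k * d2) (k * d3) (k * D)).
all: try by [rewrite divr_gt0|rewrite ler_pdivrMr// mul1r|
             rewrite mulr_ge0// ltW|rewrite mulr_gt0|exact: exceedsZ].
- by rewrite mulrACA P1 /k; field.
- by rewrite mulrACA P2 /k; field.
- by rewrite mulrACA P3 /k; field.
- by rewrite s1E /k; field.
- by rewrite s2E /k; field.
- by rewrite s3E /k; field.
- by rewrite d1E /k; field.
- by rewrite d2E /k; field.
- by rewrite d3E /k; field.
- by rewrite DE !mulrDr.
Qed.

Lemma sector_false (R : realFieldType)
    (t1 t2 t3 a12 a13 a21 a23 a31 a32 s1 s2 s3 d1 d2 d3 D : R) :
  0 < t1 -> 0 < t2 -> 0 < t3 ->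
  0 <= a12 -> 0 <= a13 -> 0 <= a21 -> 0 <= a23 -> 0 <= a31 -> 0 <= a32 ->
  a12 * a13 = (t2 * t3) ^+ 2 -> a21 * a23 = (t1 * t3) ^+ 2 ->
  a31 * a32 = (t1 * t2) ^+ 2 ->
  s1 = (t2 + t3) ^+ 2 - a21 - a31 -> s2 = (t1 + t3) ^+ 2 - a12 - a32 ->
  s3 = (t1 + t2) ^+ 2 - a13 - a23 ->
  d1 = a23 + a32 - t1 ^+ 2 -> d2 = a13 + a31 - t2 ^+ 2 ->
  d3 = a12 + a21 - t3 ^+ 2 ->
  D = d1 + d2 + d3 -> 0 < d1 -> 0 < d2 -> 0 < d3 ->
  exceeds s1 d1 D -> exceeds s2 d2 D -> exceeds s3 d3 D -> False.
Proof.
move=> t1_0 t2_0 t3_0 a12_0 a13_0 a21_0 a23_0 a31_0 a32_0 P1 P2 P3.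
move=> s1E s2E s3E d1E d2E d3E DE d1_0 d2_0 d3_0 N1 N2 N3.
have [t21|/ltW t12] := leP t2 t1; last first.
  have [t32|/ltW t23] := leP t3 t2.
    by apply: (@sector_false_max R t2 t1 t3 a21 a23 a12 a13 a32 a31
      s2 s1 s3 d2 d1 d3 D) => //; solve [rewrite mulrC P3; ring | subst; ring].
  by apply: (@sector_false_max R t3 t2 t1 a32 a31 a23 a21 a13 a12
    s3 s2 s1 d3 d2 d1 D) => //; first exact: (le_trans t12);
    solve [rewrite mulrC P3; ring | rewrite mulrC P2; ring
          | rewrite mulrC P1; ring | subst; ring].
have [t31|/ltW t13] := leP t3 t1.
  by apply: (@sector_false_max R t1 t2 t3 a12 a13 a21 a23 a31 a32
    s1 s2 s3 d1 d2 d3 D).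
by apply: (@sector_false_max R t3 t2 t1 a32 a31 a23 a21 a13 a12
  s3 s2 s1 d3 d2 d1 D) => //; first exact: (le_trans t21);
  solve [rewrite mulrC P3; ring | rewrite mulrC P2; ring
        | rewrite mulrC P1; ring | subst; ring].
Qed.

(* Bounds for twice the area [s] of the part of a convex body in the wedge of two
   vectors u, w with u x w = 1, when the body extends to 1 / Au, 1 / Aw, 1 / A'
   and 1 / A'' along u, w, u - w and w - u. By convexity the lines joining the ends
   on u - w and u, and on w and w - u, bound this part from outside: together they
   cut a quadrilateral off the wedge, and separately a triangle. *)
Definition wedge_bound (R : realFieldType) (Au Aw A' A'' s : R) : Prop :=
  [/\ 0 < Au * A'' + Aw * A' - A' * A'' ->
        s * (Au * A'' + Aw * A' - A' * A'') <=
          (Au - Aw + A'') / Au + (Aw - Au + A') / Aw,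
      A' < Au -> s * (Au * (Au - A')) <= 1 &
      A'' < Aw -> s * (Aw * (Aw - A'')) <= 1].

(** Since 4 d d' <= D^2, each of the four possible products of lower bounds for [s] and [s'] is
    larger than d d'. Comparing products makes it irrelevant which [d] belongs to which [s]. *)
Lemma exceeds_prod (R : realFieldType) (s s' d d' D : R) :
  0 < d -> 0 < d' -> d + d' <= D -> exceeds s d D -> exceeds s' d' D ->
  d * d' < s * s'.
Proof.
move=> d0 d'0 dD h h'.
have D2 : 4 * (d * d') <= D * D.
  have : (d + d') * (d + d') <= D * D by apply: ler_pM => //; rewrite addr_ge0 ?ltW.
  have := sqr_ge0 (d - d'); clear; nra.
have D0 : 0 < D by lra.
have DD := mulr_gt0 D0 D0.
case: h => h; case: h' => h'.
- have : 3 / 4 * D * (3 / 4 * D) < s * s' by apply: ltr_pM => //; lra.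
  lra.
- have : 3 / 4 * D * (d' + D / 3) < s * s' by apply: ltr_pM => //; lra.
  have := mulr_gt0 D0 d'0; lra.
- have : (d + D / 3) * (3 / 4 * D) < s * s' by apply: ltr_pM => //; lra.
  have := mulr_gt0 D0 d0; lra.
- have : (d + D / 3) * (d' + D / 3) < s * s' by apply: ltr_pM => //; lra.
  have := mulr_gt0 D0 d0; have := mulr_gt0 D0 d'0; have := mulr_gt0 d0 d'0.
  lra.
Qed.

(* If one of the three quadrilaterals is unbounded, the triangles bounding the two
   other wedges are small enough: s s' <= d d'. *)
Lemma degenerate_false (R : realFieldType) (A1 A2 A5 A6 s s' d d' D : R) :
  0 < A1 -> 0 < A2 -> 0 < A5 -> 0 < A6 ->
  A1 * A5 + A6 * A2 - A2 * A5 <= 0 ->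
  (A1 < A2 -> s * (A2 * (A2 - A1)) <= 1) ->
  (A6 < A5 -> s' * (A5 * (A5 - A6)) <= 1) ->
  1 <= d * (A1 * A2) -> 1 <= d' * (A5 * A6) -> d + d' <= D ->
  exceeds s d' D -> exceeds s' d D -> False.
Proof.
move=> A1_0 A2_0 A5_0 A6_0 T0 hs hs' hd hd' dD N N'.
have A12 : A1 < A2.
  by rewrite -(ltr_pM2r A5_0); have := mulr_gt0 A6_0 A2_0; lra.
have A65 : A6 < A5.
  by rewrite -(ltr_pM2l A2_0); have := mulr_gt0 A1_0 A5_0; lra.
have {}hs := hs A12; have {}hs' := hs' A65.
have d0 : 0 < d.
  by rewrite -(pmulr_lgt0 _ (mulr_gt0 A1_0 A2_0)) (lt_le_trans ltr01).
have d'0 : 0 < d'.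
  by rewrite -(pmulr_lgt0 _ (mulr_gt0 A5_0 A6_0)) (lt_le_trans ltr01).
have s0 : 0 < s by case: N; lra.
have s'0 : 0 < s' by case: N'; lra.
rewrite addrC in dD; have := exceeds_prod d'0 d0 dD N N'; rewrite (mulrC d'); apply/negP; rewrite -leNgt.
have A25 := mulr_gt0 A2_0 A5_0; have A16 := mulr_gt0 A1_0 A6_0.
(* The hypothesis on the quadrilateral amounts to A1 A6 <= (A2 - A1) (A5 - A6), which is why both
   sides are multiplied by A1 A2 A5 A6. *)
rewrite -(ler_pM2r (mulr_gt0 A25 A16)).
apply: (@le_trans _ _ 1).
  apply: (@le_trans _ _ (s * s' * (A2 * A5 * ((A2 - A1) * (A5 - A6))))).
    rewrite ler_wpM2l ?(ltW (mulr_gt0 s0 s'0))// (ler_pM2l A25); lra.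
  have -> : s * s' * (A2 * A5 * ((A2 - A1) * (A5 - A6))) =
    (s * (A2 * (A2 - A1))) * (s' * (A5 * (A5 - A6))) by ring.
  by rewrite mulr_ile1// mulr_ge0 ?mulr_ge0 ?subr_ge0 ?ltW.
have -> : d * d' * (A2 * A5 * (A1 * A6)) =
    (d * (A1 * A2)) * (d' * (A5 * A6)) by ring.
by rewrite mulr_ege1.
Qed.

(** The rays are numbered cyclically. The cell of [s1] lies between rays 6 and 1, that of [s2]
    between 4 and 5, that of [s3] between 2 and 3; those of [d1], [d2], [d3] lie between 3 and 4, 1
    and 2, 5 and 6. All areas are doubled. *)
Lemma hexagon_false (R : realFieldType)
    (A1 A2 A3 A4 A5 A6 s1 s2 s3 d1 d2 d3 D : R) :
  0 < A1 -> 0 < A2 -> 0 < A3 -> 0 < A4 -> 0 < A5 -> 0 < A6 ->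
  wedge_bound A1 A6 A2 A5 s1 -> wedge_bound A5 A4 A6 A3 s2 ->
  wedge_bound A3 A2 A4 A1 s3 ->
  1 <= d1 * (A3 * A4) -> 1 <= d2 * (A1 * A2) -> 1 <= d3 * (A5 * A6) ->
  D = d1 + d2 + d3 ->
  exceeds s1 d1 D -> exceeds s2 d2 D -> exceeds s3 d3 D -> False.
Proof.
move=> A1_0 A2_0 A3_0 A4_0 A5_0 A6_0 [w1 w1' w1''] [w2 w2' w2''] [w3 w3' w3''].
move=> hd1 hd2 hd3 DE N1 N2 N3.
have d1_0 : 0 < d1.
  by rewrite -(pmulr_lgt0 _ (mulr_gt0 A3_0 A4_0)) (lt_le_trans ltr01).
have d2_0 : 0 < d2.
  by rewrite -(pmulr_lgt0 _ (mulr_gt0 A1_0 A2_0)) (lt_le_trans ltr01).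
have d3_0 : 0 < d3.
  by rewrite -(pmulr_lgt0 _ (mulr_gt0 A5_0 A6_0)) (lt_le_trans ltr01).
set T1 := A1 * A5 + A6 * A2 - A2 * A5 in w1.
set T2 := A5 * A3 + A4 * A6 - A6 * A3 in w2.
set T3 := A3 * A1 + A2 * A4 - A4 * A1 in w3.
have D12 : d1 + d2 <= D by clear -DE d3_0; lra.
have D31 : d3 + d1 <= D by clear -DE d2_0; lra.
have D23 : d2 + d3 <= D by clear -DE d1_0; lra.
have [T1_0|T1_0] := leP T1 0.
  exact: (degenerate_false A1_0 A2_0 A5_0 A6_0 T1_0 w3'' w2' hd2 hd3 D23 N3 N2).
have [T2_0|T2_0] := leP T2 0.
  exact: (degenerate_false A5_0 A6_0 A3_0 A4_0 T2_0 w1'' w3' hd3 hd1 D31 N1 N3).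
have [T3_0|T3_0] := leP T3 0.
  exact: (degenerate_false A3_0 A4_0 A1_0 A2_0 T3_0 w2'' w1' hd1 hd2 D12 N2 N1).
have {}w1 := w1 T1_0; have {}w2 := w2 T2_0; have {}w3 := w3 T3_0.
clear w1' w1'' w2' w2'' w3' w3''.
(* After multiplication by T1 T2 T3 the wedge bounds and the lower bounds for the
   d_i take the shape of [sector_false] with t_i = T_i. *)
pose Pr := T1 * T2 * T3.
have Pr0 : 0 < Pr by rewrite !mulr_gt0.
have n1 := lt0r_neq0 A1_0; have n2 := lt0r_neq0 A2_0.
have n3 := lt0r_neq0 A3_0; have n4 := lt0r_neq0 A4_0.
have n5 := lt0r_neq0 A5_0; have n6 := lt0r_neq0 A6_0.
pose a12 := T2 * T3 * (A2 / A5); pose a13 := T2 * T3 * (A5 / A2).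
pose a21 := T1 * T3 * (A3 / A6); pose a23 := T1 * T3 * (A6 / A3).
pose a31 := T1 * T2 * (A4 / A1); pose a32 := T1 * T2 * (A1 / A4).
have e1 : (T2 + T3) ^+ 2 - a21 - a31 =
    T2 * T3 * ((A1 - A6 + A5) / A1 + (A6 - A1 + A2) / A6).
  by rewrite /a21 /a31 /T1 /T2 /T3; field; rewrite ?n1 ?n2 ?n3 ?n4 ?n5 ?n6.
have e2 : (T1 + T3) ^+ 2 - a12 - a32 =
    T1 * T3 * ((A5 - A4 + A3) / A5 + (A4 - A5 + A6) / A4).
  by rewrite /a12 /a32 /T1 /T2 /T3; field; rewrite ?n1 ?n2 ?n3 ?n4 ?n5 ?n6.
have e3 : (T1 + T2) ^+ 2 - a13 - a23 =
    T1 * T2 * ((A3 - A2 + A1) / A3 + (A2 - A3 + A4) / A2).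
  by rewrite /a13 /a23 /T1 /T2 /T3; field; rewrite ?n1 ?n2 ?n3 ?n4 ?n5 ?n6.
have f1 : a23 + a32 - T1 ^+ 2 = Pr / (A3 * A4).
  by rewrite /a23 /a32 /Pr /T1 /T2 /T3; field; rewrite ?n1 ?n2 ?n3 ?n4 ?n5 ?n6.
have f2 : a13 + a31 - T2 ^+ 2 = Pr / (A1 * A2).
  by rewrite /a13 /a31 /Pr /T1 /T2 /T3; field; rewrite ?n1 ?n2 ?n3 ?n4 ?n5 ?n6.
have f3 : a12 + a21 - T3 ^+ 2 = Pr / (A5 * A6).
  by rewrite /a12 /a21 /Pr /T1 /T2 /T3; field; rewrite ?n1 ?n2 ?n3 ?n4 ?n5 ?n6.
have g1 : Pr / (A3 * A4) <= Pr * d1.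
  by rewrite ler_pdivrMr ?mulr_gt0// -mulrA ler_peMr// ltW.
have g2 : Pr / (A1 * A2) <= Pr * d2.
  by rewrite ler_pdivrMr ?mulr_gt0// -mulrA ler_peMr// ltW.
have g3 : Pr / (A5 * A6) <= Pr * d3.
  by rewrite ler_pdivrMr ?mulr_gt0// -mulrA ler_peMr// ltW.
have g : a23 + a32 - T1 ^+ 2 + (a13 + a31 - T2 ^+ 2) + (a12 + a21 - T3 ^+ 2) <= Pr * D.
  by rewrite f1 f2 f3 DE !mulrDr !lerD.
have T23 := mulr_gt0 T2_0 T3_0; have T13 := mulr_gt0 T1_0 T3_0.
have T12 := mulr_gt0 T1_0 T2_0.
have h1 : Pr * s1 <= (T2 + T3) ^+ 2 - a21 - a31.
  by rewrite e1 [Pr * _](_ : _ = T2 * T3 * (s1 * T1)) ?ler_pM2l// /Pr; ring.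
have h2 : Pr * s2 <= (T1 + T3) ^+ 2 - a12 - a32.
  by rewrite e2 [Pr * _](_ : _ = T1 * T3 * (s2 * T2)) ?ler_pM2l// /Pr; ring.
have h3 : Pr * s3 <= (T1 + T2) ^+ 2 - a13 - a23.
  by rewrite e3 [Pr * _](_ : _ = T1 * T2 * (s3 * T3)) ?ler_pM2l// /Pr; ring.
apply: (@sector_false R T1 T2 T3 a12 a13 a21 a23 a31 a32) (erefl _) (erefl _)
  (erefl _) (erefl _) (erefl _) (erefl _) (erefl _) _ _ _ _ _ _ => //.
all: try by rewrite mulr_ge0 ?divr_ge0// ltW.
- by rewrite /a12 /a13; field; rewrite n2 n5.
- by rewrite /a21 /a23; field; rewrite n3 n6.
- by rewrite /a31 /a32; field; rewrite n1 n4.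
- by rewrite f1 divr_gt0// mulr_gt0.
- by rewrite f2 divr_gt0// mulr_gt0.
- by rewrite f3 divr_gt0// mulr_gt0.
- by apply: exceedsW h1 _ g (exceedsZ Pr0 N1); rewrite f1.
- by apply: exceedsW h2 _ g (exceedsZ Pr0 N2); rewrite f2.
- by apply: exceedsW h3 _ g (exceedsZ Pr0 N3); rewrite f3.
Qed.

(** * Linear bookkeeping for the three layers *)

(** With weights 4, 4, 1 the masses add up to less than twice the total. Taking away 4 (e1 + e2) >=
    4 a2 leaves 2 (a0 + a1 - a2) < 4 a1. *)
Lemma layers_pair (R : realFieldType) (a0 a1 a2 x1 x2 x3 c1 c2 c3 e1 e2 e3 : R) :
  a0 < a1 + a2 -> 0 <= c1 -> 0 <= c2 -> 0 <= c3 -> 0 <= e3 ->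
  x1 + c1 + e1 < 2 / 9 * (a0 + a1 + a2) -> x2 + c2 + e2 < 2 / 9 * (a0 + a1 + a2) ->
  x3 + c3 + e3 < 2 / 9 * (a0 + a1 + a2) -> a2 <= e1 + e2 ->
  4 * x1 + 4 * x2 + x3 < 4 * a1.
Proof. by lra. Qed.

(* The three half-space masses are added with weights 1, 7/4, 7/4 here, with
   1, 1, 5/2 in [layers_two] and with 3/2 each in [layers_three]; the weights sum
   to 9/2, so the right-hand sides add up to the total mass. *)
Lemma layers_one (R : realFieldType)
    (a0 a1 a2 x1 x2 x3 s1 s2 s3 d1 d2 d3 c1 c2 c3 e1 e2 e3 D : R) :
  a1 < a0 + a2 -> 0 <= c1 -> 0 <= e2 -> 0 <= e3 ->
  x1 + c1 + e1 < 2 / 9 * (a0 + a1 + a2) -> x2 + c2 + e2 < 2 / 9 * (a0 + a1 + a2) ->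
  x3 + c3 + e3 < 2 / 9 * (a0 + a1 + a2) -> a2 <= e1 + e2 + e3 ->
  s1 + d2 + d3 <= x1 -> s2 + d1 + d3 <= x2 -> s3 + d1 + d2 <= x3 ->
  a1 <= s1 + s2 + s3 + d1 + d2 + d3 -> D = d1 + d2 + d3 ->
  0 <= c2 -> 0 <= c3 ->
  d2 + D / 3 < s2 -> d3 + D / 3 < s3 -> a0 <= c2 + c3 + 4 * s1 ->
  3 / 4 * D < s1.
Proof.
move=> h c0 e20 e30 m1 m2 m3 E h1 h2 h3 t DE c20 c30 n2 n3 q.
have : a0 + a1 > x1 + 7 / 4 * (x2 + x3) + (c2 + c3) by clear -c0 e20 e30 m1 m2 m3 E c20 c30; lra.
by clear -h1 h2 h3 t DE n2 n3 q; lra.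
Qed.

Lemma layers_two (R : realFieldType)
    (a0 a1 a2 x1 x2 x3 s1 s2 s3 d1 d2 d3 c1 c2 c3 e1 e2 e3 D : R) :
  0 <= e3 -> 0 <= c1 -> 0 <= c2 -> 0 <= c3 ->
  x1 + c1 + e1 < 2 / 9 * (a0 + a1 + a2) -> x2 + c2 + e2 < 2 / 9 * (a0 + a1 + a2) ->
  x3 + c3 + e3 < 2 / 9 * (a0 + a1 + a2) -> a2 <= e1 + e2 + e3 ->
  s1 + d2 + d3 <= x1 -> s2 + d1 + d3 <= x2 -> s3 + d1 + d2 <= x3 ->
  a1 <= s1 + s2 + s3 + d1 + d2 + d3 -> D = d1 + d2 + d3 ->
  d3 + D / 3 < s3 -> a0 <= c2 + c3 + 4 * s1 ->
  3 / 4 * D < s1.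
Proof.
move=> e30 c10 c20 c30 m1 m2 m3 E h1 h2 h3 t DE n3 q.
have : a0 + a1 > x1 + x2 + 5 / 2 * x3 + (c2 + c3) by clear -e30 m1 m2 m3 E c10 c20 c30; lra.
by clear -h1 h2 h3 t DE n3 q; lra.
Qed.

Lemma layers_three (R : realFieldType)
    (a0 a1 a2 x1 x2 x3 s1 s2 s3 d1 d2 d3 c1 c2 c3 e1 e2 e3 D : R) :
  0 <= e1 + e2 + e3 -> 0 <= c1 -> 0 <= c2 -> 0 <= c3 ->
  x1 + c1 + e1 < 2 / 9 * (a0 + a1 + a2) -> x2 + c2 + e2 < 2 / 9 * (a0 + a1 + a2) ->
  x3 + c3 + e3 < 2 / 9 * (a0 + a1 + a2) -> a2 <= e1 + e2 + e3 ->
  s1 + d2 + d3 <= x1 -> s2 + d1 + d3 <= x2 -> s3 + d1 + d2 <= x3 ->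
  a1 <= s1 + s2 + s3 + d1 + d2 + d3 -> D = d1 + d2 + d3 -> 0 <= D ->
  a0 <= c2 + c3 + 4 * s1 -> a0 <= c1 + c3 + 4 * s2 -> a0 <= c1 + c2 + 4 * s3 ->
  [/\ 3 / 4 * D < s1, 3 / 4 * D < s2 & 3 / 4 * D < s3].
Proof.
move=> e0 c10 c20 c30 m1 m2 m3 E h1 h2 h3 t DE D0 q1 q2 q3.
have k : a0 + a1 > 3 / 2 * (x1 + x2 + x3) + (c1 + c2 + c3) by clear -e0 m1 m2 m3 E c10 c20 c30; lra.
have k' : a0 - (c1 + c2 + c3) > (s1 + s2 + s3) / 2 + 2 * D by clear -k h1 h2 h3 t DE; lra.
(* The three halving bounds add up to 3 (a0 - c1 - c2 - c3) <= 4 (s1 + s2 + s3); inserted into [k']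
   this yields 12 / 5. Then 4 s_i > 16 D / 5 for each i. *)
have k3 : s1 + s2 + s3 > 12 / 5 * D.
  by clear -k' q1 q2 q3 c10 c20 c30; lra.
by split; [clear -k' k3 q1 c10 D0|clear -k' k3 q2 c20 D0|clear -k' k3 q3 c30 D0]; lra.
Qed.

(** Here [x], [c], [e] are the masses in layers 1, 0, 2. For each index either the other two traces
    cover layer 2, which gives the second alternative by [layers_pair], or halving bounds [a0],
    which gives the first one by a lemma depending on how many indices are of this kind. *)
Lemma layers_exceeds (R : realFieldType)
    (a0 a1 a2 x1 x2 x3 s1 s2 s3 d1 d2 d3 c1 c2 c3 e1 e2 e3 : R) :
  a0 < a1 + a2 -> a1 < a0 + a2 ->
  0 <= c1 -> 0 <= c2 -> 0 <= c3 -> 0 <= e1 -> 0 <= e2 -> 0 <= e3 ->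
  0 <= d1 -> 0 <= d2 -> 0 <= d3 ->
  x1 + c1 + e1 < 2 / 9 * (a0 + a1 + a2) -> x2 + c2 + e2 < 2 / 9 * (a0 + a1 + a2) ->
  x3 + c3 + e3 < 2 / 9 * (a0 + a1 + a2) -> a2 <= e1 + e2 + e3 ->
  s1 + d2 + d3 <= x1 -> s2 + d1 + d3 <= x2 -> s3 + d1 + d2 <= x3 ->
  a1 <= s1 + s2 + s3 + d1 + d2 + d3 ->
  (a2 <= e2 + e3) \/ (a0 <= c2 + c3 + 4 * s1) ->
  (a2 <= e1 + e3) \/ (a0 <= c1 + c3 + 4 * s2) ->
  (a2 <= e1 + e2) \/ (a0 <= c1 + c2 + 4 * s3) ->
  let D := d1 + d2 + d3 in
  [/\ exceeds s1 d1 D, exceeds s2 d2 D & exceeds s3 d3 D].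
Proof.
move=> ha0 ha1 c10 c20 c30 e10 e20 e30 d10 d20 d30 m1 m2 m3 E h1 h2 h3 t.
move=> P1 P2 P3 D; have DE : D = d1 + d2 + d3 by [].
have D0 : 0 <= D by rewrite !addr_ge0.
clearbody D.
have {}P1 : (d1 + D / 3 < s1) \/ (a0 <= c2 + c3 + 4 * s1).
  case: P1 => P; [left|by right].
  have := layers_pair ha0 c20 c30 c10 e10 m2 m3 m1 P.
  by clear -h1 h2 h3 t DE; lra.
have {}P2 : (d2 + D / 3 < s2) \/ (a0 <= c1 + c3 + 4 * s2).
  case: P2 => P; [left|by right].
  have := layers_pair ha0 c10 c30 c20 e20 m1 m3 m2 P.
  by clear -h1 h2 h3 t DE; lra.
have {}P3 : (d3 + D / 3 < s3) \/ (a0 <= c1 + c2 + 4 * s3).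
  case: P3 => P; [left|by right].
  have := layers_pair ha0 c10 c20 c30 e30 m1 m2 m3 P.
  by clear -h1 h2 h3 t DE; lra.
case: P1 => P1; case: P2 => P2; case: P3 => P3.
- by split; right.
- have : 3 / 4 * D < s3.
    apply: (@layers_one R a0 a1 a2 x3 x1 x2 s3 s1 s2 d3 d1 d2 c3 c1 c2 e3 e1 e2 D);
      first [assumption | by clear -E; lra | by clear -h1; lra | by clear -h2; lra
            | by clear -h3; lra | by clear -t; lra | by clear -DE; lra
            | by clear -P1; lra | by clear -P2; lra | by clear -P3; lra].
  by move=> ?; split; [right|right|left].
- have : 3 / 4 * D < s2.
    apply: (@layers_one R a0 a1 a2 x2 x1 x3 s2 s1 s3 d2 d1 d3 c2 c1 c3 e2 e1 e3 D);
      first [assumption | by clear -E; lra | by clear -h1; lra | by clear -h2; lra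
            | by clear -h3; lra | by clear -t; lra | by clear -DE; lra
            | by clear -P1; lra | by clear -P2; lra | by clear -P3; lra].
  by move=> ?; split; [right|left|right].
- have : 3 / 4 * D < s2.
    apply: (@layers_two R a0 a1 a2 x2 x3 x1 s2 s3 s1 d2 d3 d1 c2 c3 c1 e2 e3 e1 D);
      first [assumption | by clear -E; lra | by clear -h1; lra | by clear -h2; lra
            | by clear -h3; lra | by clear -t; lra | by clear -DE; lra
            | by clear -P1; lra | by clear -P2; lra | by clear -P3; lra].
  have : 3 / 4 * D < s3.
    apply: (@layers_two R a0 a1 a2 x3 x2 x1 s3 s2 s1 d3 d2 d1 c3 c2 c1 e3 e2 e1 D);
      first [assumption | by clear -E; lra | by clear -h1; lra | by clear -h2; lra
            | by clear -h3; lra | by clear -t; lra | by clear -DE; lra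
            | by clear -P1; lra | by clear -P2; lra | by clear -P3; lra].
  by move=> ? ?; split; [right|left|left].
- have : 3 / 4 * D < s1.
    apply: (@layers_one R a0 a1 a2 x1 x2 x3 s1 s2 s3 d1 d2 d3 c1 c2 c3 e1 e2 e3 D);
      first [assumption | by clear -E; lra | by clear -h1; lra | by clear -h2; lra
            | by clear -h3; lra | by clear -t; lra | by clear -DE; lra
            | by clear -P1; lra | by clear -P2; lra | by clear -P3; lra].
  by move=> ?; split; [left|right|right].
- have : 3 / 4 * D < s1.
    apply: (@layers_two R a0 a1 a2 x1 x3 x2 s1 s3 s2 d1 d3 d2 c1 c3 c2 e1 e3 e2 D);
      first [assumption | by clear -E; lra | by clear -h1; lra | by clear -h2; lra
            | by clear -h3; lra | by clear -t; lra | by clear -DE; lra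
            | by clear -P1; lra | by clear -P2; lra | by clear -P3; lra].
  have : 3 / 4 * D < s3.
    apply: (@layers_two R a0 a1 a2 x3 x1 x2 s3 s1 s2 d3 d1 d2 c3 c1 c2 e3 e1 e2 D);
      first [assumption | by clear -E; lra | by clear -h1; lra | by clear -h2; lra
            | by clear -h3; lra | by clear -t; lra | by clear -DE; lra
            | by clear -P1; lra | by clear -P2; lra | by clear -P3; lra].
  by move=> ? ?; split; [left|right|left].
- have : 3 / 4 * D < s1.
    apply: (@layers_two R a0 a1 a2 x1 x2 x3 s1 s2 s3 d1 d2 d3 c1 c2 c3 e1 e2 e3 D);
      first [assumption | by clear -E; lra | by clear -h1; lra | by clear -h2; lra
            | by clear -h3; lra | by clear -t; lra | by clear -DE; lra
            | by clear -P1; lra | by clear -P2; lra | by clear -P3; lra].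
  have : 3 / 4 * D < s2.
    apply: (@layers_two R a0 a1 a2 x2 x1 x3 s2 s1 s3 d2 d1 d3 c2 c1 c3 e2 e1 e3 D);
      first [assumption | by clear -E; lra | by clear -h1; lra | by clear -h2; lra
            | by clear -h3; lra | by clear -t; lra | by clear -DE; lra
            | by clear -P1; lra | by clear -P2; lra | by clear -P3; lra].
  by move=> ? ?; split; [left|left|right].
- have [] := @layers_three R a0 a1 a2 x1 x2 x3 s1 s2 s3 d1 d2 d3 c1 c2 c3 e1 e2 e3 D;
    try assumption.
    by rewrite !addr_ge0.
  by move=> ? ? ?; split; left.
Qed.

(** * Planar Lebesgue measure *)

(** Uniqueness of Lebesgue measure: the pushforward scaled by |a| agrees with it on half-open
    intervals, whose preimages are closed on the other side if [a] is negative. *)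
Lemma lebesgue_measure_affine (R : realType) (a b : R) (A : set (measurableTypeR R)) :
  a != 0 -> measurable A ->
  (`|a|%:E * lebesgue_measure ((fun y : R => a * y + b)%R @^-1` A) =
   lebesgue_measure A)%E.
Proof.
move=> a0 mA.
pose f (y : measurableTypeR R) : measurableTypeR R := a * y + b.
have mf : measurable_fun setT f.
  by apply: measurable_funD => //; apply: measurable_funM.
pose p := measure_function_pushforward__canonical__measure_function_Measure
  (@lebesgue_measure R) mf.
pose mu := mscale (NngNum (normr_ge0 a)) p.
rewrite [RHS](_ : _ = mu A)//; move: A mA.
apply: lebesgue_measure_unique => X [[x y] _ <-] /=.
rewrite /mu /mscale/= /pushforward.
have [a_lt0|a_gt0|a_eq0] := ltgtP a 0; last by rewrite a_eq0 eqxx in a0.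
- rewrite [f @^-1` _](_ : _ = [set` `[(y - b) / a, (x - b) / a[]); last first.
    apply/seteqP; split => z /=; rewrite !in_itv/= /f => /andP[h1 h2];
      apply/andP; (split; [move: h2|move: h1]).
    + by rewrite ler_ndivrMr// lerBrDr mulrC.
    + by rewrite ltr_ndivlMr// ltrBlDr mulrC.
    + by rewrite ltr_ndivlMr// ltrBlDr mulrC.
    + by rewrite ler_ndivrMr// lerBrDr mulrC.
  rewrite !lebesgue_measure_itv/= !lte_fin ltr_nM2r ?invr_lt0// ltrBlDr subrK.
  case: ifPn => _; last by rewrite mule0.
  rewrite -!EFinB -EFinM ltr0_norm//; congr EFin; field.
  by rewrite lt_eqF.
- rewrite [f @^-1` _](_ : _ = [set` `](x - b) / a, (y - b) / a]]); last first.
    apply/seteqP; split => z /=; rewrite !in_itv/= /f => /andP[h1 h2];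
      apply/andP; (split; [move: h1|move: h2]).
    + by rewrite ltr_pdivrMr// ltrBlDr mulrC.
    + by rewrite ler_pdivlMr// lerBrDr mulrC.
    + by rewrite ltr_pdivrMr// ltrBlDr mulrC.
    + by rewrite ler_pdivlMr// lerBrDr mulrC.
  rewrite !lebesgue_measure_itv/= !lte_fin ltr_pM2r ?invr_gt0// ltrBlDr subrK.
  case: ifPn => _; last by rewrite mule0.
  rewrite -!EFinB -EFinM gtr0_norm//; congr EFin; field.
  by rewrite gt_eqF.
Qed.

Notation plane R := (measurableTypeR R * measurableTypeR R)%type.

Lemma measurable_linear_form (R : realType) (p q e : R) :
  measurable_fun setT (fun z : measurableTypeR R * measurableTypeR R =>
    p * z.1 + q * z.2 + e).
Proof.
apply: measurable_funD => //; apply: measurable_funD; apply: measurable_funM => //.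
Qed.

Lemma area_shear_y (R : realType) (k a b : R) (E : set (R * R)) :
  a != 0 -> measurable (E : set (measurableTypeR R * measurableTypeR R)) ->
  (`|a|%:E * area ((fun z => (z.1, k * z.1 + a * z.2 + b)%R) @^-1` E) = area E)%E.
Proof.
move=> a0 mE; rewrite /area /product_measure1.
set F := _ @^-1` _.
have mF : measurable (F : set (measurableTypeR R * measurableTypeR R)).
  rewrite -[F]setTI; apply: (_ : measurable_fun setT _) => //.
  by apply/measurable_fun_pairP; split; [exact: measurable_fst|exact: measurable_linear_form].
rewrite -ge0_integralZl//; last exact: measurable_fun_xsection.
apply: eq_integral => x _ /=.
rewrite -(@lebesgue_measure_affine R a (k * x + b) (xsection E x) a0); last first.
  exact: measurable_xsection.
congr (_ * lebesgue_measure _)%E; apply/seteqP; split => y; rewrite /xsection/=;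
  by rewrite !inE /F/= addrAC addrC addrA.
Qed.

Lemma measurable_swap (R : realType) (E : set (R * R)) :
  measurable (E : set (plane R)) ->
  measurable ((fun z => (z.2, z.1)) @^-1` E : set (plane R)).
Proof.
move=> mE; rewrite -[X in measurable X]setTI; apply: (_ : measurable_fun setT _) => //.
by apply/measurable_fun_pairP; split; [exact: measurable_snd|exact: measurable_fst].
Qed.

Lemma area_swap (R : realType) (E : set (R * R)) :
  measurable (E : set (measurableTypeR R * measurableTypeR R)) ->
  area ((fun z => (z.2, z.1)) @^-1` E) = area E.
Proof.
move=> mE; rewrite /area.
transitivity (product_measure2 lebesgue_measure lebesgue_measure E).
  rewrite /product_measure1 /product_measure2; apply: eq_integral => x _ /=.
  by congr lebesgue_measure; apply/seteqP; split => y; rewrite /xsection /ysection/= !inE.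
by symmetry; apply: product_measure_unique => //= *; rewrite product_measure2E.
Qed.

Definition affine_map (R : realType) (p q e r s f : R) (z : R * R) : R * R :=
  (p * z.1 + q * z.2 + e, r * z.1 + s * z.2 + f).

Lemma measurable_affine_preimage (R : realType) (p q e r s f : R) (E : set (R * R)) :
  measurable (E : set (plane R)) ->
  measurable (affine_map p q e r s f @^-1` E : set (plane R)).
Proof.
move=> mE; rewrite -[X in measurable X]setTI; apply: (_ : measurable_fun setT _) => //.
by apply/measurable_fun_pairP; split; exact: measurable_linear_form.
Qed.

(** For [s != 0] the map factors into two vertical shears separated by coordinate swaps, with scale
    factors [s] and the determinant divided by [s]. The case [s = 0] follows by exchanging the
    rows. *)
Lemma area_affine (R : realType) (p q e r s f : R) (E : set (R * R)) :
  p * s - q * r != 0 -> measurable (E : set (plane R)) ->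
  (`|p * s - q * r|%:E * area (affine_map p q e r s f @^-1` E) = area E)%E.
Proof.
wlog s0 : p q e r s f E / s != 0.
  move=> H; have [->|s0] := eqVneq s 0; last exact: H.
  have [->|q0] := eqVneq q 0; first by rewrite mulr0 mul0r subrr eqxx.
  move=> d0 mE.
  pose E' : set (R * R) := (fun z => (z.2, z.1)) @^-1` E.
  have mE' : measurable (E' : set (plane R)).
    exact: measurable_swap mE.
  rewrite mulr0 sub0r oppr_eq0 in d0.
  rewrite -(area_swap mE) -/E' -(H r 0 f p q e E')//; last first.
    by rewrite mul0r subr0 mulrC.
  by rewrite mulr0 mul0r sub0r subr0 normrN mulrC.
move=> d0 mE.
pose k := q / s; pose al := p - q * r / s.
have al0 : al != 0.
  have -> : al = (p * s - q * r) / s by rewrite /al; field.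
  by rewrite mulf_neq0// invr_eq0.
pose E' : set (R * R) := (fun z => (z.2, z.1)) @^-1` E.
rewrite -(area_swap mE) -/E'.
have mE' : measurable (E' : set (plane R)).
  exact: measurable_swap mE.
pose G (z : R * R) := (z.1, k * z.1 + al * z.2 + (e - k * f)).
rewrite -(@area_shear_y _ k al (e - k * f) E' al0 mE') -/G.
set E2 := G @^-1` E'.
have mE2 : measurable (E2 : set (plane R)).
  rewrite /E2 -[X in measurable X]setTI; apply: (_ : measurable_fun setT _) => //.
  by apply/measurable_fun_pairP; split;
    [exact: measurable_fst|exact: measurable_linear_form].
pose E3 : set (R * R) := (fun z => (z.2, z.1)) @^-1` E2.
rewrite -(area_swap mE2) -/E3.
have mE3 : measurable (E3 : set (plane R)).
  exact: measurable_swap mE2.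
rewrite -(@area_shear_y _ r s f E3 s0 mE3) muleA -EFinM -normrM.
have -> : al * s = p * s - q * r by rewrite /al; field.
congr (_ * area _)%E; apply/seteqP; split => -[x y];
  rewrite /E3 /E2 /E' /G /affine_map/=;
  by have -> : k * (r * x + s * y + f) + al * x + (e - k * f) = p * x + q * y + e
    by rewrite /k /al; field.
Qed.

(** Measurability refers to the product sigma-algebra, hence the countable union of rational
    boxes. *)
Lemma open_measurable_plane (R : realType) (U : set (R * R)) :
  open U -> measurable (U : set (plane R)).
Proof.
move=> oU.
pose box (i : rat * rat * rat * rat) : set (R * R) :=
  [set` `]ratr i.1.1.1, ratr i.1.1.2[] `*` [set` `]ratr i.1.2, ratr i.2[].
pose F i := if pselect (box i `<=` U) then box i else set0.
have -> : U = \bigcup_i F i.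
  apply/seteqP; split => [[x y] /= Uxy|z [i _]]; last first.
    by rewrite /F; case: pselect => // BU; exact: BU.
  have /nbhs_ballP[e /= e0 eU] : nbhs (x, y) U by exact: open_nbhs_nbhs.
  have [a] := @rat_in_itvoo R (x - e) x ltac:(lra).
  have [b] := @rat_in_itvoo R x (x + e) ltac:(lra).
  have [c] := @rat_in_itvoo R (y - e) y ltac:(lra).
  have [d] := @rat_in_itvoo R y (y + e) ltac:(lra).
  rewrite !in_itv/= => /andP[d1 d2] /andP[c1 c2] /andP[b1 b2] /andP[a1 a2].
  exists (a, b, c, d) => //; rewrite /F; case: pselect => [BU|nBU].
    by split; rewrite /= in_itv/= ?a2 ?b1 ?c2 ?d1.
  exfalso; apply: nBU => -[u w] [/=]; rewrite !in_itv/= => /andP[u1 u2] /andP[w1 w2].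
  apply: eU; split; rewrite /ball/= ltr_norml; apply/andP; split; lra.
apply: countable_bigcupT_measurable => //= i; rewrite /F.
case: pselect => ?; last exact: measurable0.
by apply: measurableX; exact: measurable_itv.
Qed.

Lemma compact_measurable_plane (R : realType) (A : set (R * R)) :
  compact A -> measurable (A : set (plane R)).
Proof.
move=> cA; rewrite -[A]setCK; apply: measurableC; apply: open_measurable_plane.
by apply: closed_openC; apply: compact_closed => //; exact: norm_hausdorff.
Qed.

Lemma compact_plane_box (R : realType) (A : set (R * R)) :
  compact A -> exists2 M : R, 0 < M & A `<=` [set` `[- M, M]] `*` [set` `[- M, M]].
Proof.
move=> /compact_bounded/ex_strict_bound_gt0[M M0 AM].
exists M => // -[x y] /AM /=; rewrite /Num.norm/= gt_max => /andP[/= hx hy].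
by rewrite /setX/= !in_itv/= -!ler_norml; split; exact: ltW.
Qed.

Lemma compact_area_fin (R : realType) (A : set (R * R)) :
  compact A -> (area A < +oo)%E.
Proof.
move=> cA; have [M M0 AM] := compact_plane_box cA.
rewrite /area (@le_lt_trans _ _ ((lebesgue_measure \x lebesgue_measure)%E
  ([set` `[- M, M]] `*` [set` `[- M, M]] : set (R * R))))//.
  apply: le_measure => //; rewrite inE; first exact: compact_measurable_plane.
  by apply: measurableX; exact: measurable_itv.
have mI : measurable ([set` `[- M, M]] : set (measurableTypeR R)) by exact: measurable_itv.
rewrite (product_measure1E _ _ mI mI).
by rewrite /= lebesgue_measure_itv/=; case: ifPn => _; rewrite -?EFinB -?EFinM ?mule0 ltry.
Qed.

Lemma measurable_halfplane (R : realType) (p q c : R) :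
  measurable ([set z | p * z.1 + q * z.2 <= c] : set (plane R)).
Proof.
rewrite (_ : [set _ | _] =
    (fun z : plane R => p * z.1 + q * z.2 + 0) @^-1` [set` `]-oo, c]]).
  rewrite -[X in measurable X]setTI; have := @measurable_linear_form R p q 0 measurableT _ (measurable_itv `]-oo, c]).
  exact.
by apply/seteqP; split => z /=; rewrite in_itv/= addr0.
Qed.

(** The map with rows (p, q) and (-q, p) has determinant p^2 + q^2 and, suitably shifted, pulls the
    vertical axis back to the line. *)
Lemma area_line (R : realType) (p q c : R) : (p, q) != 0 ->
  area [set z : R * R | p * z.1 + q * z.2 = c] = 0%E.
Proof.
move=> pq0.
have d0 : p * p - q * (- q) != 0.
  rewrite mulrN opprK; apply: contra pq0 => h.
  rewrite -!expr2 paddr_eq0 ?sqr_ge0// !sqrf_eq0 in h.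
  by case/andP: h => /eqP -> /eqP ->.
pose L : set (R * R) := [set` `[0, 0]] `*` setT.
have mL : measurable (L : set (plane R)).
  by apply: measurableX => //; exact: measurable_itv.
have := @area_affine R p q (- c) (- q) p 0 L d0 mL.
have -> : area L = 0%E.
  have m0 : measurable ([set` `[0, 0]] : set (measurableTypeR R)) by exact: measurable_itv.
  rewrite /area /L (product_measure1E _ _ m0 measurableT).
  by rewrite /= lebesgue_measure_itv/= ltxx mul0e.
rewrite (_ : _ @^-1` _ = [set z | p * z.1 + q * z.2 = c]).
  move/eqP; rewrite mule_eq0 => /orP[|/eqP//].
  by rewrite eqe normr_eq0 (negbTE d0).
apply/seteqP; split => z; rewrite /affine_map /L /setX/=.
  by rewrite in_itv/= -eq_le eq_sym subr_eq0 => -[/eqP].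
by move=> ->; rewrite subrr in_itv/= lexx.
Qed.

Lemma area_point (R : realType) (v : R * R) : area [set v] = 0%E.
Proof.
apply/eqP; rewrite eq_le; apply/andP; split; last exact: measure_ge0.
rewrite -(@area_line R 1 0 v.1); last by rewrite xpair_eqE oner_eq0.
apply: le_measure; rewrite ?inE.
- rewrite (_ : [set v] = [set v.1] `*` [set v.2]).
    by apply: measurableX; exact: measurable_set1.
  by apply/seteqP; split => [z ->|[x y] [/= -> ->]] //; case: (v).
- rewrite (_ : [set _ | _] = [set v.1] `*` setT).
    by apply: measurableX => //; exact: measurable_set1.
  by apply/seteqP; split => z; rewrite /setX/= mul1r mul0r addr0 // => -[].
- by move=> z ->; rewrite /= mul1r mul0r addr0.
Qed.

(** * Areas as real numbers *)

Definition fin_area (R : realType) (A : set (R * R)) : Prop :=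
  measurable (A : set (plane R)) /\ (area A < +oo)%E.

(** [fine] sends infinity to 0, so inequalities between values of [rarea] ask for [fin_area]. *)
Definition rarea (R : realType) (A : set (R * R)) : R := fine (area A).

Definition dot (R : realType) (u x : R * R) : R := u.1 * x.1 + u.2 * x.2.

Definition hplane (R : realType) (u : R * R) (c : R) : set (R * R) :=
  [set x | dot u x <= c].

Lemma area_ge0 (R : realType) (A : set (R * R)) : (0 <= area A)%E.
Proof. exact: measure_ge0. Qed.

Lemma rareaK (R : realType) (A : set (R * R)) :
  (area A < +oo)%E -> (rarea A)%:E = area A.
Proof. by move=> h; rewrite /rarea fineK// ge0_fin_numE// area_ge0. Qed.

Lemma rarea_ge0 (R : realType) (A : set (R * R)) : 0 <= rarea A.
Proof. exact/fine_ge0/area_ge0. Qed.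

Lemma le_area (R : realType) (A B : set (R * R)) :
  measurable (A : set (plane R)) -> measurable (B : set (plane R)) ->
  A `<=` B -> (area A <= area B)%E.
Proof. by move=> mA mB AB; apply: le_measure => //; rewrite inE. Qed.

Lemma fin_areaS (R : realType) (A B : set (R * R)) :
  measurable (A : set (plane R)) -> fin_area B -> A `<=` B -> fin_area A.
Proof. by move=> mA [mB fB] AB; split => //; apply: le_lt_trans fB; exact: le_area. Qed.

Lemma fin_areaIl (R : realType) (A B : set (R * R)) :
  fin_area A -> measurable (B : set (plane R)) -> fin_area (A `&` B).
Proof.
move=> fA mB; apply: (fin_areaS _ fA); last exact: subIsetl.
by apply: measurableI => //; case: fA.
Qed.

Lemma fin_area_compact (R : realType) (A : set (R * R)) : compact A -> fin_area A.
Proof. by split; [exact: compact_measurable_plane|exact: compact_area_fin]. Qed.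

Lemma measurable_hplane (R : realType) (u : R * R) (c : R) :
  measurable (hplane u c : set (plane R)).
Proof. exact: measurable_halfplane. Qed.

Lemma le_rarea (R : realType) (A B : set (R * R)) :
  measurable (A : set (plane R)) -> fin_area B -> A `<=` B -> rarea A <= rarea B.
Proof.
move=> mA fB AB; have [_ fA] := fin_areaS mA fB AB; case: fB => mB fB.
by rewrite -lee_fin !rareaK//; exact: le_area.
Qed.

Lemma area_setU_le (R : realType) (A B : set (R * R)) :
  measurable (A : set (plane R)) -> measurable (B : set (plane R)) ->
  (area (A `|` B) <= area A + area B)%E.
Proof. exact: measureU2. Qed.

Lemma fin_areaU (R : realType) (A B : set (R * R)) :
  fin_area A -> fin_area B -> fin_area (A `|` B).
Proof.
move=> [mA fA] [mB fB]; split; first exact: measurableU.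
by apply: le_lt_trans (area_setU_le mA mB) _; exact: lte_add_pinfty.
Qed.

Lemma rareaU_le (R : realType) (A B : set (R * R)) :
  fin_area A -> fin_area B -> rarea (A `|` B) <= rarea A + rarea B.
Proof.
move=> fA fB; have [_ fAB] := fin_areaU fA fB.
rewrite -lee_fin EFinD (rareaK fAB) (rareaK fA.2) (rareaK fB.2).
exact: area_setU_le fA.1 fB.1.
Qed.

Lemma rareaU (R : realType) (A B : set (R * R)) :
  fin_area A -> fin_area B -> A `&` B = set0 ->
  rarea (A `|` B) = rarea A + rarea B.
Proof.
move=> [mA fA] [mB fB] AB.
have E := @measureU _ _ _ (lebesgue_measure \x lebesgue_measure)%E A B mA mB AB.
by rewrite /rarea -fineD ?ge0_fin_numE ?area_ge0// /area -E.
Qed.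

Lemma rarea_point (R : realType) (v : R * R) : rarea [set v] = 0.
Proof. by rewrite /rarea area_point. Qed.

Lemma fin_area_point (R : realType) (v : R * R) : fin_area [set v].
Proof. by apply: fin_area_compact; exact: compact_set1. Qed.

Lemma rarea_affine (R : realType) (p q e r s f : R) (E : set (R * R)) :
  p * s - q * r != 0 -> measurable (E : set (plane R)) ->
  `|p * s - q * r| * rarea (affine_map p q e r s f @^-1` E) = rarea E.
Proof.
move=> d0 mE; rewrite /rarea -(area_affine e f d0 mE).
set X := area _; have := area_ge0 (affine_map p q e r s f @^-1` E); rewrite -/X.
have : 0 < `|p * s - q * r| by rewrite normr_gt0.
case: X => [x| |] // n0 _; rewrite ?mulr0; by rewrite gt0_muley.
Qed.

(** Phrased by a pointwise inclusion instead of an image of [B]: the area formula is for preimages,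
    and the preimage of [E] contains [B]. *)
Lemma rarea_homothety (R : realType) (s : R) (q : R * R) (B E : set (R * R)) :
  0 < s -> measurable (B : set (plane R)) -> fin_area E ->
  (forall b, B b -> E (s *: b + q)) -> s ^+ 2 * rarea B <= rarea E.
Proof.
move=> s0 mB fE BE.
have d0 : s * s - 0 * 0 != 0 by rewrite mulr0 subr0 mulf_neq0// lt0r_neq0.
have dE : `|s * s - 0 * 0| = s ^+ 2.
  by rewrite mulr0 subr0 expr2 ger0_norm// mulr_ge0// ltW.
have E1 := @area_affine R s 0 q.1 0 s q.2 E d0 fE.1.
have E2 := @rarea_affine R s 0 q.1 0 s q.2 E d0 fE.1.
set F := _ @^-1` E in E1 E2; rewrite dE in E1 E2.
have mF : measurable (F : set (plane R)) by exact: measurable_affine_preimage fE.1.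
have fF : fin_area F.
  split => //; case: (area F) (area_ge0 F) E1 => [x _ _|_ h2|//]; first exact: ltry.
  by move: fE.2; rewrite -h2 gt0_muley// lte_fin exprn_gt0.
rewrite -E2 ler_pM2l ?exprn_gt0//; apply: (le_rarea mB fF).
by move=> [x y] /BE; rewrite /F /affine_map /= !mul0r add0r addr0.
Qed.

Lemma rarea_half (R : realType) (q : R * R) (B E : set (R * R)) :
  measurable (B : set (plane R)) -> fin_area E ->
  (forall b, B b -> E (2^-1 *: (b + q))) -> rarea B <= 4 * rarea E.
Proof.
move=> mB fE BE.
have h0 : 0 < 2^-1 :> R by rewrite invr_gt0.
have hom b : B b -> E (2^-1 *: b + 2^-1 *: q) by rewrite -scalerDr; exact: BE.
have := rarea_homothety h0 mB fE hom.
by clear; move: (rarea _) (rarea _) => x y; lra.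
Qed.

(** Continuity from above along the bounds c + 1 / (n + 1). It makes badness of a half-plane an open
    condition on the bound. *)
Lemma hplane_area_right_continuous (R : realType) (A : set (R * R)) (u : R * R) (c d : R) :
  fin_area A -> 0 < d ->
  exists2 e, 0 < e & rarea (A `&` hplane u (c + e)) < rarea (A `&` hplane u c) + d.
Proof.
move=> fA d0.
pose F n : set (plane R) := A `&` hplane u (c + n.+1%:R^-1).
have mF n : measurable (F n).
  by apply: measurableI; [case: fA|exact: measurable_hplane].
have ffin n : fin_area (F n) by apply: fin_areaIl => //; exact: measurable_hplane.
have capF : \bigcap_n F n = A `&` hplane u c.
  apply/seteqP; split => x /=.
    move=> Fx; split; first by have [] := Fx 0%N I.
    rewrite /hplane/=; apply/ler_addgt0Pr => e e0.
    have [N] := near_infty_natSinv_lt (PosNum e0).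
    move=> _ /(_ N (leqnn N)) /= h; have [_ h'] := Fx N I.
    by rewrite (le_trans h')// lerD2l ltW.
  move=> [Ax h] n _; split=> //; rewrite /hplane/= (le_trans h)// lerDl.
  by rewrite invr_ge0.
have fC : fin_area (A `&` hplane u c).
  by apply: fin_areaIl => //; exact: measurable_hplane.
have cv := @nonincreasing_cvg_mu _ _ _
  ((lebesgue_measure \x lebesgue_measure)%E : {measure set (plane R) -> \bar R}) F
  (ffin 0%N).2 mF.
have mcap : measurable (\bigcap_n F n) by rewrite capF; case: fC.
have {}cv := cv mcap.
have dec : {homo F : n m / (n <= m)%N >-> (m <= n)%O}.
  move=> n m nm; apply/subsetPset => x [Ax h]; split=> //.
  by rewrite /hplane/= (le_trans h)// lerD2l lef_pV2 ?posrE ?ltr0n// ler_nat.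
have {}cv := cv dec.
have : \forall n \near \oo, (area (F n) < (rarea (A `&` hplane u c) + d)%:E)%E.
  apply: (cv [set y | (y < _)%E]); rewrite capF.
  apply: open_ereal_lt'; rewrite -[X in (X < _)%E](rareaK fC.2) lte_fin.
  by rewrite ltrDl.
move=> [N _ /(_ N (leqnn N)) /= h]; exists N.+1%:R^-1; first by rewrite invr_gt0 ltr0n.
by rewrite -lte_fin (rareaK (ffin N).2).
Qed.

(** * Areas of triangles *)

Definition cross (R : realType) (a b : R * R) : R := a.1 * b.2 - a.2 * b.1.

(* The triangle 0, a, b in barycentric coordinates; junk if [cross a b = 0]. *)
Definition triangle (R : realType) (a b : R * R) : set (R * R) :=
  [set z | [/\ 0 <= cross z b / cross a b, 0 <= cross a z / cross a b &
            cross z b / cross a b + cross a z / cross a b <= 1]].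

Definition simplex (R : realType) : set (R * R) :=
  [set z | [/\ 0 <= z.1, 0 <= z.2 & z.1 + z.2 <= 1]].
Arguments simplex R : clear implicits.

Lemma simplex_hplane (R : realType) : simplex R =
  hplane (-1, 0) 0 `&` hplane (0, -1) 0 `&` hplane (1, 1) 1.
Proof.
apply/seteqP; rewrite /simplex /hplane /dot; split => z /=.
  by case=> h1 h2 h3; split; [split|]; lra.
by case=> -[h1 h2] h3; split; lra.
Qed.

Lemma fin_area_simplex (R : realType) : fin_area (simplex R).
Proof.
have mI : measurable ([set` `[0, 1]] : set (measurableTypeR R)) by exact: measurable_itv.
have f1 : fin_area ([set` `[0, 1]] `*` [set` `[0, 1]] : set (R * R)).
  split; first exact: measurableX.
  rewrite /area (product_measure1E _ _ mI mI) /= lebesgue_measure_itv/= lte_fin ltr01.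
  by rewrite -EFinD -EFinM ltry.
apply: (fin_areaS _ f1).
  rewrite simplex_hplane; apply: measurableI; first apply: measurableI;
  exact: measurable_hplane.
by move=> [x y] [/= h1 h2 h3]; split; rewrite /= in_itv/=; apply/andP; split; lra.
Qed.

(** The point reflection z -> (1, 1) - z carries the simplex to the other half of the unit square,
    and the two halves meet in a segment of area zero. *)
Lemma area_simplex (R : realType) : rarea (simplex R) = 2^-1.
Proof.
have mI : measurable ([set` `[0, 1]] : set (measurableTypeR R)) by exact: measurable_itv.
pose sq : set (R * R) := [set` `[0, 1]] `*` [set` `[0, 1]].
have sqE : area sq = 1%E.
  rewrite /area (product_measure1E _ _ mI mI) /= lebesgue_measure_itv/= lte_fin ltr01.
  by rewrite -EFinD -EFinM subr0 mulr1.
have fsq : fin_area sq.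
  by split; [exact: measurableX|rewrite sqE ltry].
pose f := affine_map (-1) 0 1 0 (-1) (1 : R).
pose D := simplex R; pose D' := f @^-1` D.
have fD := fin_area_simplex R.
have mD' : measurable (D' : set (plane R)) by apply: measurable_affine_preimage fD.1.
have d0 : (-1) * (-1) - 0 * 0 != 0 :> R by rewrite mulr0 subr0 mulrNN mulr1 oner_eq0.
have eD' : rarea D' = rarea D.
  rewrite -(rarea_affine 1 1 d0 fD.1) mulr0 subr0 mulrNN mulr1 normr1 mul1r.
  by [].
have D'sq : D' `<=` sq.
  move=> [x y]; rewrite /D' /D /f /simplex /affine_map /sq /= => -[h1 h2 h3].
  by split; rewrite /= in_itv/=; apply/andP; clear -h1 h2 h3; split; lra.
have Dsq : D `<=` sq.
  move=> [x y]; rewrite /D /simplex /sq /= => -[h1 h2 h3].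
  by split; rewrite /= in_itv/=; apply/andP; clear -h1 h2 h3; split; lra.
have fD' : fin_area D' by apply: fin_areaS D'sq.
have sq1 : rarea sq = 1 by rewrite /rarea sqE.
have ge : 1 <= rarea D + rarea D'.
  rewrite -sq1; apply: le_trans (rareaU_le fD fD').
  apply: le_rarea (fin_areaU fD fD') _; first exact: measurableX.
  move=> [x y] [/=]; rewrite !in_itv/= => /andP[x0 x1] /andP[y0 y1].
  have [h|h] := leP (x + y) 1; [left|right];
  rewrite /D' /D /f /simplex /affine_map/=; clear -x0 x1 y0 y1 h; split; lra.
pose L : set (R * R) := [set z | 1 * z.1 + 1 * z.2 = 1].
have L0 : area L = 0%E by apply: area_line; rewrite xpair_eqE oner_eq0.
have mL : measurable (L : set (plane R)).
  rewrite (_ : L = hplane (1, 1) 1 `&` hplane (-1, -1) (-1)).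
    by apply: measurableI; exact: measurable_hplane.
  apply/seteqP; rewrite /L /hplane /dot; split => z /=.
    by move=> h; clear -h; split; lra.
  by case=> h1 h2; clear -h1 h2; lra.
have fL : fin_area L by split; [exact: mL|rewrite L0 ltry].
have fDL : fin_area (D' `\` L).
  by apply: (fin_areaS _ fD'); [exact: measurableD|exact: subIsetl].
have le : rarea D + rarea (D' `\` L) <= 1.
  rewrite -sq1 -(rareaU fD fDL).
    apply: (le_rarea (fin_areaU fD fDL).1 fsq).
    by move=> z [/Dsq//|[/D'sq]].
  apply/seteqP; split => // -[x y]; rewrite /D' /D /f /simplex /affine_map /L/=.
  by case=> -[h1 h2 h3] [[h4 h5 h6]]; apply; clear -h3 h6; lra.
have : rarea D' <= rarea (D' `\` L) + rarea L.
  apply: le_trans (rareaU_le fDL fL).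
  apply: (le_rarea mD' (fin_areaU fDL fL)) => z D'z.
  by have [Lz|nLz] := pselect (L z); [right|left].
have L1 : rarea L = 0 by rewrite /rarea L0.
move: ge le; rewrite L1 eD' addr0; clear; move: (rarea _) (rarea _) => x y; lra.
Qed.

Lemma triangle_affine (R : realType) (a b : R * R) : cross a b != 0 ->
  triangle a b = affine_map (b.2 / cross a b) (- b.1 / cross a b) 0
     (- a.2 / cross a b) (a.1 / cross a b) 0 @^-1` (simplex R).
Proof.
move=> d0; apply/seteqP; rewrite /triangle /simplex /affine_map /=.
have e1 (z : R * R) : b.2 / cross a b * z.1 + - b.1 / cross a b * z.2 + 0 = cross z b / cross a b.
  by rewrite [in RHS]/cross; ring.
have e2 (z : R * R) : - a.2 / cross a b * z.1 + a.1 / cross a b * z.2 + 0 = cross a z / cross a b.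
  by rewrite [cross a z]/cross; ring.
by split => z /=; rewrite e1 e2.
Qed.

Lemma fin_area_triangle (R : realType) (a b : R * R) : cross a b != 0 ->
  fin_area (triangle a b) /\ rarea (triangle a b) = `|cross a b| / 2.
Proof.
move=> d0; have fS := fin_area_simplex R.
set p := b.2 / cross a b; set q := - b.1 / cross a b.
set r := - a.2 / cross a b; set s := a.1 / cross a b.
have dE : p * s - q * r = (cross a b)^-1.
  have : a.1 * b.2 - a.2 * b.1 = cross a b by [].
  rewrite /p /q /r /s; move: (cross a b) d0 => d d0 E.
  transitivity ((a.1 * b.2 - a.2 * b.1) / d ^+ 2); first by field.
  by rewrite E; field.
have d1 : p * s - q * r != 0 by rewrite dE invr_eq0.
rewrite (triangle_affine d0) -/p -/q -/r -/s; set T := _ @^-1` _.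
have mT : measurable (T : set (plane R)) by apply: measurable_affine_preimage fS.1.
have E := @area_affine R p q 0 r s 0 (simplex R) d1 fS.1.
have E' := @rarea_affine R p q 0 r s 0 (simplex R) d1 fS.1.
rewrite -/T dE normfV in E E'.
split; first split => //.
  case: (area T) (area_ge0 T) E => [x _ _|_ h2|//]; first exact: ltry.
  by move: fS.2; rewrite -h2 gt0_muley// lte_fin invr_gt0 normr_gt0.
rewrite area_simplex in E'.
by apply: (mulfI (x := `|cross a b|^-1)); rewrite ?invr_eq0 ?normr_eq0// E' mulKf// normr_eq0.
Qed.

(** * The hexagon of sectors around a point *)

Definition comb (R : realType) (u w : R * R) (x y : R) : R * R :=
  (x * u.1 + y * w.1, x * u.2 + y * w.2).

Lemma combE (R : realType) (u w : R * R) (x y : R) :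
  comb u w x y = x *: u + y *: w.
Proof. by []. Qed.

(** Convexity with a bare real parameter and explicit coordinates, in which [ring] and [field] can
    compute. *)
Definition pconvex (R : realType) (A : set (R * R)) : Prop :=
  forall a b t, A a -> A b -> 0 <= t <= 1 -> A (comb a b (1 - t) t).

Lemma comb_cross (R : realType) (u w z : R * R) : cross u w = 1 ->
  z = comb u w (cross z w) (cross u z).
Proof.
case: u w z => [u1 u2] [w1 w2] [z1 z2]; rewrite /comb /cross /= => h.
by congr pair; rewrite -[LHS]mul1r -h; ring.
Qed.

Lemma cross_comb (R : realType) (u w : R * R) x y x' y' : cross u w = 1 ->
  cross (comb u w x y) (comb u w x' y') = x * y' - y * x'.
Proof.
case: u w => [u1 u2] [w1 w2]; rewrite /comb /cross /= => h.
by rewrite -[RHS]mulr1 -h; ring.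
Qed.

(** The segment from the given point to the end of the body on u - w crosses the ray of [u] at ((x +
    y) / (1 + y b)) u, and maximality of 1 / a applies there. *)
Lemma pconvex_wedge (R : realType) (A : set (R * R)) (u w : R * R) (a b x y : R) :
  pconvex A -> 0 < a -> 0 < b -> 0 <= x -> 0 <= y ->
  A (comb u w b^-1 (- b^-1)) ->
  (forall t, A (comb u w t 0) -> t * a <= 1) ->
  A (comb u w x y) -> a * x + (a - b) * y <= 1.
Proof.
move=> cA a0 b0 x0 y0 Ab amax Az.
have yb0 : 0 <= y * b by rewrite mulr_ge0// ltW.
have k0 : 0 < 1 + y * b by rewrite ltr_wpDr.
have kn := lt0r_neq0 k0; have bn := lt0r_neq0 b0.
have t01 : 0 <= y * b / (1 + y * b) <= 1.
  by rewrite divr_ge0 ?(ltW k0)//= ler_pdivrMr// mul1r lerDr.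
have := cA _ _ _ Az Ab t01.
rewrite (_ : comb _ _ _ _ = comb u w ((x + y) / (1 + y * b)) 0); last first.
  rewrite /comb /=; congr pair; field; by rewrite kn bn.
move=> /amax; rewrite mulrAC ler_pdivrMr// mul1r; clear; lra.
Qed.

(** In coordinates along [u] and [w] the two bounding lines are a x + (a - b) y = 1 and (c - d) x +
    c y = 1. When they form a quadrilateral with the rays, the diagonal from the apex to their
    intersection splits it into two triangles. *)
Lemma wedge_area (R : realType) (A S : set (R * R)) (u w : R * R) (a c b d : R) :
  pconvex A -> fin_area A -> measurable (S : set (plane R)) -> cross u w = 1 ->
  0 < a -> 0 < c -> 0 < b -> 0 < d ->
  A (comb u w a^-1 0) -> A (comb u w 0 c^-1) ->
  A (comb u w b^-1 (- b^-1)) -> A (comb u w (- d^-1) d^-1) ->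
  (forall t, A (comb u w t 0) -> t * a <= 1) ->
  (forall t, A (comb u w 0 t) -> t * c <= 1) ->
  (forall z, S z -> [/\ A z, 0 < cross z w & 0 < cross u z]) ->
  wedge_bound a c b d (2 * rarea S).
Proof.
move=> cA fA mS uw a0 c0 b0 d0 Aa Ac Ab Ad maxa maxc SA.
have con1 x y : 0 <= x -> 0 <= y -> A (comb u w x y) -> a * x + (a - b) * y <= 1.
  by move=> x0 y0; exact: pconvex_wedge.
have con2 x y : 0 <= x -> 0 <= y -> A (comb u w x y) -> (c - d) * x + c * y <= 1.
  move=> x0 y0 Axy; rewrite addrC.
  have sw x' y' : comb w u x' y' = comb u w y' x'.
    by rewrite /comb addrC [X in (_, X)]addrC.
  apply: (@pconvex_wedge R A w u c d) => //; rewrite ?sw//.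
  by move=> t; rewrite sw; exact: maxc.
have SxyP z : S z -> exists x y, [/\ z = comb u w x y, 0 < x, 0 < y,
    a * x + (a - b) * y <= 1 & (c - d) * x + c * y <= 1].
  move=> /SA[Az x0 y0]; have zE := comb_cross z uw.
  exists (cross z w), (cross u z); split => //; rewrite zE in Az.
    by apply: con1 => //; exact: ltW.
  by apply: con2 => //; exact: ltW.
have combc x y x' y' := cross_comb x y x' y' uw.
(* Common to all three bounds: S' lies in the triangle spanned by (p, q) and (r, s), whose doubled
   area is the determinant. *)
have tri0 (S' : set (R * R)) p q r s :
    measurable (S' : set (plane R)) -> S' `<=` S -> 0 < p * s - q * r ->
    (forall x y, S' (comb u w x y) -> 0 < x -> 0 < y -> a * x + (a - b) * y <= 1 ->
       (c - d) * x + c * y <= 1 ->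
       [/\ 0 <= x * s - y * r, 0 <= p * y - q * x &
         (x * s - y * r) + (p * y - q * x) <= p * s - q * r]) ->
    2 * rarea S' <= p * s - q * r.
  move=> mS' S'S D0 H.
  have cr : cross (comb u w p q) (comb u w r s) = p * s - q * r by rewrite combc.
  have crn : cross (comb u w p q) (comb u w r s) != 0 by rewrite cr gt_eqF.
  have [fT aT] := fin_area_triangle crn.
  have : rarea S' <= rarea (triangle (comb u w p q) (comb u w r s)).
    apply: le_rarea => // z S'z; have [x [y [zE x0 y0 h1 h2]]] := SxyP z (S'S z S'z).
    rewrite zE in S'z *; have [H1 H2 H3] := H x y S'z x0 y0 h1 h2.
    rewrite /triangle /= !combc; split; rewrite ?divr_ge0 ?(ltW D0)//.
    by rewrite -mulrDl ler_pdivrMr// mul1r.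
  by rewrite aT cr gtr0_norm//; clear; lra.
have fS : fin_area S by apply: fin_areaS fA _ => // z /SA[].
clear Ab Ad maxa maxc SA.
split.
- move=> T0; set T := a * d + c * b - b * d in T0 *.
  have h1 : 0 <= c - a + b.
    have := con1 0 c^-1 (lexx 0); rewrite invr_ge0 mulr0 add0r => /(_ (ltW c0) Ac).
    by rewrite ler_pdivrMr//; clear; lra.
  have h2 : 0 <= a - c + d.
    have := con2 a^-1 0; rewrite invr_ge0 mulr0 addr0 => /(_ (ltW a0) (lexx 0) Aa).
    by rewrite ler_pdivrMr//; clear; lra.
  (* (X, Y) is the intersection of the two lines, so Y / a and X / c are the doubled areas of the
     two triangles. *)
  pose X := (c - a + b) / T; pose Y := (a - c + d) / T.
  have Tn := lt0r_neq0 T0.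
  have l1 : a * X + (a - b) * Y = 1.
    transitivity (T / T); last by rewrite divff.
    by rewrite /X /Y /T; field.
  have l2 : (c - d) * X + c * Y = 1.
    transitivity (T / T); last by rewrite divff.
    by rewrite /X /Y /T; field.
  have X0 : 0 <= X by rewrite divr_ge0// ltW.
  have Y0 : 0 <= Y by rewrite divr_ge0// ltW.
  have XT : X * T = c - a + b by rewrite divfK.
  have YT : Y * T = a - c + d by rewrite divfK.
  clearbody X Y.
  suff H : 2 * rarea S <= Y / a + X / c.
    apply: le_trans (_ : (Y / a + X / c) * T <= _); first by rewrite ler_pM2r.
    by rewrite mulrDl [Y / a * T]mulrAC [X / c * T]mulrAC XT YT.
  have an := lt0r_neq0 a0; have cn := lt0r_neq0 c0.
  have triA (S' : set (R * R)) : 0 < Y -> measurable (S' : set (plane R)) ->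
      (forall x y, S' (comb u w x y) -> 0 < x -> 0 < y -> X * y - Y * x <= 0) -> S' `<=` S ->
      2 * rarea S' <= Y / a.
    move=> Yp mS' HS' S'S.
    have -> : Y / a = a^-1 * Y - 0 * X by rewrite mul0r subr0 mulrC.
    apply: tri0 => //; first by rewrite mul0r subr0 mulr_gt0// invr_gt0.
    move=> x y Sz x0 y0 hc _; have hz := HS' x y Sz x0 y0.
    rewrite !mul0r !subr0; split; first by clear -hz; lra.
      by rewrite mulr_ge0 ?invr_ge0 ?ltW.
    rewrite -(ler_pM2l a0) mulrDr !mulrA divff// !mul1r.
    have : Y * (a * x + (a - b) * y) <= Y * 1 by rewrite ler_pM2l.
    have : y * (a * X + (a - b) * Y) = y by rewrite l1 mulr1.
    by clear; lra.
  have triB (S' : set (R * R)) : 0 < X -> measurable (S' : set (plane R)) ->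
      (forall x y, S' (comb u w x y) -> 0 < x -> 0 < y -> 0 <= X * y - Y * x) -> S' `<=` S ->
      2 * rarea S' <= X / c.
    move=> Xp mS' HS' S'S.
    have -> : X / c = X * c^-1 - Y * 0 by rewrite mulr0 subr0.
    apply: tri0 => //; first by rewrite mulr0 subr0 mulr_gt0// invr_gt0.
    move=> x y Sz x0 y0 _ hc; have hz := HS' x y Sz x0 y0.
    rewrite !mulr0 !subr0; split => //; first by rewrite mulr_ge0 ?invr_ge0 ?ltW.
    rewrite -(ler_pM2r c0) mulrDl !divfK//.
    have : X * ((c - d) * x + c * y) <= X * 1 by rewrite ler_pM2l.
    have : x * ((c - d) * X + c * Y) = x by rewrite l2 mulr1.
    by clear; lra.
  (* If the intersection lies on one of the two rays, a single triangle remains. *)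
  have [Yeq|Yn] := eqVneq Y 0.
    have Xp : 0 < X.
      rewrite lt0r X0 andbT; apply/eqP => Xeq.
      by move: l1; rewrite Xeq Yeq !mulr0 addr0; apply/eqP; rewrite eq_sym oner_eq0.
    rewrite {1}Yeq mul0r add0r; apply: triB => // x y _ x0 y0.
    by rewrite Yeq mul0r subr0 mulr_ge0// ltW.
  have Yp : 0 < Y by rewrite lt0r Yn.
  have [Xeq|Xn] := eqVneq X 0.
    rewrite {1}Xeq mul0r addr0; apply: triA => // x y _ x0 y0.
    by rewrite Xeq mul0r sub0r oppr_le0 mulr_ge0// ltW.
  have Xp : 0 < X by rewrite lt0r Xn.
  pose Z := comb u w X Y.
  have ZE x y : X * y - Y * x = dot (- Z.2, Z.1) (comb u w x y).
    by rewrite -combc /cross /dot /=; ring.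
  have mH v := measurable_hplane v (0 : R).
  have := triA (S `&` hplane (- Z.2, Z.1) 0) Yp (measurableI _ _ mS (mH _)) _ _.
  have := triB (S `&` hplane (Z.2, - Z.1) 0) Xp (measurableI _ _ mS (mH _)) _ _.
  move=> hB hA.
  have {}hA : 2 * rarea (S `&` hplane (- Z.2, Z.1) 0) <= Y / a.
    by apply: hA => // x y [_]; rewrite /hplane /= ZE.
  have {}hB : 2 * rarea (S `&` hplane (Z.2, - Z.1) 0) <= X / c.
    apply: hB => // x y [_]; rewrite /hplane /= ZE /dot /=; clear.
    by move=> h _ _; lra.
  have : rarea S <= rarea (S `&` hplane (- Z.2, Z.1) 0) + rarea (S `&` hplane (Z.2, - Z.1) 0).
    have f1 := fin_areaIl fS (mH (- Z.2, Z.1)).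
    have f2 := fin_areaIl fS (mH (Z.2, - Z.1)).
    apply: le_trans (rareaU_le f1 f2).
    apply: (le_rarea mS (fin_areaU f1 f2)) => z Sz.
    have [h|h] := leP (dot (- Z.2, Z.1) z) 0; [left|right]; split => //.
    by rewrite /hplane /= /dot /=; move: h; rewrite /dot /=; clear; lra.
  move: (rarea (_ `&` _)) (rarea (_ `&` _)) (rarea S) hA hB => r1 r2 r3.
  by clear; lra.
(* Now the first line alone meets both rays, at 1 / a and 1 / (a - b). *)
- move=> ba; have ab0 : 0 < a - b by rewrite subr_gt0.
  have an := lt0r_neq0 a0; have abn := lt0r_neq0 ab0.
  have : 2 * rarea S <= a^-1 * (a - b)^-1 - 0 * 0.
    apply: tri0 => //; first by rewrite mul0r subr0 mulr_gt0 ?invr_gt0.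
    move=> x y _ x0 y0 h _; rewrite !mulr0 !mul0r !subr0.
    split; [by rewrite mulr_ge0 ?invr_ge0 ?ltW|by rewrite mulr_ge0 ?invr_ge0 ?ltW|].
    rewrite -(ler_pM2r (mulr_gt0 a0 ab0)).
    rewrite [leLHS](_ : _ = a * x + (a - b) * y); last by field; rewrite an abn.
    rewrite [leRHS](_ : _ = 1)//; by field; rewrite an abn.
  rewrite mul0r subr0 -invfM => h; rewrite -[leRHS](@mulVf _ (a * (a - b))) ?mulf_neq0//.
  by rewrite ler_pM2r// mulr_gt0.
- move=> dc; have cd0 : 0 < c - d by rewrite subr_gt0.
  have cn := lt0r_neq0 c0; have cdn := lt0r_neq0 cd0.
  have : 2 * rarea S <= (c - d)^-1 * c^-1 - 0 * 0.
    apply: tri0 => //; first by rewrite mul0r subr0 mulr_gt0 ?invr_gt0.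
    move=> x y _ x0 y0 _ h; rewrite !mulr0 !mul0r !subr0.
    split; [by rewrite mulr_ge0 ?invr_ge0 ?ltW|by rewrite mulr_ge0 ?invr_ge0 ?ltW|].
    rewrite -(ler_pM2r (mulr_gt0 c0 cd0)).
    rewrite [leLHS](_ : _ = (c - d) * x + c * y); last by field; rewrite cn cdn.
    rewrite [leRHS](_ : _ = 1)//; by field; rewrite cn cdn.
  rewrite mul0r subr0 -invfM mulrC => h.
  rewrite -[leRHS](@mulVf _ (c * (c - d))) ?mulf_neq0//.
  by rewrite ler_pM2r ?mulr_gt0// [c * _]mulrC; move: h; rewrite mulrC.
Qed.

(** By convexity [D] contains the triangle formed by the apex and the ends on the two rays, of
    doubled area 1 / (a b). *)
Lemma double_area (R : realType) (A D : set (R * R)) (u w : R * R) (a b : R) :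
  pconvex A -> fin_area D -> cross u w = 1 -> 0 < a -> 0 < b -> A (0, 0) ->
  A (comb u w a^-1 0) -> A (comb u w 0 b^-1) ->
  (forall z, A z -> 0 <= cross z w -> 0 <= cross u z -> D z) ->
  1 <= 2 * rarea D * (a * b).
Proof.
move=> cA fD uw a0 b0 A0 Aa Ab AD.
have an := lt0r_neq0 a0; have bn := lt0r_neq0 b0.
have cr : cross (comb u w a^-1 0) (comb u w 0 b^-1) = (a * b)^-1.
  by rewrite cross_comb// mulr0 subr0 invfM.
have crn : cross (comb u w a^-1 0) (comb u w 0 b^-1) != 0.
  by rewrite cr invr_eq0 mulf_neq0.
have [fT aT] := fin_area_triangle crn.
have : rarea (triangle (comb u w a^-1 0) (comb u w 0 b^-1)) <= rarea D.
  apply: le_rarea => //; first by case: fT.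
  move=> z; have [x [y ->]] : exists x y, z = comb u w x y.
    by exists (cross z w), (cross u z); exact: comb_cross.
  rewrite /triangle /= cr !cross_comb// !mulr0 !mul0r !subr0 !invrK => -[h1 h2 h3].
  have xa : x / b * (a * b) = x * a by field.
  have yb : a^-1 * y * (a * b) = y * b by field.
  rewrite xa in h1 h3; rewrite yb in h2 h3.
  have x0 : 0 <= x by rewrite -(pmulr_lge0 _ a0).
  have y0 : 0 <= y by rewrite -(pmulr_lge0 _ b0).
  have [Eu Ew] : cross (comb u w x y) w = x /\ cross u (comb u w x y) = y.
    by move: uw; case: (u) (w) => [u1 u2] [w1 w2]; rewrite /cross /comb /= => uw;
      split; rewrite -[RHS]mulr1 -uw; ring.
  apply: AD; rewrite ?Eu ?Ew//.
  set k := x * a + y * b in h3.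
  have k0 : 0 <= k by rewrite addr_ge0.
  have [keq|kn] := eqVneq k 0.
    have [xa0 yb0] : x * a = 0 /\ y * b = 0.
      by move: keq h1 h2; rewrite /k; clear; split; lra.
    have -> : x = 0 by apply/eqP; rewrite -(mulIr_eq0 _ (mulIf an)) xa0.
    have -> : y = 0 by apply/eqP; rewrite -(mulIr_eq0 _ (mulIf bn)) yb0.
    by rewrite /comb !mul0r addr0.
  have t01 : 0 <= y * b / k <= 1.
    by rewrite divr_ge0//= ler_pdivrMr ?lt0r ?kn// mul1r lerDr.
  have Az := cA _ _ _ Aa Ab t01.
  have k01 : 0 <= k <= 1 by rewrite k0.
  have := cA _ _ _ A0 Az k01; congr A; rewrite /comb /=.
  have kx : 1 - y * b / k = x * a / k by rewrite -[1](divff kn) -mulrBl addrK.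
  by rewrite kx; congr pair; field; rewrite ?kn ?an ?bn.
rewrite aT cr gtr0_norm ?invr_gt0 ?mulr_gt0// => h.
have ab0 := mulr_gt0 a0 b0.
rewrite -[leLHS](@mulVf _ (a * b)) ?mulf_neq0// ler_pM2r//.
by move: h; clear; lra.
Qed.

Lemma dotZ (R : realType) (u x : R * R) (t : R) : dot u (t *: x) = t * dot u x.
Proof. by rewrite /dot /= /GRing.scale /=; ring. Qed.

Lemma continuous_dot (R : realType) (u : R * R) : continuous (dot u).
Proof.
move=> x; apply: cvgD; apply: cvgM; try exact: cvg_cst; [exact: cvg_fst|exact: cvg_snd].
Qed.

Lemma compact_hplaneI (R : realType) (A : set (R * R)) (u : R * R) (c : R) :
  compact A -> compact (A `&` hplane u c).
Proof.
move=> cA; apply: compact_closedI => //.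
have -> : hplane u c = dot u @^-1` [set` `]-oo, c]].
  by apply/seteqP; split => x; rewrite /hplane/= in_itv.
apply: closed_comp; last exact: lray_closed.
by move=> x _; exact: continuous_dot.
Qed.

(** Returns the reciprocal of the extent, the form in which it enters the area bounds. It comes from
    maximising [dot e] over the part of the body on the line through [e], cut out by two opposite
    half-planes. *)
Lemma ray_extent (R : realType) (A : set (R * R)) (e : R * R) (t0 : R) :
  compact A -> e != 0 -> 0 < t0 -> A (t0 *: e) ->
  exists a, [/\ 0 < a, A (a^-1 *: e) & forall t, A (t *: e) -> t * a <= 1].
Proof.
move=> cA e0 t00 At0.
have ee0 : 0 < dot e e.
  rewrite lt0r; apply/andP; split; last by rewrite addr_ge0// -expr2 sqr_ge0.
  apply: contra e0 => h; case: e {At0} h => x y; rewrite /dot/= -!expr2.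
  by rewrite paddr_eq0 ?sqr_ge0// !sqrf_eq0 => /andP[/eqP -> /eqP ->].
pose B := A `&` hplane (e.2, - e.1) 0 `&` hplane (- e.2, e.1) 0.
have cB : compact B by do 2!apply: compact_hplaneI.
have Be t : A (t *: e) -> B (t *: e).
  by move=> At; split; [split|] => //; rewrite /hplane /= dotZ /dot /=; clear; lra.
have [||v vB vmax] := @compact_EVT_max _ R (dot e) B _ cB.
- by exists (t0 *: e); exact: Be.
- by apply: continuous_subspaceT; exact: continuous_dot.
rewrite inE in vB.
have {}vmax t : A (t *: e) -> t * dot e e <= dot e v.
  move=> /Be At; have := vmax (t *: e); rewrite inE => /(_ At).
  by rewrite dotZ.
have vE : v = (dot e v / dot e e) *: e.
  have c : e.2 * v.1 = e.1 * v.2.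
    by case: vB => -[_]; rewrite /hplane /dot /=; clear; lra.
  have en := lt0r_neq0 ee0; apply: (@scalerI _ _ (dot e e)) => //.
  rewrite scalerA mulrC divfK//.
  case: e v c {Be vB vmax cB B en ee0 At0 e0} => [e1 e2] [v1 v2]; rewrite /dot/= => c.
  congr pair; rewrite /= /GRing.scale/=.
    by transitivity (e1 * (e1 * v1) + e2 * (e2 * v1)); [ring|rewrite c; ring].
  by transitivity (e1 * (e1 * v2) + e2 * (e2 * v2)); [ring|rewrite -c; ring].
have ev0 : 0 < dot e v by apply: lt_le_trans (vmax _ At0); rewrite mulr_gt0.
exists (dot e e / dot e v); split; first by rewrite divr_gt0.
  by rewrite invf_div -vE; case: vB => -[].
by move=> t /vmax; rewrite mulrA ler_pdivrMr// mul1r.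
Qed.

(** Supplies a point of the body on a boundary ray: [f] vanishes on the line of the ray, and [g] is
    positive on the ray. *)
Lemma segment_crossing (R : realType) (A : set (R * R)) (z z' : R * R) (f g : R * R) :
  pconvex A -> A z -> A z' -> 0 < dot f z -> dot f z' < 0 ->
  0 < dot g z -> 0 < dot g z' ->
  exists y, [/\ A y, dot f y = 0 & 0 < dot g y].
Proof.
move=> cA Az Az' fz fz' gz gz'.
have k0 : 0 < dot f z - dot f z' by rewrite subr_gt0 (lt_trans fz').
have kn := lt0r_neq0 k0.
pose t := dot f z / (dot f z - dot f z').
have t01 : 0 <= t <= 1.
  by rewrite divr_ge0 ?(ltW fz) ?(ltW k0)//= ler_pdivrMr// mul1r lerBrDl gerDr ltW.
have dotc h : dot h (comb z z' (1 - t) t) = (1 - t) * dot h z + t * dot h z'.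
  by rewrite /dot /comb /=; ring.
exists (comb z z' (1 - t) t); split; first exact: cA.
  by rewrite dotc /t; field.
rewrite dotc; have /andP[t0 t1] := t01.
have [->|tn] := eqVneq t 0; first by rewrite subr0 mul1r mul0r addr0.
rewrite ltr_wpDl ?mulr_ge0 ?subr_ge0 ?(ltW gz)//.
by rewrite mulr_gt0// lt0r tn.
Qed.

(* In coordinates where the three half-planes are 0 <= x + y, x <= 0 and y <= 0,
   their boundary lines form the six rays e1, ..., e6. *)
Lemma hexagon_cells (R : realType) (A S1 S2 S3 D1 D2 D3 : set (R * R))
    (z1 z2 z3 : R * R) :
  compact A -> pconvex A ->
  A z1 -> 0 < z1.1 -> 0 < z1.2 ->
  A z2 -> 0 < z2.2 -> z2.1 + z2.2 < 0 ->
  A z3 -> 0 < z3.1 -> z3.1 + z3.2 < 0 ->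
  measurable (S1 : set (plane R)) -> measurable (S2 : set (plane R)) ->
  measurable (S3 : set (plane R)) ->
  fin_area D1 -> fin_area D2 -> fin_area D3 ->
  (forall z, S1 z -> [/\ A z, 0 < z.1 & 0 < z.2]) ->
  (forall z, S2 z -> [/\ A z, 0 < z.2 & z.1 + z.2 < 0]) ->
  (forall z, S3 z -> [/\ A z, 0 < z.1 & z.1 + z.2 < 0]) ->
  (forall z, A z -> z.1 <= 0 -> z.2 <= 0 -> D1 z) ->
  (forall z, A z -> z.2 <= 0 -> 0 <= z.1 + z.2 -> D2 z) ->
  (forall z, A z -> z.1 <= 0 -> 0 <= z.1 + z.2 -> D3 z) ->
  let D := rarea D1 + rarea D2 + rarea D3 in
  exceeds (rarea S1) (rarea D1) D -> exceeds (rarea S2) (rarea D2) D ->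
  exceeds (rarea S3) (rarea D3) D -> False.
Proof.
move=> cA vA Az1 z11 z12 Az2 z22 z2s Az3 z31 z3s mS1 mS2 mS3 fD1 fD2 fD3.
move=> S1A S2A S3A AD1 AD2 AD3 D N1 N2 N3.
have fA := fin_area_compact cA.
pose e1 : R * R := (1, 0). pose e2 : R * R := (1, -1). pose e3 : R * R := (0, -1).
pose e4 : R * R := (-1, 0). pose e5 : R * R := (-1, 1). pose e6 : R * R := (0, 1).
have ray (e f g z z' : R * R) : A z -> A z' -> 0 < dot f z -> dot f z' < 0 ->
    0 < dot g z -> 0 < dot g z' -> e != 0 ->
    (forall y, dot f y = 0 -> y = dot g y *: e) ->
    exists a, [/\ 0 < a, A (a^-1 *: e) & forall t, A (t *: e) -> t * a <= 1].
  move=> Az Az' fz fz' gz gz' e0 E.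
  have [y [Ay fy gy]] := segment_crossing vA Az Az' fz fz' gz gz'.
  by apply: (@ray_extent R A e (dot g y)) => //; rewrite -E.
have pneq (x y : R) : (x != 0) || (y != 0) -> (x, y) != 0 :> R * R.
  by rewrite xpair_eqE negb_and.
have n1 : (1 : R) != 0 by rewrite oner_eq0.
have nN1 : (-1 : R) != 0 by rewrite oppr_eq0 oner_eq0.
have peq (x y x' y' : R) : x = x' -> y = y' -> (x, y) = (x', y') by move=> -> ->.
(* The line carrying e1 is crossed between z1 and z3, which lie on its two sides. Every other ray
   likewise uses its two nearest witnesses. *)
have [A1 [A1_0 A1A A1m]] : exists a, [/\ 0 < a, A (a^-1 *: e1) & forall t, A (t *: e1) -> t * a <= 1].
  apply: (ray e1 (0, 1) (1, 0) z1 z3) => //; rewrite /dot /=; try by clear -z11 z12 z31 z3s; lra.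
    by rewrite pneq ?n1.
  move=> [x y]; rewrite /dot /= => h; apply: peq; rewrite /GRing.scale /=; clear -h; lra.
have [A2 [A2_0 A2A A2m]] : exists a, [/\ 0 < a, A (a^-1 *: e2) & forall t, A (t *: e2) -> t * a <= 1].
  apply: (ray e2 (1, 1) (1, 0) z1 z3) => //; rewrite /dot /=; try by clear -z11 z12 z31 z3s; lra.
    by rewrite pneq ?n1.
  move=> [x y]; rewrite /dot /= => h; apply: peq; rewrite /GRing.scale /=; clear -h; lra.
have [A3 [A3_0 A3A A3m]] : exists a, [/\ 0 < a, A (a^-1 *: e3) & forall t, A (t *: e3) -> t * a <= 1].
  apply: (ray e3 (1, 0) (-1, -1) z3 z2) => //; rewrite /dot /=; try by clear -z22 z2s z31 z3s; lra.
    by rewrite pneq ?nN1 ?orbT.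
  move=> [x y]; rewrite /dot /= => h; apply: peq; rewrite /GRing.scale /=; clear -h; lra.
have [A4 [A4_0 A4A A4m]] : exists a, [/\ 0 < a, A (a^-1 *: e4) & forall t, A (t *: e4) -> t * a <= 1].
  apply: (ray e4 (0, 1) (-1, -1) z2 z3) => //; rewrite /dot /=; try by clear -z22 z2s z31 z3s; lra.
    by rewrite pneq ?nN1.
  move=> [x y]; rewrite /dot /= => h; apply: peq; rewrite /GRing.scale /=; clear -h; lra.
have [A5 [A5_0 A5A A5m]] : exists a, [/\ 0 < a, A (a^-1 *: e5) & forall t, A (t *: e5) -> t * a <= 1].
  apply: (ray e5 (1, 1) (0, 1) z1 z2) => //; rewrite /dot /=; try by clear -z11 z12 z22 z2s; lra.
    by rewrite pneq ?nN1.
  move=> [x y]; rewrite /dot /= => h; apply: peq; rewrite /GRing.scale /=; clear -h; lra.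
have [A6 [A6_0 A6A A6m]] : exists a, [/\ 0 < a, A (a^-1 *: e6) & forall t, A (t *: e6) -> t * a <= 1].
  apply: (ray e6 (1, 0) (0, 1) z1 z2) => //; rewrite /dot /=; try by clear -z11 z12 z22 z2s; lra.
    by rewrite pneq ?n1 ?orbT.
  move=> [x y]; rewrite /dot /= => h; apply: peq; rewrite /GRing.scale /=; clear -h; lra.
clear ray z11 z12 z22 z2s z31 z3s Az1 Az2 Az3.
(* The apex lies between the ends on the opposite rays e1 and e4. *)
have A0 : A (0, 0).
  have s0 := addr_gt0 A1_0 A4_0; have sn := lt0r_neq0 s0.
  have n1' := lt0r_neq0 A1_0; have n4' := lt0r_neq0 A4_0.
  have t01 : 0 <= A4 / (A1 + A4) <= 1.
    by rewrite divr_ge0 ?(ltW A4_0) ?(ltW s0)//= ler_pdivrMr// mul1r lerDr ltW.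
  have := vA _ _ _ A1A A4A t01; congr A.
  rewrite /comb /= /GRing.scale /=; apply: peq; last by rewrite !mulr0 addr0.
  by field; rewrite ?sn ?n1' ?n4'.
have wdg (S : set (R * R)) (u w u' w' : R * R) a c b d :
    measurable (S : set (plane R)) -> cross u w = 1 -> u' = u - w -> w' = w - u ->
    0 < a -> 0 < c -> 0 < b -> 0 < d -> A (a^-1 *: u) -> A (c^-1 *: w) ->
    A (b^-1 *: u') -> A (d^-1 *: w') -> (forall t, A (t *: u) -> t * a <= 1) ->
    (forall t, A (t *: w) -> t * c <= 1) ->
    (forall z, S z -> [/\ A z, 0 < cross z w & 0 < cross u z]) ->
    wedge_bound a c b d (2 * rarea S).
  move=> mS uw -> -> a0 c0 b0 d0 Aa Ac Ab Ad ma mc SA.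
  apply: (wedge_area vA fA mS uw) => //; try by rewrite combE scale0r ?addr0 ?add0r.
  - by rewrite combE scaleNr -scalerBr.
  - by rewrite combE scaleNr addrC -scalerBr.
  - by move=> t; rewrite combE scale0r addr0; exact: ma.
  - by move=> t; rewrite combE scale0r add0r; exact: mc.
have w1 : wedge_bound A1 A6 A2 A5 (2 * rarea S1).
  apply: (wdg S1 e1 e6 e2 e5) => //.
  - by rewrite /cross /=; ring.
  - by apply: peq; rewrite /=; ring.
  - by apply: peq; rewrite /=; ring.
  - move=> z /S1A[Az h1 h2]; rewrite /cross /=; split => //; clear -h1 h2; lra.
have w2 : wedge_bound A5 A4 A6 A3 (2 * rarea S2).
  apply: (wdg S2 e5 e4 e6 e3) => //.
  - by rewrite /cross /=; ring.
  - by apply: peq; rewrite /=; ring.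
  - by apply: peq; rewrite /=; ring.
  - move=> z /S2A[Az h1 h2]; rewrite /cross /=; split => //; clear -h1 h2; lra.
have w3 : wedge_bound A3 A2 A4 A1 (2 * rarea S3).
  apply: (wdg S3 e3 e2 e4 e1) => //.
  - by rewrite /cross /=; ring.
  - by apply: peq; rewrite /=; ring.
  - by apply: peq; rewrite /=; ring.
  - move=> z /S3A[Az h1 h2]; rewrite /cross /=; split => //; clear -h1 h2; lra.
have dbl (E : set (R * R)) (u w : R * R) a b : fin_area E -> cross u w = 1 ->
    0 < a -> 0 < b -> A (a^-1 *: u) -> A (b^-1 *: w) ->
    (forall z, A z -> 0 <= cross z w -> 0 <= cross u z -> E z) ->
    1 <= 2 * rarea E * (a * b).
  move=> fE uw a0 b0 Aa Ab AE.
  by apply: (double_area vA fE uw) => //; rewrite combE scale0r ?addr0 ?add0r.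
have h1 : 1 <= 2 * rarea D1 * (A3 * A4).
  rewrite (mulrC A3); apply: (dbl D1 e4 e3) => //.
    by rewrite /cross /=; ring.
  move=> z Az; rewrite /cross /= => k1 k2; apply: AD1 => //; clear -k1 k2; lra.
have h2 : 1 <= 2 * rarea D2 * (A1 * A2).
  rewrite (mulrC A1); apply: (dbl D2 e2 e1) => //.
    by rewrite /cross /=; ring.
  move=> z Az; rewrite /cross /= => k1 k2; apply: AD2 => //; clear -k1 k2; lra.
have h3 : 1 <= 2 * rarea D3 * (A5 * A6).
  rewrite (mulrC A5); apply: (dbl D3 e6 e5) => //.
    by rewrite /cross /=; ring.
  move=> z Az; rewrite /cross /= => k1 k2; apply: AD3 => //; clear -k1 k2; lra.
have D2E : 2 * D = 2 * rarea D1 + 2 * rarea D2 + 2 * rarea D3 by rewrite /D !mulrDr.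
have two0 : 0 < 2 :> R by [].
exact: (hexagon_false A1_0 A2_0 A3_0 A4_0 A5_0 A6_0 w1 w2 w3 h1 h2 h3 D2E
  (exceedsZ two0 N1) (exceedsZ two0 N2) (exceedsZ two0 N3)).
Qed.

(** * Covering a planar convex body by bad half-planes *)

Lemma dot_sum (R : realType) (u : R * R) n (w : 'I_n -> R) (x : 'I_n -> R * R) :
  dot u (\sum_i w i *: x i) = \sum_i w i * dot u (x i).
Proof.
have dotD (a b : R * R) : dot u (a + b) = dot u a + dot u b.
  by rewrite /dot /=; ring.
have dot0 : dot u 0 = 0 by rewrite /dot !mulr0 addr0.
rewrite (big_morph (dot u) dotD dot0).
by apply: eq_bigr => i _; rewrite dotZ.
Qed.

Lemma pconvex_sum (R : realType) (A : set (R * R)) n (w : 'I_n -> R)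
    (x : 'I_n -> R * R) :
  pconvex A -> (forall i, 0 <= w i) -> \sum_i w i = 1 -> (forall i, A (x i)) ->
  A (\sum_i w i *: x i).
Proof.
move=> cA; elim: n w x => [|n IH] w x w0 w1 Ax.
  by move: w1; rewrite big_ord0 => /eqP; rewrite eq_sym oner_eq0.
rewrite big_ord_recl; rewrite big_ord_recl in w1.
have r0 : 0 <= \sum_(i < n) w (lift ord0 i) by exact: sumr_ge0.
have [r_eq0|rn] := eqVneq (\sum_(i < n) w (lift ord0 i)) 0.
  have wz i : w (lift ord0 i) = 0.
    by move/psumr_eq0P: r_eq0 => /(_ (fun i _ => w0 _)); exact.
  rewrite r_eq0 addr0 in w1; rewrite w1 scale1r big1 ?addr0// => i _.
  by rewrite wz scale0r.
set r := \sum_(i < n) _ in r0 rn w1.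
have Ay : A (\sum_(i < n) (w (lift ord0 i) / r) *: x (lift ord0 i)).
  apply: IH => [i||i]; [by rewrite divr_ge0| |by []].
  by rewrite -mulr_suml divff.
have r01 : 0 <= r <= 1 by rewrite r0 -w1 lerDr w0.
have := cA _ _ _ (Ax ord0) Ay r01; congr A.
rewrite combE; congr (_ *: _ + _); first by rewrite -w1 addrK.
rewrite scaler_sumr; apply: eq_bigr => i _.
by rewrite scalerA mulrC divfK.
Qed.

(** Radon's theorem. A nonzero vector in the left kernel of the matrix of homogeneous coordinates
    splits into positive and negative parts, whose sums agree because of the column of ones. The
    disjunction says that the two supports are disjoint. *)
Lemma radon_plane (R : realType) (x : 'I_4 -> R * R) :
  exists w w' : 'I_4 -> R, [/\ forall i, 0 <= w i /\ 0 <= w' i,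
    \sum_i w i = 1, \sum_i w' i = 1, forall i, w i = 0 \/ w' i = 0 &
    \sum_i w i *: x i = \sum_i w' i *: x i].
Proof.
pose M : 'M[R]_(4, 3) := \matrix_(i, j)
  (if j == 0 then 1 else if j == 1 then (x i).1 else (x i).2).
have : kermx M != 0.
  by rewrite -mxrank_eq0 mxrank_ker subn_eq0 -ltnNge ltnS rank_leq_col.
move=> /rowV0Pn[v /sub_kermxP vM vn0].
have col j : \sum_i v 0 i * M i j = 0.
  by move/matrixP: vM => /(_ 0 j); rewrite !mxE.
have s0 : \sum_i v 0 i = 0.
  by rewrite -[RHS](col 0); apply: eq_bigr => i _; rewrite mxE mulr1.
have s1 : \sum_i v 0 i * (x i).1 = 0.
  by rewrite -[RHS](col 1); apply: eq_bigr => i _; rewrite mxE.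
have s2 : \sum_i v 0 i * (x i).2 = 0.
  by rewrite -[RHS](col (1 + 1)); apply: eq_bigr => i _; rewrite mxE.
pose p i := Num.max (v 0 i) 0; pose q i := Num.max (- v 0 i) 0.
have pq i : p i - q i = v 0 i.
  by rewrite /p /q; case: (leP (v 0 i) 0) => h; case: leP => h'; lra.
have p0 i : 0 <= p i by rewrite le_max lexx orbT.
have q0 i : 0 <= q i by rewrite le_max lexx orbT.
have pqz i : p i = 0 \/ q i = 0.
  by rewrite /p /q; case: (leP (v 0 i) 0) => h; [left|right] => //; case: leP => h'; lra.
pose s := \sum_i p i.
have sq : \sum_i q i = s.
  apply/eqP; rewrite eq_sym -subr_eq0 /s -sumrB; apply/eqP; rewrite -[RHS]s0.
  by apply: eq_bigr => i _.
have sn : s != 0.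
  apply: contra vn0 => /eqP s_eq0; apply/eqP/rowP => i; rewrite mxE -pq.
  have -> : p i = 0 by apply/(psumr_eq0P (fun i _ => p0 i) s_eq0).
  have -> : q i = 0.
    by rewrite s_eq0 in sq; apply/(psumr_eq0P (fun i _ => q0 i) sq).
  by rewrite subr0.
have sge0 : 0 <= s by exact: sumr_ge0.
exists (fun i => p i / s), (fun i => q i / s); split.
- by move=> i; rewrite !divr_ge0.
- by rewrite -mulr_suml divff.
- by rewrite -mulr_suml sq divff.
- by move=> i; case: (pqz i) => ->; rewrite mul0r; [left|right].
- apply/eqP; rewrite -subr_eq0 -sumrB; apply/eqP.
  transitivity (s^-1 *: \sum_i v 0 i *: x i).
    rewrite scaler_sumr; apply: eq_bigr => i _.
    by rewrite -scalerBl -mulrBl pq scalerA mulrC.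
  have -> : \sum_i v 0 i *: x i = 0.
    have fstD : {morph (fun z : R * R => z.1) : a b / a + b} by [].
    have sndD : {morph (fun z : R * R => z.2) : a b / a + b} by [].
    rewrite [LHS]surjective_pairing (big_morph _ fstD (erefl _)).
    by rewrite (big_morph _ sndD (erefl _)) s1 s2.
  by rewrite scaler0.
Qed.

Definition halfplane_cover (R : realType) (A : set (R * R))
    (s : seq ((R * R) * R)) : Prop :=
  forall x, A x -> exists2 i, i \in s & dot i.1 x < i.2.

Lemma compact_halfplane_cover (R : realType) (A : set (R * R))
    (D : set ((R * R) * R)) :
  compact A -> (forall x, A x -> exists2 i, D i & dot i.1 x < i.2) ->
  exists2 s : seq ((R * R) * R), {in s, forall i, D i} & halfplane_cover A s.
Proof.
move=> cA AD.
have E := congr1 (@^~ A) (compact_cover ((R * R)%type : normedModType R)).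
have {E}cA : cover_compact A by rewrite -E; exact: cA.
move: cA => /(_ _ D (fun i => [set x | dot i.1 x < i.2]))[].
- move=> i _.
  have -> : [set x | dot i.1 x < i.2] = dot i.1 @^-1` [set` `]-oo, i.2[].
    by apply/seteqP; split => x /=; rewrite in_itv.
  by apply: open_comp; [move=> x _; exact: continuous_dot|exact: lray_open].
- by move=> x /AD[i Di xi]; exists i.
- move=> D' D'D AD'; exists (enum_fset D').
    by move=> i /D'D; rewrite inE.
  by move=> x /AD'[i /= iD' xi]; exists i.
Qed.

(** Helly's theorem in covering form. In a minimal cover each member has a private point of [A].
    Given four of them, Radon's theorem yields a point in the hulls of two disjoint classes. For
    each member one of the two classes lies outside it, so the Radon point is covered by none. *)
Lemma helly_minimal_cover (R : realType) (A : set (R * R))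
    (D : set ((R * R) * R)) (s : seq ((R * R) * R)) :
  pconvex A -> {in s, forall i, D i} -> halfplane_cover A s ->
  exists s', [/\ {in s', forall i, D i}, halfplane_cover A s' & (size s' <= 3)%N].
Proof.
move=> cA sD sA.
pose P n := `[< exists s', [/\ {in s', forall i, D i}, halfplane_cover A s' & size s' = n] >].
have exP : exists n, P n by exists (size s); apply/asboolP; exists s.
case: (ex_minnP exP) => n /asboolP[s' [s'D s'A sn]] nmin.
exists s'; split => //; rewrite sn leqNgt; apply/negP => n4.
have miss (k : nat) : (k < n)%N -> exists2 x, A x &
    forall j, (j < n)%N -> j != k -> (nth (0, 0) s' j).2 <= dot (nth (0, 0) s' j).1 x.
  move=> kn; apply: contrapT => H.
  pose t := take k s' ++ drop k.+1 s'.
  have tn : size t = n.-1.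
    by rewrite size_cat size_take size_drop sn kn; case: n kn {nmin n4 s'D s'A sn H t} => // m; rewrite ltnS => km; rewrite subSS addnC subnK.
  have memt i : i \in t -> i \in s'.
    by rewrite mem_cat => /orP[/mem_take|/mem_drop].
  have : P n.-1.
    apply/asboolP; exists t; split => //; first by move=> i /memt/s'D.
    move=> x Ax; apply: contrapT => H'; apply: H; exists x => // j jn jk.
    rewrite leNgt; apply/negP => h; apply: H'; exists (nth (0, 0) s' j) => //.
    rewrite mem_cat; have [jlt|kj] := ltnP j k.
      by rewrite -(nth_take (0, 0) jlt) mem_nth// size_take sn kn.
    have {jk kj}kj : (k < j)%N by rewrite ltn_neqAle eq_sym jk.
    apply/orP; right; rewrite -(subnKC kj) -nth_drop mem_nth//.
    by rewrite size_drop sn ltn_sub2r// (leq_ltn_trans kj).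
  by move=> /nmin; rewrite leqNgt => /negP; apply; rewrite ltn_predL (leq_ltn_trans _ n4).
have /choice[x xP] : forall k : 'I_4, exists x, A x /\ 
    forall j, (j < n)%N -> j != k -> (nth (0, 0) s' j).2 <= dot (nth (0, 0) s' j).1 x.
  move=> k; have [|x Ax xk] := miss k; last by exists x.
  exact: leq_trans (ltn_ord k) n4.
have [w [w' [w0 w1 w'1 ww wx]]] := radon_plane x.
have Az : A (\sum_i w i *: x i).
  by apply: pconvex_sum => // i; [case: (w0 i)|case: (xP i)].
have [i /(nthP (0, 0))[j js <-]] := s'A _ Az; apply/negP; rewrite -leNgt.
rewrite sn in js.
have key (v : 'I_4 -> R) : (forall i, 0 <= v i) -> \sum_i v i = 1 ->
    (forall i, nat_of_ord i = j -> v i = 0) ->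
    (nth (0, 0) s' j).2 <= dot (nth (0, 0) s' j).1 (\sum_i v i *: x i).
  move=> v0 v1 vj; rewrite dot_sum -[leLHS]mulr1 -v1 mulr_sumr.
  apply: ler_sum => k _; rewrite mulrC.
  have [kj|kj] := eqVneq (nat_of_ord k) j; first by rewrite vj// !mul0r.
  by rewrite ler_wpM2l//; case: (xP k) => _ -> //; rewrite eq_sym.
(* Members beyond the first four contain none of the chosen points, so either class will do. *)
have [j4|j4] := ltnP j 4; last first.
  apply: key => //; first by move=> k; case: (w0 k).
  by move=> k kj; move: (ltn_ord k); rewrite kj ltnNge j4.
have [wz|wz] := ww (Ordinal j4).
  apply: key => //; first by move=> k; case: (w0 k).
  by move=> k kj; rewrite -wz; congr w; apply: val_inj.
rewrite wx; apply: key => //; first by move=> k; case: (w0 k).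
by move=> k kj; rewrite -wz; congr w'; apply: val_inj.
Qed.

Lemma dotB (R : realType) (u x y : R * R) : dot u (x - y) = dot u x - dot u y.
Proof. by rewrite /dot /=; ring. Qed.

Lemma dot_comb (R : realType) (u x y : R * R) (s t : R) :
  dot u (comb x y s t) = s * dot u x + t * dot u y.
Proof. by rewrite /dot /comb /=; ring. Qed.

Lemma dotZl (R : realType) (u x : R * R) (t : R) : dot (t *: u) x = t * dot u x.
Proof. by rewrite /dot /= /GRing.scale /=; ring. Qed.

Lemma dot_gt0 (R : realType) (u : R * R) : u != 0 -> 0 < dot u u.
Proof.
case: u => x y u0; rewrite lt0r; apply/andP; split.
  apply: contra u0; rewrite /dot/= -!expr2.
  by rewrite paddr_eq0 ?sqr_ge0// !sqrf_eq0 => /andP[/eqP -> /eqP ->].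
by rewrite addr_ge0// -expr2 sqr_ge0.
Qed.

(* At a minimiser [v] over [A] of the largest slack, an inactive constraint
   could be dropped: moving [v] slightly towards [x] would decrease the maximum. *)
Lemma minmax_active (R : realType) (A : set (R * R)) (u1 u2 u3 v x : R * R) (k1 k2 k3 : R) :
  pconvex A -> A v -> A x ->
  (forall y, A y -> [\/ dot u1 y <= k1, dot u2 y <= k2 | dot u3 y <= k3]) ->
  k2 <= dot u2 v -> k3 <= dot u3 v -> k2 < dot u2 x -> k3 < dot u3 x ->
  dot u1 v <= k1.
Proof.
move=> cA Av Ax cov v2 v3 x2 x3; rewrite leNgt; apply/negP => v1.
have a0 : 0 < dot u1 v - k1 by rewrite subr_gt0.
set a := dot u1 v - k1 in a0.
pose b := `|dot u1 x - k1|.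
have b0 : 0 <= b by exact: normr_ge0.
have bx : - b <= dot u1 x - k1.
  by have := ler_norm (- (dot u1 x - k1)); rewrite normrN -/b lerNl.
have ab0 : 0 < 2 * (a + b) by rewrite mulr_gt0// ltr_wpDr.
pose t := a / (2 * (a + b)).
have t0 : 0 < t by rewrite divr_gt0.
have tab : 2 * t * (a + b) = a by rewrite /t; field; rewrite lt0r_neq0// ltr_wpDr.
have t1 : t <= 1 by rewrite ler_pdivrMr// mul1r; clear -a0 b0; lra.
have tt1 : t < 1.
  by rewrite ltr_pdivrMr// mul1r; clear -a0 b0; lra.
have t01 : 0 <= t <= 1 by rewrite ltW.
have := cov _ (cA _ _ _ Av Ax t01); rewrite !dot_comb => -[].
- have h : 0 <= t * (dot u1 x - k1 + b) by apply: mulr_ge0; [exact: ltW|clear -bx; move: (dot _ _) bx => d; lra].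
  have aE : dot u1 v = a + k1 by rewrite /a subrK.
  rewrite aE => h2.
  have ta : 0 < t * a by rewrite mulr_gt0.
  clear -h h2 tab a0 t0 b0 ta.
  by move: (dot u1 x) h h2 => d; lra.
- have h : 0 <= (1 - t) * (dot u2 v - k2) by rewrite mulr_ge0// subr_ge0.
  have h' : 0 < t * (dot u2 x - k2) by rewrite mulr_gt0// subr_gt0.
  by clear -h h'; lra.
- have h : 0 <= (1 - t) * (dot u3 v - k3) by rewrite mulr_ge0// subr_ge0.
  have h' : 0 < t * (dot u3 x - k3) by rewrite mulr_gt0// subr_gt0.
  by clear -h h'; lra.
Qed.

(** Cramer's relation between three planar vectors; up to a common sign its coefficients become the
    multipliers that make the normals sum to zero. *)
Lemma cross_dot (R : realType) (u1 u2 u3 y : R * R) :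
  cross u2 u3 * dot u1 y + cross u3 u1 * dot u2 y + cross u1 u2 * dot u3 y = 0.
Proof. by rewrite /cross /dot; ring. Qed.

(** In the third relation a positive sum is balanced by w3 a33 with a33 <= 0, so w3 > 0. The first
    two relations then exclude w1 = 0 and w2 = 0. *)
Lemma cross_signs_pos (R : realType) (w1 w2 w3 a11 a21 a31 a12 a22 a32 a13 a23 a33 : R) :
  w1 * a11 + w2 * a21 + w3 * a31 = 0 -> w1 * a12 + w2 * a22 + w3 * a32 = 0 ->
  w1 * a13 + w2 * a23 + w3 * a33 = 0 ->
  a11 <= 0 -> 0 < a21 -> 0 < a31 -> 0 < a12 -> a22 <= 0 -> 0 < a32 ->
  0 < a13 -> 0 < a23 -> a33 <= 0 ->
  0 <= w1 -> 0 <= w2 -> ~ (w1 = 0 /\ w2 = 0) -> [/\ 0 < w1, 0 < w2 & 0 < w3].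
Proof.
move=> E1 E2 E3 a11' a21' a31' a12' a22' a32' a13' a23' a33' w1' w2' w12.
have s0 : 0 < w1 * a13 + w2 * a23.
  have [w1_0|w1n] := eqVneq w1 0.
    have w2n : w2 != 0 by apply/eqP => h; apply: w12.
    by rewrite w1_0 mul0r add0r mulr_gt0// lt0r w2n.
  by rewrite ltr_pwDl ?mulr_ge0 ?(ltW a23')// mulr_gt0// lt0r w1n.
have w3' : 0 < w3.
  rewrite ltNge; apply/negP => h.
  have : 0 <= w3 * a33 by exact: mulr_le0.
  by clear -s0 E3; lra.
have p31 := mulr_gt0 w3' a31'; have p32 := mulr_gt0 w3' a32'.
split => //; rewrite lt0r ?w1' ?w2' andbT; apply/eqP => h.
  have : 0 <= w2 * a21 by rewrite mulr_ge0// ltW.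
  by rewrite h mul0r in E1; clear -p31 E1; lra.
have : 0 <= w1 * a12 by rewrite mulr_ge0// ltW.
by rewrite h mul0r in E2; clear -p32 E2; lra.
Qed.

(** Otherwise [u3] would be a multiple of [u1], but [dot u3] is positive at both points while
    [dot u1] is positive at [y2] only. *)
Lemma not_parallel (R : realType) (u1 u2 u3 y1 y2 : R * R) : u1 != 0 ->
  dot u1 y1 <= 0 -> 0 < dot u2 y1 -> 0 < dot u3 y1 -> 0 < dot u1 y2 ->
  0 < dot u3 y2 -> cross u3 u1 = 0 -> cross u1 u2 = 0 -> False.
Proof.
move=> u1n a11 a21 a31 a12 a32 c31 c12.
have n0 := dot_gt0 u1n.
have E (v y : R * R) : cross u1 v = 0 -> dot u1 u1 * dot v y = dot u1 v * dot u1 y.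
  move=> c; have : dot u1 u1 * dot v y - dot u1 v * dot u1 y =
     cross u1 v * (u1.1 * y.2 - u1.2 * y.1).
    by rewrite /dot /cross; ring.
  by rewrite c mul0r => /eqP; rewrite subr_eq0 => /eqP.
have c13 : cross u1 u3 = 0 by move: c31; rewrite /cross; clear; lra.
have h1 := E u3 y1 c13; have h2 := E u3 y2 c13.
have p1 : 0 < dot u1 u3 * dot u1 y1 by rewrite -h1 mulr_gt0.
have p2 : 0 < dot u1 u3 * dot u1 y2 by rewrite -h2 mulr_gt0.
have g0 : 0 < dot u1 u3 by rewrite -(pmulr_lgt0 _ a12).
by move: p1; rewrite pmulr_rgt0// ltNge a11.
Qed.

(** Two of the three cross products have weakly the same sign; up to the global sign [k],
    [cross_signs_pos] then forces the third one and strictness. *)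
Lemma cross_signs (R : realType) (u1 u2 u3 y1 y2 y3 : R * R) :
  u1 != 0 -> u2 != 0 -> u3 != 0 ->
  dot u1 y1 <= 0 -> 0 < dot u2 y1 -> 0 < dot u3 y1 ->
  0 < dot u1 y2 -> dot u2 y2 <= 0 -> 0 < dot u3 y2 ->
  0 < dot u1 y3 -> 0 < dot u2 y3 -> dot u3 y3 <= 0 ->
  exists k, [/\ 0 < k * cross u2 u3, 0 < k * cross u3 u1 & 0 < k * cross u1 u2].
Proof.
move=> n1 n2 n3 a11 a21 a31 a12 a22 a32 a13 a23 a33.
have E y := cross_dot u1 u2 u3 y.
have P12 : ~ (cross u2 u3 = 0 /\ cross u3 u1 = 0).
  by case=> h1 h2; exact: (@not_parallel R u3 u1 u2 y3 y1).
have P13 : ~ (cross u2 u3 = 0 /\ cross u1 u2 = 0).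
  by case=> h1 h2; exact: (@not_parallel R u2 u3 u1 y2 y3).
have P23 : ~ (cross u3 u1 = 0 /\ cross u1 u2 = 0).
  by case=> h1 h2; exact: (@not_parallel R u1 u2 u3 y1 y2).
have := E y3; have := E y2; have := E y1; clear E n1 n2 n3.
move: (cross u2 u3) (cross u3 u1) (cross u1 u2) P12 P13 P23 => w1 w2 w3 P12 P13 P23.
move=> E1 E2 E3.
have N (x y z p q r : R) : x * p + y * q + z * r = 0 -> (- x) * p + (- y) * q + (- z) * r = 0.
  by move=> h; clear -h; lra.
have C23 (x y z p q r : R) : x * p + y * q + z * r = 0 -> x * p + z * r + y * q = 0.
  by rewrite addrAC.
have C13 (x y z p q r : R) : x * p + y * q + z * r = 0 -> z * r + y * q + x * p = 0.
  by move=> h; rewrite -h; ring.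
have neg (x y : R) : ~ (x = 0 /\ y = 0) -> ~ (- x = 0 /\ - y = 0 :> R).
  by move=> h [hx hy]; apply: h; split; apply/eqP; rewrite -oppr_eq0; apply/eqP.
have pos12 (v1 v2 v3 : R) : v1 * dot u1 y1 + v2 * dot u2 y1 + v3 * dot u3 y1 = 0 ->
    v1 * dot u1 y2 + v2 * dot u2 y2 + v3 * dot u3 y2 = 0 ->
    v1 * dot u1 y3 + v2 * dot u2 y3 + v3 * dot u3 y3 = 0 ->
    0 <= v1 -> 0 <= v2 -> ~ (v1 = 0 /\ v2 = 0) -> [/\ 0 < v1, 0 < v2 & 0 < v3].
  by move=> F1 F2 F3 p1 p2 pn; apply: (cross_signs_pos F1 F2 F3).
have pos13 (v1 v2 v3 : R) : v1 * dot u1 y1 + v2 * dot u2 y1 + v3 * dot u3 y1 = 0 ->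
    v1 * dot u1 y2 + v2 * dot u2 y2 + v3 * dot u3 y2 = 0 ->
    v1 * dot u1 y3 + v2 * dot u2 y3 + v3 * dot u3 y3 = 0 ->
    0 <= v1 -> 0 <= v3 -> ~ (v1 = 0 /\ v3 = 0) -> [/\ 0 < v1, 0 < v2 & 0 < v3].
  move=> /C23 F1 /C23 F2 /C23 F3 p1 p2 pn.
  by have [] := cross_signs_pos F1 F3 F2 a11 a31 a21 a13 a33 a23 a12 a32 a22 p1 p2 pn.
have pos23 (v1 v2 v3 : R) : v1 * dot u1 y1 + v2 * dot u2 y1 + v3 * dot u3 y1 = 0 ->
    v1 * dot u1 y2 + v2 * dot u2 y2 + v3 * dot u3 y2 = 0 ->
    v1 * dot u1 y3 + v2 * dot u2 y3 + v3 * dot u3 y3 = 0 ->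
    0 <= v3 -> 0 <= v2 -> ~ (v2 = 0 /\ v3 = 0) -> [/\ 0 < v1, 0 < v2 & 0 < v3].
  move=> /C13 F1 /C13 F2 /C13 F3 p1 p2 pn.
  have pn' : ~ (v3 = 0 /\ v2 = 0) by case=> *; apply: pn.
  by have [] := cross_signs_pos F3 F2 F1 a33 a23 a13 a32 a22 a12 a31 a21 a11 p1 p2 pn'.
have np12 := pos12 _ _ _ (N _ _ _ _ _ _ E1) (N _ _ _ _ _ _ E2) (N _ _ _ _ _ _ E3).
have np13 := pos13 _ _ _ (N _ _ _ _ _ _ E1) (N _ _ _ _ _ _ E2) (N _ _ _ _ _ _ E3).
have np23 := pos23 _ _ _ (N _ _ _ _ _ _ E1) (N _ _ _ _ _ _ E2) (N _ _ _ _ _ _ E3).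
have {}pos12 := pos12 _ _ _ E1 E2 E3; have {}pos13 := pos13 _ _ _ E1 E2 E3.
have {}pos23 := pos23 _ _ _ E1 E2 E3.
have [h1|/ltW h1] := leP 0 w1; have [h2|/ltW h2] := leP 0 w2;
  have [h3|/ltW h3] := leP 0 w3.
1-2: by exists 1; rewrite !mul1r; exact: pos12.
1: by exists 1; rewrite !mul1r; exact: pos13.
1: by exists (-1); rewrite !mulN1r; apply: np23; rewrite ?oppr_ge0//; exact: neg.
1: by exists 1; rewrite !mul1r; exact: pos23.
1: by exists (-1); rewrite !mulN1r; apply: np13; rewrite ?oppr_ge0//; exact: neg.
1-2: by exists (-1); rewrite !mulN1r; apply: np12; rewrite ?oppr_ge0//; exact: neg.
Qed.

(** [v] minimises the largest slack [c_i - dot u_i x] and [m] is the minimum: when every bound is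
    lowered by [m], the closed half-planes still cover [A]. *)
Lemma three_slacks_minmax (R : realType) (A : set (R * R)) (u1 u2 u3 : R * R) (c1 c2 c3 : R) :
  A !=set0 -> compact A ->
  (forall x, A x -> [\/ dot u1 x < c1, dot u2 x < c2 | dot u3 x < c3]) ->
  exists v m, [/\ A v, 0 < m, 
    [/\ c1 - m <= dot u1 v, c2 - m <= dot u2 v & c3 - m <= dot u3 v] &
    forall x, A x -> [\/ dot u1 x <= c1 - m, dot u2 x <= c2 - m | dot u3 x <= c3 - m]].
Proof.
move=> A0 cA cov.
pose F x := Num.max (c1 - dot u1 x) (Num.max (c2 - dot u2 x) (c3 - dot u3 x)).
have cont u c : continuous (fun x : R * R => (c - dot u x : R)).
  by move=> x; apply: cvgB; [exact: cvg_cst|exact: continuous_dot].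
have cF : continuous F.
  apply: max_fun_continuous; first exact: cont.
  by apply: max_fun_continuous; exact: cont.
have [v vA vmin] := compact_EVT_min A0 cA (continuous_subspaceT cF).
rewrite inE in vA; exists v, (F v); split => //.
- rewrite /F !lt_max !subr_gt0.
  by have [->|->|->] := cov v vA; rewrite ?orbT.
- by split; rewrite lerBlDl -lerBlDr ?opprB /F !le_max lexx ?orbT.
- move=> x Ax; have := vmin x; rewrite inE => /(_ Ax).
  rewrite {2}/F !le_max => /or3P[] h; [constructor 1|constructor 2|constructor 3];
  by rewrite lerBrDl addrC -lerBrDl.
Qed.

(** Badness stays abstract because it is a plain area bound for a planar body but existential over
    tilts for a layered one. The last hypothesis, that two bad half-planes never cover [A], supplies
    the witnesses [x1], [x2], [x3]. *)
Theorem centerpoint_or_triple (R : realType) (A : set (R * R)) (bad : R * R -> R -> Prop) :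
  A !=set0 -> compact A -> pconvex A ->
  (forall u c c', c' <= c -> bad u c -> bad u c') ->
  (forall u c, u != 0 -> bad u c -> exists2 e, 0 < e & bad u (c + e)) ->
  (forall u c k, 0 < k -> bad u c -> bad (k *: u) (k * c)) ->
  (forall u c u' c', u != 0 -> u' != 0 -> bad u c -> bad u' c' ->
     exists x, [/\ A x, c < dot u x & c' < dot u' x]) ->
  (exists2 p, A p & forall u c, u != 0 -> bad u c -> c < dot u p) \/
  (exists v u1 u2 u3 x1 x2 x3,
    [/\ u1 + u2 + u3 = 0, cross u2 u3 != 0,
        [/\ bad u1 (dot u1 v), bad u2 (dot u2 v) & bad u3 (dot u3 v)] &
      [/\ [/\ A x1, dot u2 v < dot u2 x1 & dot u3 v < dot u3 x1],
          [/\ A x2, dot u1 v < dot u1 x2 & dot u3 v < dot u3 x2] &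
          [/\ A x3, dot u1 v < dot u1 x3 & dot u2 v < dot u2 x3]]]).
Proof.
move=> A0 cA vA mono opn scal two.
apply: contrapT => /not_orP[nc nt]; apply: nc.
apply: contrapT => nc.
have cov x : A x -> exists2 i, (fun i : (R * R) * R => i.1 != 0 /\ bad i.1 i.2) i & dot i.1 x < i.2.
  move=> Ax; apply: contrapT => H; apply: nc; exists x => // u c u0 buc.
  rewrite ltNge; apply/negP => h; apply: H.
  have [e e0 be] := opn u c u0 buc.
  by exists (u, c + e) => //=; rewrite (le_lt_trans h)// ltrDl.
have [s sD sA] := compact_halfplane_cover cA cov.
have [s' [s'D s'A s'3]] := helly_minimal_cover vA sD sA.
clear nc cov s sD sA.
have one u c : u != 0 -> bad u c -> exists2 x, A x & c < dot u x.
  by move=> u0 b; have [x [Ax h _]] := two u c u c u0 u0 b b; exists x.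
(* Fewer than three half-planes cannot cover [A], by [two] and nonemptiness. *)
case: s' s'3 s'D s'A => [|[u1 c1] [|[u2 c2] [|[u3 c3] [|//]]]] _ s'D s'A.
- by have [x /s'A[i]] := A0.
- have /= [n1 b1] := s'D (u1, c1) (mem_head _ _).
  have [x Ax h] := one _ _ n1 b1.
  by have [i] := s'A x Ax; rewrite inE => /eqP -> /=; rewrite ltNge ltW.
- have /= [n1 b1] := s'D (u1, c1) (mem_head _ _).
  have /= [|n2 b2] := s'D (u2, c2); first by rewrite !inE eqxx orbT.
  have [x [Ax h h']] := two _ _ _ _ n1 n2 b1 b2.
  by have [i] := s'A x Ax; rewrite !inE => /orP[] /eqP -> /=; rewrite ltNge ltW.
have /= [n1 b1] := s'D (u1, c1) (mem_head _ _).
have /= [|n2 b2] := s'D (u2, c2); first by rewrite !inE eqxx orbT.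
have /= [|n3 b3] := s'D (u3, c3); first by rewrite !inE eqxx !orbT.
have {s'A s'D}cov x : A x -> [\/ dot u1 x < c1, dot u2 x < c2 | dot u3 x < c3].
  by move=> /s'A[i]; rewrite !inE => /or3P[] /eqP -> /= h; [constructor 1|constructor 2|constructor 3].
have [v [m [Av m0 [v1 v2 v3] {}cov]]] := three_slacks_minmax A0 cA cov.
have down u c : bad u c -> bad u (c - m).
  by apply: mono; rewrite gerBl ltW.
have {}b1 := down _ _ b1; have {}b2 := down _ _ b2; have {}b3 := down _ _ b3.
have [x1 [Ax1 x12 x13]] := two _ _ _ _ n2 n3 b2 b3.
have [x2 [Ax2 x21 x23]] := two _ _ _ _ n1 n3 b1 b3.
have [x3 [Ax3 x31 x32]] := two _ _ _ _ n1 n2 b1 b2.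
(* All three bounds are attained at [v], so the boundary lines are concurrent. *)
have e1 : dot u1 v = c1 - m.
  apply/eqP; rewrite eq_le v1 andbT.
  exact: (minmax_active vA Av Ax1 cov v2 v3 x12 x13).
have e2 : dot u2 v = c2 - m.
  apply/eqP; rewrite eq_le v2 andbT.
  apply: (minmax_active vA Av Ax2 _ v1 v3 x21 x23) => y /cov[]; first by constructor 2.
    by constructor 1.
  by constructor 3.
have e3 : dot u3 v = c3 - m.
  apply/eqP; rewrite eq_le v3 andbT.
  apply: (minmax_active vA Av Ax3 _ v1 v2 x31 x32) => y /cov[]; first by constructor 2.
    by constructor 3.
  by constructor 1.
rewrite -e1 -e2 -e3 in b1 b2 b3 x12 x13 x21 x23 x31 x32 cov.
have x11 : dot u1 x1 <= dot u1 v.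
  by have [//|h|h] := cov x1 Ax1; [move: x12|move: x13]; rewrite ltNge h.
have x22 : dot u2 x2 <= dot u2 v.
  by have [h|//|h] := cov x2 Ax2; [move: x21|move: x23]; rewrite ltNge h.
have x33 : dot u3 x3 <= dot u3 v.
  by have [h|h|//] := cov x3 Ax3; [move: x31|move: x32]; rewrite ltNge h.
have [||||||||||||k [k1 k2 k3]] := @cross_signs R u1 u2 u3 (x1 - v) (x2 - v) (x3 - v).
all: rewrite ?dotB ?subr_gt0 ?subr_le0 //.
apply: nt.
(* Positive rescaling keeps the half-planes, and Cramer's relation makes the new normals sum to
   zero. *)
exists v, ((k * cross u2 u3) *: u1), ((k * cross u3 u1) *: u2), ((k * cross u1 u2) *: u3), x1, x2, x3.
split.
- rewrite /cross; case: (u1) (u2) (u3) => [p1 q1] [p2 q2] [p3 q3].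
  by congr pair; rewrite /= /GRing.scale /=; ring.
- rewrite [X in X != 0](_ : _ = (k * cross u3 u1) * (k * cross u1 u2) * cross u2 u3).
    apply: mulf_neq0; first by apply: mulf_neq0; exact: lt0r_neq0.
    by apply/eqP => h; move: k1; rewrite h mulr0 ltxx.
  move: (k * cross u3 u1) (k * cross u1 u2) => a b.
  by rewrite /cross /= /GRing.scale /=; ring.
- by split; rewrite dotZl; exact: scal.
- by split; split => //; rewrite !dotZl ltr_pM2l.
Qed.

(** * Centerpoints of planar bodies and of layered bodies *)

Lemma dots_eq0 (R : realType) (u w y : R * R) :
  cross u w != 0 -> dot u y = 0 -> dot w y = 0 -> y = 0.
Proof.
case: y => [a b]; rewrite /dot /cross /= => cr E2 E3.
have ha : (u.1 * w.2 - u.2 * w.1) * a = 0.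
  by transitivity (w.2 * (u.1 * a + u.2 * b) - u.2 * (w.1 * a + w.2 * b));
    [ring|rewrite E2 E3 !mulr0 subr0].
have hb : (u.1 * w.2 - u.2 * w.1) * b = 0.
  by transitivity (u.1 * (w.1 * a + w.2 * b) - w.1 * (u.1 * a + u.2 * b));
    [ring|rewrite E2 E3 !mulr0 subr0].
by move/eqP: ha; move/eqP: hb; rewrite !mulf_eq0 (negbTE cr)/= => /eqP -> /eqP ->.
Qed.

(** In the coordinates [dot u2 (y - v)] and [dot u3 (y - v)] the half-planes take the form required
    by [hexagon_cells], as u1 = - u2 - u3. All areas are multiplied by |cross u2 u3|, which
    [exceeds] tolerates. *)
Lemma triple_cells_false (R : realType) (A : set (R * R)) (v u1 u2 u3 x1 x2 x3 : R * R) :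
  compact A -> pconvex A -> u1 + u2 + u3 = 0 -> cross u2 u3 != 0 ->
  [/\ A x1, dot u2 v < dot u2 x1 & dot u3 v < dot u3 x1] ->
  [/\ A x2, dot u1 v < dot u1 x2 & dot u3 v < dot u3 x2] ->
  [/\ A x3, dot u1 v < dot u1 x3 & dot u2 v < dot u2 x3] ->
  let K1 := hplane u1 (dot u1 v) in let K2 := hplane u2 (dot u2 v) in
  let K3 := hplane u3 (dot u3 v) in
  let d1 := rarea (A `&` K2 `&` K3) in let d2 := rarea (A `&` K1 `&` K3) in
  let d3 := rarea (A `&` K1 `&` K2) in
  exceeds (rarea (A `\` K2 `\` K3)) d1 (d1 + d2 + d3) ->
  exceeds (rarea (A `\` K1 `\` K3)) d2 (d1 + d2 + d3) ->
  exceeds (rarea (A `\` K1 `\` K2)) d3 (d1 + d2 + d3) -> False.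
Proof.
move=> cA vA us cr [Ax1 x12 x13] [Ax2 x21 x23] [Ax3 x31 x32] K1 K2 K3 d1 d2 d3 N1 N2 N3.
have u1E y : dot u1 y = - dot u2 y - dot u3 y.
  have : dot (u1 + u2 + u3) y = 0 by rewrite us /dot !mul0r addr0.
  have -> : dot (u1 + u2 + u3) y = dot u1 y + dot u2 y + dot u3 y.
    by rewrite /dot /=; ring.
  by clear; lra.
pose f := affine_map u2.1 u2.2 (- dot u2 v) u3.1 u3.2 (- dot u3 v).
have f1 y : (f y).1 = dot u2 y - dot u2 v by [].
have f2 y : (f y).2 = dot u3 y - dot u3 v by [].
have finj y z : f y = f z -> y = z.
  move=> E.
  have E2 : dot u2 (y - z) = 0.
    by rewrite dotB; have := congr1 fst E; rewrite f1 f1; clear; lra.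
  have E3 : dot u3 (y - z) = 0.
    by rewrite dotB; have := congr1 snd E; rewrite f2 f2; clear; lra.
  by apply/eqP; rewrite -subr_eq0; apply/eqP; exact: (dots_eq0 cr).
pose A' := f @` A.
(* Injectivity lets the area formula for preimages apply to the image A'. *)
have fA' : f @^-1` A' = A.
  apply/seteqP; split => y; first by move=> [z Az /finj <-].
  by move=> Ay; exists y.
have cA' : compact A'.
  apply: continuous_compact => //; apply: continuous_subspaceT => y.
  have c1 u c : (fun z : R * R => dot u z + c) z @[z --> y] --> dot u y + c.
    by apply: cvgD; [exact: continuous_dot|exact: cvg_cst].
  exact: (cvg_pair (c1 u2 (- dot u2 v)) (c1 u3 (- dot u3 v))).
have vA' : pconvex A'.
  move=> _ _ t [y Ay <-] [z Az <-] t01; exists (comb y z (1 - t) t).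
    exact: vA.
  rewrite [LHS]surjective_pairing f1 f2 !dot_comb /comb !f1 !f2.
  by congr pair; ring.
pose L1 := @hplane R (-1, -1) 0. pose L2 := @hplane R (1, 0) 0.
pose L3 := @hplane R (0, 1) 0.
have L1E z : L1 z <-> 0 <= z.1 + z.2 by rewrite /L1 /hplane /dot /=; clear; split; lra.
have L2E z : L2 z <-> z.1 <= 0 by rewrite /L2 /hplane /dot /=; clear; split; lra.
have L3E z : L3 z <-> z.2 <= 0 by rewrite /L3 /hplane /dot /=; clear; split; lra.
have fL1 : f @^-1` L1 = K1.
  apply/seteqP; split => y /=; rewrite L1E f1 f2 /K1 /hplane /= u1E (u1E v);
  move: (dot u2 y) (dot u2 v) (dot u3 y) (dot u3 v); clear; move=> a b c d; lra.
have fL2 : f @^-1` L2 = K2.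
  by apply/seteqP; split => y /=; rewrite L2E f1 /K2 /hplane /= subr_le0.
have fL3 : f @^-1` L3 = K3.
  by apply/seteqP; split => y /=; rewrite L3E f2 /K3 /hplane /= subr_le0.
have mA' : measurable (A' : set (plane R)) by exact: compact_measurable_plane.
have fA2 := fin_area_compact cA'.
have mL u : measurable (hplane u 0 : set (plane R)) by exact: measurable_hplane.
have tr (E E' : set (R * R)) : measurable (E' : set (plane R)) -> f @^-1` E' = E ->
    rarea E' = `|cross u2 u3| * rarea E.
  by move=> mE' <-; rewrite -(rarea_affine (- dot u2 v) (- dot u3 v) cr mE').
have mD (X Y : set (R * R)) : measurable (X : set (plane R)) ->
    measurable (Y : set (plane R)) -> measurable (A' `\` X `\` Y : set (plane R)).
  by move=> mX mY; apply: measurableD => //; exact: measurableD.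
have fI (X Y : set (R * R)) : measurable (X : set (plane R)) ->
    measurable (Y : set (plane R)) -> fin_area (A' `&` X `&` Y).
  by move=> mX mY; exact: (fin_areaIl (fin_areaIl fA2 mX) mY).
have k0 : 0 < `|cross u2 u3| by rewrite normr_gt0.
have s1 : rarea (A' `\` L2 `\` L3) = `|cross u2 u3| * rarea (A `\` K2 `\` K3).
  by apply: tr; [exact: (mD _ _ (mL _) (mL _))|rewrite -fL2 -fL3 -[in RHS]fA'].
have s2 : rarea (A' `\` L1 `\` L3) = `|cross u2 u3| * rarea (A `\` K1 `\` K3).
  by apply: tr; [exact: (mD _ _ (mL _) (mL _))|rewrite -fL1 -fL3 -[in RHS]fA'].
have s3 : rarea (A' `\` L1 `\` L2) = `|cross u2 u3| * rarea (A `\` K1 `\` K2).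
  by apply: tr; [exact: (mD _ _ (mL _) (mL _))|rewrite -fL1 -fL2 -[in RHS]fA'].
have t1 : rarea (A' `&` L2 `&` L3) = `|cross u2 u3| * d1.
  by apply: tr; [case: (fI _ _ (mL (1, 0)) (mL (0, 1)))|rewrite -fL2 -fL3 -[in RHS]fA'].
have t2 : rarea (A' `&` L1 `&` L3) = `|cross u2 u3| * d2.
  by apply: tr; [case: (fI _ _ (mL (-1, -1)) (mL (0, 1)))|rewrite -fL1 -fL3 -[in RHS]fA'].
have t3 : rarea (A' `&` L1 `&` L2) = `|cross u2 u3| * d3.
  by apply: tr; [case: (fI _ _ (mL (-1, -1)) (mL (1, 0)))|rewrite -fL1 -fL2 -[in RHS]fA'].
have tD : rarea (A' `&` L2 `&` L3) + rarea (A' `&` L1 `&` L3) + rarea (A' `&` L1 `&` L2) =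
    `|cross u2 u3| * (d1 + d2 + d3) by rewrite t1 t2 t3 !mulrDr.
have a1 : A' (f x1) by exists x1.
have a2 : A' (f x2) by exists x2.
have a3 : A' (f x3) by exists x3.
have nL (X : set (R * R)) (g : R * R -> R) : (forall z, X z <-> g z <= 0) ->
    forall z, ~ X z -> 0 < g z.
  by move=> XE z nX; rewrite ltNge; apply/negP => h; apply: nX; apply/XE.
have nL2 := nL _ _ L2E; have nL3 := nL _ _ L3E.
have nL1 z : ~ L1 z -> z.1 + z.2 < 0.
  by move=> nX; rewrite ltNge; apply/negP => h; apply: nX; apply/L1E.
have neg2 : (f x2).1 + (f x2).2 < 0.
  by move: x21; rewrite f1 f2 !u1E; clear; move: (dot u2 _) (dot u3 _) (dot u2 _) (dot u3 _) => a b c d; lra.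
have neg3 : (f x3).1 + (f x3).2 < 0.
  by move: x31; rewrite f1 f2 !u1E; clear; move: (dot u2 _) (dot u3 _) (dot u2 _) (dot u3 _) => a b c d; lra.
have pos x u : dot u v < dot u x -> 0 < dot u x - dot u v by rewrite subr_gt0.
set T := _ + _ + _ in tD.
have M1 : exceeds (rarea (A' `\` L2 `\` L3)) (rarea (A' `&` L2 `&` L3)) T.
  by rewrite s1 t1 tD; exact: exceedsZ.
have M2 : exceeds (rarea (A' `\` L1 `\` L3)) (rarea (A' `&` L1 `&` L3)) T.
  by rewrite s2 t2 tD; exact: exceedsZ.
have M3 : exceeds (rarea (A' `\` L1 `\` L2)) (rarea (A' `&` L1 `&` L2)) T.
  by rewrite s3 t3 tD; exact: exceedsZ.
move: M1 M2 M3.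
apply: (@hexagon_cells R A' _ _ _ _ _ _ (f x1) (f x2) (f x3) cA' vA'
  a1 (pos _ _ x12) (pos _ _ x13) a2 (pos _ _ x23) neg2 a3 (pos _ _ x32) neg3
  (mD _ _ (mL _) (mL _)) (mD _ _ (mL _) (mL _)) (mD _ _ (mL _) (mL _))
  (fI _ _ (mL _) (mL _)) (fI _ _ (mL _) (mL _)) (fI _ _ (mL _) (mL _))).
- by move=> z [[Az /nL2 h] /nL3 h'].
- by move=> z [[Az /nL1 h] /nL3 h'].
- by move=> z [[Az /nL1 h] /nL2 h'].
- by move=> z Az /L2E h /L3E h'.
- by move=> z Az /L3E h /L1E h'.
- by move=> z Az /L2E h /L1E h'.
Qed.

Lemma rareaD_point (R : realType) (X : set (R * R)) (v : R * R) :
  fin_area X -> rarea X <= rarea (X `\` [set v]).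
Proof.
move=> fX; rewrite -[leRHS]addr0 -(rarea_point v).
have fv := fin_area_point v.
have fD : fin_area (X `\` [set v]).
  by apply: (fin_areaS _ fX); [apply: measurableD; [case: fX|case: fv]|exact: subDsetl].
apply: le_trans (rareaU_le fD fv); apply: (le_rarea _ (fin_areaU fD fv)).
  by case: fX.
by move=> x Xx; have [->|xv] := pselect (x = v); [right|left; split].
Qed.

(** The two doubly covered cells meet at most in [v], which has area zero and is removed from one of
    them before adding. *)
Lemma cells_le (R : realType) (A K1 K2 K3 : set (R * R)) (v : R * R) :
  fin_area A -> measurable (K1 : set (plane R)) -> measurable (K2 : set (plane R)) ->
  measurable (K3 : set (plane R)) ->
  (forall x, [\/ K1 x, K2 x | K3 x]) -> (forall x, K1 x -> K2 x -> K3 x -> x = v) ->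
  rarea (A `\` K2 `\` K3) + rarea (A `&` K1 `&` K3) + rarea (A `&` K1 `&` K2)
    <= rarea (A `&` K1).
Proof.
move=> fA m1 m2 m3 cov pt.
have fv := fin_area_point v.
have f13 := fin_areaIl (fin_areaIl fA m1) m3.
have f12 := fin_areaIl (fin_areaIl fA m1) m2.
have fS : fin_area (A `\` K2 `\` K3).
  by rewrite !setDE; do 2 (apply: fin_areaIl; last exact: measurableC).
have f13v : fin_area (A `&` K1 `&` K3 `\` [set v]).
  by rewrite setDE; apply: fin_areaIl => //; apply: measurableC; case: fv.
apply: (@le_trans _ _ (rarea (A `\` K2 `\` K3) + rarea (A `&` K1 `&` K3 `\` [set v]) +
    rarea (A `&` K1 `&` K2))).
  by rewrite lerD2r lerD2l; exact: rareaD_point.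
rewrite -(rareaU fS f13v); last first.
  by apply/seteqP; split => // x [[_ nk3] [[_ k3] _]].
have fU := fin_areaU fS f13v.
rewrite -(rareaU fU f12); last first.
  apply/seteqP; split => // x [[[[_ nk2] _]|[[[_ k1] k3] xv]] [_ k2]] //.
  by apply: xv; exact: pt.
apply: le_rarea.
- by case: (fin_areaU fU f12).
- exact: fin_areaIl.
- move=> x [[[[Ax nk2] nk3]|[[[Ax k1] _] _]]|[[Ax k1] _]]; split => //.
  by case: (cov x).
Qed.

Lemma le_cells (R : realType) (A K1 K2 K3 : set (R * R)) :
  fin_area A -> measurable (K1 : set (plane R)) -> measurable (K2 : set (plane R)) ->
  measurable (K3 : set (plane R)) -> (forall x, [\/ K1 x, K2 x | K3 x]) ->
  rarea A <= rarea (A `\` K2 `\` K3) + rarea (A `\` K1 `\` K3) + rarea (A `\` K1 `\` K2)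
    + rarea (A `&` K2 `&` K3) + rarea (A `&` K1 `&` K3) + rarea (A `&` K1 `&` K2).
Proof.
move=> fA m1 m2 m3 cov.
have fI X Y : measurable (X : set (plane R)) -> measurable (Y : set (plane R)) ->
    fin_area (A `&` X `&` Y).
  by move=> mX mY; exact: (fin_areaIl (fin_areaIl fA mX) mY).
have fD X Y : measurable (X : set (plane R)) -> measurable (Y : set (plane R)) ->
    fin_area (A `\` X `\` Y).
  by move=> mX mY; rewrite !setDE; do 2 (apply: fin_areaIl; last exact: measurableC).
have s1 := fD _ _ m2 m3; have s2 := fD _ _ m1 m3; have s3 := fD _ _ m1 m2.
have d1 := fI _ _ m2 m3; have d2 := fI _ _ m1 m3; have d3 := fI _ _ m1 m2.
have f2 := fin_areaU s1 s2; have f3 := fin_areaU f2 s3; have f4 := fin_areaU f3 d1.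
have f5 := fin_areaU f4 d2; have f6 := fin_areaU f5 d3.
apply: le_trans (_ : rarea (_ `|` (A `&` K1 `&` K2)) <= _).
  apply: (le_rarea _ f6); first by case: fA.
  move=> x Ax; have [k1|k1] := pselect (K1 x); have [k2|k2] := pselect (K2 x);
    have [k3|k3] := pselect (K3 x); rewrite /setU /setI /setD /=; tauto.
apply: le_trans (rareaU_le f5 d3) _; rewrite lerD2r.
apply: le_trans (rareaU_le f4 d2) _; rewrite lerD2r.
apply: le_trans (rareaU_le f3 d1) _; rewrite lerD2r.
apply: le_trans (rareaU_le f2 s3) _; rewrite lerD2r.
exact: rareaU_le.
Qed.

Lemma le_rarea_cover2 (R : realType) (A K K' : set (R * R)) :
  fin_area A -> measurable (K : set (plane R)) -> measurable (K' : set (plane R)) ->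
  A `<=` K `|` K' -> rarea A <= rarea (A `&` K) + rarea (A `&` K').
Proof.
move=> fA m m' AK.
have f := fin_areaIl fA m; have f' := fin_areaIl fA m'.
apply: le_trans (rareaU_le f f'); apply: (le_rarea _ (fin_areaU f f')).
  by case: fA.
by move=> x Ax; case: (AK x Ax); [left|right].
Qed.

Lemma le_rarea_cover3 (R : realType) (A K K' K'' : set (R * R)) :
  fin_area A -> measurable (K : set (plane R)) -> measurable (K' : set (plane R)) ->
  measurable (K'' : set (plane R)) ->
  A `<=` K `|` K' `|` K'' ->
  rarea A <= rarea (A `&` K) + rarea (A `&` K') + rarea (A `&` K'').
Proof.
move=> fA m m' m'' AK.
have f := fin_areaIl fA m; have f' := fin_areaIl fA m'; have f'' := fin_areaIl fA m''.
apply: (@le_trans _ _ (rarea (A `&` K `|` A `&` K' `|` A `&` K''))).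
  apply: (le_rarea _ (fin_areaU (fin_areaU f f') f'')); first by case: fA.
  by move=> x Ax; case: (AK x Ax) => [[]|]; [left; left|left; right|right].
apply: le_trans (rareaU_le (fin_areaU f f') f'') _; rewrite lerD2r.
exact: rareaU_le.
Qed.

(** The three values [dot u_i (x - v)] sum to zero: they are never all positive, and they all vanish
    if none is positive. *)
Lemma triple_geometry (R : realType) (v u1 u2 u3 : R * R) :
  u1 + u2 + u3 = 0 -> cross u2 u3 != 0 ->
  (forall x, [\/ hplane u1 (dot u1 v) x, hplane u2 (dot u2 v) x | hplane u3 (dot u3 v) x]) /\
  (forall x, hplane u1 (dot u1 v) x -> hplane u2 (dot u2 v) x ->
     hplane u3 (dot u3 v) x -> x = v).
Proof.
move=> us cr.
have E y : dot u1 y = - dot u2 y - dot u3 y.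
  have : dot (u1 + u2 + u3) y = 0 by rewrite us /dot !mul0r addr0.
  have -> : dot (u1 + u2 + u3) y = dot u1 y + dot u2 y + dot u3 y.
    by rewrite /dot /=; ring.
  by clear; lra.
split=> x; rewrite /hplane /=.
  have [h2|h2] := leP (dot u2 x) (dot u2 v); first by constructor 2.
  have [h3|h3] := leP (dot u3 x) (dot u3 v); first by constructor 3.
  by constructor 1; rewrite !E; clear -h2 h3; move: (dot _ _) (dot _ _) (dot _ _) (dot _ _) h2 h3 => a b c d; lra.
rewrite !E => h1 h2 h3.
have E2 : dot u2 (x - v) = 0.
  by rewrite dotB; clear -h1 h2 h3; move: (dot u2 _) (dot u3 _) (dot u2 _) (dot u3 _) h1 h2 h3 => a b c d; lra.
have E3 : dot u3 (x - v) = 0.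
  by rewrite dotB; clear -h1 h2 h3; move: (dot u2 _) (dot u3 _) (dot u2 _) (dot u3 _) h1 h2 h3 => a b c d; lra.
by apply/eqP; rewrite -subr_eq0; apply/eqP; exact: (dots_eq0 cr).
Qed.

(** Substituting the cell bounds into the combination with weights 4, 4, 1 leaves 3 d_i + D < 3 s_i,
    the second alternative. *)
Lemma exceeds_of_pair (R : realFieldType) (a x1 x2 x3 s1 s2 s3 d1 d2 d3 : R) :
  s1 + d2 + d3 <= x1 -> s2 + d1 + d3 <= x2 -> s3 + d1 + d2 <= x3 ->
  a <= s1 + s2 + s3 + d1 + d2 + d3 ->
  [/\ 4 * x2 + 4 * x3 + x1 < 4 * a -> exceeds s1 d1 (d1 + d2 + d3),
      4 * x1 + 4 * x3 + x2 < 4 * a -> exceeds s2 d2 (d1 + d2 + d3) &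
      4 * x1 + 4 * x2 + x3 < 4 * a -> exceeds s3 d3 (d1 + d2 + d3)].
Proof. by move=> h1 h2 h3 h4; split => h; right; lra. Qed.

Lemma le_hplane (R : realType) (A : set (R * R)) (u : R * R) (c c' : R) :
  fin_area A -> c' <= c -> rarea (A `&` hplane u c') <= rarea (A `&` hplane u c).
Proof.
move=> fA cc; apply: le_rarea.
- by case: (fin_areaIl fA (measurable_hplane u c')).
- exact: (fin_areaIl fA (measurable_hplane u c)).
- by move=> x [Ax h]; split => //; rewrite /hplane /= (le_trans h).
Qed.

Lemma hplaneZ (R : realType) (u : R * R) (c k : R) : 0 < k ->
  hplane (k *: u) (k * c) = hplane u c.
Proof.
move=> k0; apply/seteqP; split => x; rewrite /hplane /= dotZl; by rewrite ler_pM2l.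
Qed.

Lemma triple_cells_system (R : realType) (A : set (R * R)) (v u1 u2 u3 : R * R) :
  fin_area A -> u1 + u2 + u3 = 0 -> cross u2 u3 != 0 ->
  let K1 := hplane u1 (dot u1 v) in let K2 := hplane u2 (dot u2 v) in
  let K3 := hplane u3 (dot u3 v) in
  let d1 := rarea (A `&` K2 `&` K3) in let d2 := rarea (A `&` K1 `&` K3) in
  let d3 := rarea (A `&` K1 `&` K2) in
  let s1 := rarea (A `\` K2 `\` K3) in let s2 := rarea (A `\` K1 `\` K3) in
  let s3 := rarea (A `\` K1 `\` K2) in
  [/\ s1 + d2 + d3 <= rarea (A `&` K1), s2 + d1 + d3 <= rarea (A `&` K2),
      s3 + d1 + d2 <= rarea (A `&` K3) & rarea A <= s1 + s2 + s3 + d1 + d2 + d3].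
Proof.
move=> fA us cr K1 K2 K3 d1 d2 d3 s1 s2 s3.
have [cov pt] := triple_geometry v us cr.
have m1 : measurable (K1 : set (plane R)) by exact: measurable_hplane.
have m2 : measurable (K2 : set (plane R)) by exact: measurable_hplane.
have m3 : measurable (K3 : set (plane R)) by exact: measurable_hplane.
split; last exact: (le_cells fA m1 m2 m3 cov).
- exact: (cells_le fA m1 m2 m3 cov pt).
- have -> : d3 = rarea (A `&` K2 `&` K1) by rewrite /d3 setIAC.
  apply: (cells_le fA m2 m1 m3) => [x|x k2 k1 k3]; last exact: pt.
  by case: (cov x); [constructor 2|constructor 1|constructor 3].
- have -> : d1 = rarea (A `&` K3 `&` K2) by rewrite /d1 setIAC.
  have -> : d2 = rarea (A `&` K3 `&` K1) by rewrite /d2 setIAC.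
  apply: (cells_le fA m3 m1 m2) => [x|x k3 k1 k2]; last exact: pt.
  by case: (cov x); [constructor 2|constructor 3|constructor 1].
Qed.

(** Bad half-planes have less than 4 / 9 of the area, so two of them cannot cover [A]; as the
    weights 4, 4, 1 add up to 9, a bad triple satisfies [exceeds] at every cell. *)
Theorem planar_centerpoint (R : realType) (A : set (R * R)) :
  A !=set0 -> compact A -> pconvex A ->
  exists2 p, A p & forall u c, u != 0 -> dot u p <= c ->
    4 / 9 * rarea A <= rarea (A `&` hplane u c).
Proof.
move=> A0 cA vA; have fA := fin_area_compact cA.
pose bad (u : R * R) (c : R) := rarea (A `&` hplane u c) < 4 / 9 * rarea A.
have a0 := rarea_ge0 A.
have [||||[p Ap good]|] := @centerpoint_or_triple R A bad A0 cA vA.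
- by move=> u c c' cc; apply: le_lt_trans; exact: le_hplane.
- move=> u c u0 b; have d0 : 0 < 4 / 9 * rarea A - rarea (A `&` hplane u c) by rewrite subr_gt0.
  have [e e0 h] := hplane_area_right_continuous u c fA d0.
  exists e; first exact: e0.
  by apply: (lt_le_trans h); rewrite addrC subrK.
- by move=> u c k k0; rewrite /bad hplaneZ.
- move=> u c u' c' _ _ b b'; apply: contrapT => H.
  have : rarea A <= rarea (A `&` hplane u c) + rarea (A `&` hplane u' c').
    apply: le_rarea_cover2 => //; try exact: measurable_hplane.
    move=> x Ax; have [h|h] := leP (dot u x) c; [by left|right].
    by rewrite /hplane/= leNgt; apply/negP => h'; apply: H; exists x.
  by move: b b' a0; rewrite /bad; clear; move: (rarea _) (rarea _) (rarea _) => r s t; lra.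
- exists p; first exact: Ap.
  by move=> u c u0 h; rewrite leNgt; apply/negP => /(good u c u0); rewrite ltNge h.
move=> [v [u1 [u2 [u3 [x1 [x2 [x3 [us cr [b1 b2 b3] [X1 X2 X3]]]]]]]]]; exfalso.
have [c1 c2 c3 tot] := triple_cells_system v fA us cr.
have [E1 E2 E3] := exceeds_of_pair c1 c2 c3 tot.
clear c1 c2 c3 tot; rewrite /bad in b1 b2 b3.
apply: (triple_cells_false cA vA us cr X1 X2 X3).
- apply: E1; clear -b1 b2 b3.
  by move: (rarea _) (rarea _) (rarea _) (rarea _) b1 b2 b3 => p q r s; lra.
- apply: E2; clear -b1 b2 b3.
  by move: (rarea _) (rarea _) (rarea _) (rarea _) b1 b2 b3 => p q r s; lra.
- apply: E3; clear -b1 b2 b3.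
  by move: (rarea _) (rarea _) (rarea _) (rarea _) b1 b2 b3 => p q r s; lra.
Qed.

Lemma dot_half (R : realType) (u a b : R * R) :
  dot u (2^-1 *: (a + b)) = (dot u a + dot u b) / 2.
Proof. by rewrite dotZ /dot /=; field. Qed.

(** The traces of a half-space on three consecutive planes are shifted by [t], 0 and [- t], and its
    complement is closed under midpoints. *)
Lemma half_outside (R : realType) (u a b : R * R) (c t : R) :
  ~ hplane u (c + t) a -> ~ hplane u (c - t) b -> ~ hplane u c (2^-1 *: (a + b)).
Proof.
rewrite /hplane /= dot_half => /negP + /negP; rewrite -!ltNge => h1 h2 h3.
by clear -h1 h2 h3; lra.
Qed.

(* If a point q of A2 lies in the third half-plane only, then halving towards q maps
   the part of A0 outside the first two half-planes into the cell of A1 that lies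
   in the third half-plane only. *)
Lemma triple_layers_false (R : realType) (A0 A1 A2 : set (R * R))
    (v u1 u2 u3 x1 x2 x3 : R * R) (t1 t2 t3 : R) :
  compact A0 -> compact A1 -> compact A2 -> pconvex A1 ->
  (forall a b, A0 a -> A2 b -> A1 (2^-1 *: (a + b))) ->
  let a0 := rarea A0 in let a1 := rarea A1 in let a2 := rarea A2 in
  a0 < a1 + a2 -> a1 < a0 + a2 ->
  u1 + u2 + u3 = 0 -> cross u2 u3 != 0 ->
  [/\ A1 x1, dot u2 v < dot u2 x1 & dot u3 v < dot u3 x1] ->
  [/\ A1 x2, dot u1 v < dot u1 x2 & dot u3 v < dot u3 x2] ->
  [/\ A1 x3, dot u1 v < dot u1 x3 & dot u2 v < dot u2 x3] ->
  let M u t := rarea (A1 `&` hplane u (dot u v)) +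
    rarea (A0 `&` hplane u (dot u v + t)) + rarea (A2 `&` hplane u (dot u v - t)) in
  M u1 t1 < 2 / 9 * (a0 + a1 + a2) -> M u2 t2 < 2 / 9 * (a0 + a1 + a2) ->
  M u3 t3 < 2 / 9 * (a0 + a1 + a2) ->
  A2 `<=` hplane u1 (dot u1 v - t1) `|` hplane u2 (dot u2 v - t2) `|`
    hplane u3 (dot u3 v - t3) -> False.
Proof.
move=> cA0 cA1 cA2 vA1 mid a0 a1 a2 ha0 ha1 us cr X1 X2 X3 M m1 m2 m3 cov2.
have f0 := fin_area_compact cA0; have f1 := fin_area_compact cA1.
have f2 := fin_area_compact cA2.
have [c1 c2 c3 tot] := triple_cells_system v f1 us cr.
have E := le_rarea_cover3 f2 (measurable_hplane _ _) (measurable_hplane _ _)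
  (measurable_hplane _ _) cov2.
have mD (A : set (R * R)) u c u' c' : fin_area A ->
    measurable (A `\` hplane u c `\` hplane u' c' : set (plane R)).
  by case=> mA _; apply: measurableD; [apply: measurableD|]; rewrite //; exact: measurable_hplane.
have alt u u' t t' :
    (a2 <= rarea (A2 `&` hplane u (dot u v - t)) + rarea (A2 `&` hplane u' (dot u' v - t'))) \/
    (a0 <= rarea (A0 `&` hplane u (dot u v + t)) + rarea (A0 `&` hplane u' (dot u' v + t')) +
       4 * rarea (A1 `\` hplane u (dot u v) `\` hplane u' (dot u' v))).
  have [[q [[Aq nq] nq']]|H] := pselect (exists q, (A2 `\` hplane u (dot u v - t) `\` hplane u' (dot u' v - t')) q).
    right; set B := A0 `\` hplane u (dot u v + t) `\` hplane u' (dot u' v + t').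
    have mB : measurable (B : set (plane R)) by exact: mD.
    have fB : fin_area B by apply: (fin_areaS mB f0) => x [[]].
    have fS : fin_area (A1 `\` hplane u (dot u v) `\` hplane u' (dot u' v)).
      by apply: (fin_areaS _ f1); [exact: mD|move=> x [[]]].
    have hB : rarea B <= 4 * rarea (A1 `\` hplane u (dot u v) `\` hplane u' (dot u' v)).
      apply: (@rarea_half R q) => // b [[Ab nb] nb']; split; first split.
      - exact: mid.
      - exact: half_outside nb nq.
      - exact: half_outside nb' nq'.
    have k := le_rarea_cover3 f0 (measurable_hplane u (dot u v + t)) (measurable_hplane u' (dot u' v + t')) mB.
    have {}k : a0 <= rarea (A0 `&` hplane u (dot u v + t)) +
       rarea (A0 `&` hplane u' (dot u' v + t')) + rarea (A0 `&` B).
      apply: k => x Ax.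
      have [h|h] := pselect (hplane u (dot u v + t) x); first by left; left.
      have [h'|h'] := pselect (hplane u' (dot u' v + t') x); first by left; right.
      by right.
    apply: (le_trans k); rewrite lerD2l; apply: le_trans hB.
    exact: (le_rarea (fin_areaIl f0 mB).1 fB (@subIsetr _ _ _)).
  left; apply: (le_rarea_cover2 f2 (measurable_hplane _ _) (measurable_hplane _ _)).
  move=> x Ax; apply: contrapT => nU; apply: H; exists x; split; first split => //.
    by move=> h; apply: nU; left.
  by move=> h; apply: nU; right.
have ge0 := rarea_ge0.
have [N1 N2 N3] := layers_exceeds ha0 ha1 (ge0 _ _) (ge0 _ _) (ge0 _ _) (ge0 _ _)
  (ge0 _ _) (ge0 _ _) (ge0 _ _) (ge0 _ _) (ge0 _ _) m1 m2 m3 E c1 c2 c3 tot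
  (alt u2 u3 t2 t3) (alt u1 u3 t1 t3) (alt u1 u2 t1 t2).
exact: (triple_cells_false cA1 vA1 us cr X1 X2 X3 N1 N2 N3).
Qed.

Theorem layers_centerpoint (R : realType) (A0 A1 A2 : set (R * R)) :
  A1 !=set0 -> compact A0 -> compact A1 -> compact A2 -> pconvex A1 ->
  (forall a b, A0 a -> A2 b -> A1 (2^-1 *: (a + b))) ->
  let a0 := rarea A0 in let a1 := rarea A1 in let a2 := rarea A2 in
  a0 < a1 + a2 -> a1 < a0 + a2 -> a2 < a0 + a1 ->
  exists2 p, A1 p & forall u c t, u != 0 -> dot u p <= c ->
    2 / 9 * (a0 + a1 + a2) <= rarea (A0 `&` hplane u (c + t)) +
      rarea (A1 `&` hplane u c) + rarea (A2 `&` hplane u (c - t)).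
Proof.
move=> n1 cA0 cA1 cA2 vA1 mid a0 a1 a2 ha0 ha1 ha2.
have f0 := fin_area_compact cA0; have f1 := fin_area_compact cA1.
have f2 := fin_area_compact cA2.
set V := 2 / 9 * _.
pose M u c t := rarea (A1 `&` hplane u c) + rarea (A0 `&` hplane u (c + t)) +
  rarea (A2 `&` hplane u (c - t)).
(* The tilt is quantified inside [bad], so that one point of [A1] serves half-spaces of all
   tilts. *)
pose bad (u : R * R) (c : R) := exists t, M u c t < V.
have [||||[p Ap good]|] := @centerpoint_or_triple R A1 bad n1 cA1 vA1.
- move=> u c c' cc [t h]; exists t; apply: le_lt_trans h.
  by apply: lerD; [apply: lerD|]; apply: le_hplane; rewrite // lerD2r.
- move=> u c u0 [t h].
  have [dl d0 dlE] : exists2 dl, 0 < dl & V = M u c t + 3 * dl.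
    exists ((V - M u c t) / 3); first by rewrite divr_gt0// subr_gt0.
    by rewrite [3 * _]mulrC divfK// addrC subrK.
  have [e1 e10 h1] := hplane_area_right_continuous u c f1 d0.
  have [e2 e20 h2] := hplane_area_right_continuous u (c + t) f0 d0.
  have [e3 e30 h3] := hplane_area_right_continuous u (c - t) f2 d0.
  pose e := Num.min e1 (Num.min e2 e3).
  have [le1 le2 le3] : [/\ e <= e1, e <= e2 & e <= e3].
    by split; rewrite /e !ge_min lexx ?orbT.
  exists e; first by rewrite /e !lt_min e10 e20.
  exists t.
  have g1 : rarea (A1 `&` hplane u (c + e)) <= rarea (A1 `&` hplane u (c + e1)).
    by apply: le_hplane; rewrite // lerD2l.
  have g2 : rarea (A0 `&` hplane u (c + e + t)) <= rarea (A0 `&` hplane u (c + t + e2)).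
    by apply: le_hplane; rewrite // addrAC lerD2l.
  have g3 : rarea (A2 `&` hplane u (c + e - t)) <= rarea (A2 `&` hplane u (c - t + e3)).
    by apply: le_hplane; rewrite // addrAC lerD2l.
  have s1 := le_lt_trans g1 h1; have s2 := le_lt_trans g2 h2; have s3 := le_lt_trans g3 h3.
  have := ltrD (ltrD s1 s2) s3; rewrite -/(M u (c + e) t).
  move=> /lt_le_trans; apply.
  rewrite dlE /M; clear; move: (rarea _) (rarea _) (rarea _) => p q r; lra.
- move=> u c k k0 [t h]; exists (k * t).
  by rewrite /M (hplaneZ _ _ k0) -mulrDr (hplaneZ _ _ k0) -mulrBr (hplaneZ _ _ k0).
- move=> u c u' c' u0 u'0 [t h] [t' h']; apply: contrapT => H.
  have cov1 : A1 `<=` hplane u c `|` hplane u' c'.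
    move=> x Ax; have [k|k] := leP (dot u x) c; [by left|right].
    by rewrite /hplane/= leNgt; apply/negP => k'; apply: H; exists x.
  have E1 := le_rarea_cover2 f1 (measurable_hplane _ _) (measurable_hplane _ _) cov1.
  (* If points of [A0] and [A2] both escaped the two traces, so would their midpoint; hence one
     outer layer is covered besides [A1]. Together the two layers carry more than half of the mass,
     while the two half-spaces have less than 4 / 9. *)
  have [cov|ncov] := pselect (A0 `<=` hplane u (c + t) `|` hplane u' (c' + t')).
    have E0 := le_rarea_cover2 f0 (measurable_hplane _ _) (measurable_hplane _ _) cov.
    have := rarea_ge0 (A2 `&` hplane u (c - t)).
    have := rarea_ge0 (A2 `&` hplane u' (c' - t')).
    move: h h' E0 E1 ha0 ha1 ha2; rewrite /M /V -/a0 -/a1 -/a2; clear.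
    by do 6!move: (rarea (_ `&` _)); move: a0 a1 a2 => *; lra.
  have cov : A2 `<=` hplane u (c - t) `|` hplane u' (c' - t').
    move=> q Aq; apply: contrapT => nq; apply: ncov => p Ap; apply: contrapT => np.
    case: (cov1 _ (mid _ _ Ap Aq)).
      by apply: half_outside => k; [apply: np|apply: nq]; left; exact: k.
    by apply: half_outside => k; [apply: np|apply: nq]; right; exact: k.
  have E2 := le_rarea_cover2 f2 (measurable_hplane _ _) (measurable_hplane _ _) cov.
  have := rarea_ge0 (A0 `&` hplane u (c + t)).
  have := rarea_ge0 (A0 `&` hplane u' (c' + t')).
  move: h h' E2 E1 ha0 ha1 ha2; rewrite /M /V -/a0 -/a1 -/a2; clear.
  by do 6!move: (rarea (_ `&` _)); move: a0 a1 a2 => *; lra.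
- exists p; first exact: Ap.
  move=> u c t u0 h; rewrite leNgt; apply/negP => k.
  have := good u c u0; rewrite ltNge h => /(_ _)/negP; apply => //.
  by exists t; rewrite /M [X in X + _]addrC.
move=> [v [u1 [u2 [u3 [x1 [x2 [x3 [us cr [[t1 b1] [t2 b2] [t3 b3]] [X1 X2 X3]]]]]]]]]; exfalso.
have [cov _] := triple_geometry v us cr.
pose K2 := hplane u1 (dot u1 v - t1) `|` hplane u2 (dot u2 v - t2) `|`
    hplane u3 (dot u3 v - t3).
have [cov2|ncov2] := pselect (A2 `<=` K2).
  exact: (triple_layers_false cA0 cA1 cA2 vA1 mid ha0 ha1 us cr X1 X2 X3 b1 b2 b3 cov2).
(* By midpoints again [A0] must be covered. This is the mirror case, with [A0] and [A2] exchanged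
   and the tilts negated. *)
have cov0 : A0 `<=` hplane u1 (dot u1 v - - t1) `|` hplane u2 (dot u2 v - - t2) `|`
    hplane u3 (dot u3 v - - t3).
  move=> p Ap; apply: contrapT => np; apply: ncov2 => q Aq; apply: contrapT => nq.
  rewrite !opprK in np.
  case: (cov (2^-1 *: (p + q))).
  - by apply: half_outside => k; [apply: np|apply: nq]; left; left; exact: k.
  - by apply: half_outside => k; [apply: np|apply: nq]; left; right; exact: k.
  - by apply: half_outside => k; [apply: np|apply: nq]; right; exact: k.
have mid' a b : A2 a -> A0 b -> A1 (2^-1 *: (a + b)).
  by move=> Aa Ab; rewrite addrC; exact: mid.
have flip u t : M u (dot u v) t < V ->
    rarea (A1 `&` hplane u (dot u v)) + rarea (A2 `&` hplane u (dot u v + - t)) +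
    rarea (A0 `&` hplane u (dot u v - - t)) < 2 / 9 * (a2 + a1 + a0).
  have -> : 2 / 9 * (a2 + a1 + a0) = V.
    by rewrite /V (addrAC a2) (addrC a2 a0) (addrAC a0).
  by rewrite opprK addrAC.
apply: (triple_layers_false cA2 cA1 cA0 vA1 mid' _ _ us cr X1 X2 X3
  (flip _ _ b1) (flip _ _ b2) (flip _ _ b3) cov0).
- by move: ha2; rewrite addrC.
- by move: ha1; rewrite addrC.
Qed.

(** * Mixed-integer volume *)

Lemma convex_setE (R : realType) (M : lmodType R) (A : set M) (x y : M) (t : R) :
  convex_set A -> A x -> A y -> 0 <= t <= 1 -> A ((1 - t) *: x + t *: y).
Proof.
move=> cA Ax Ay /andP[t0 t1].
have h0 : 0 <= 1 - t by rewrite subr_ge0.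
have h1 : 1 - t <= 1 by rewrite gerBl.
have := cA x y (Itv01 h0 h1); rewrite !inE => /(_ Ax Ay).
by rewrite /conv /= /isConvexSpace.conv/= /unstable.onem opprB addrCA subrr addr0.
Qed.

Lemma hplane0 (R : realType) (A : set (R * R)) (c : R) : 0 <= c ->
  A `&` hplane 0 c = A.
Proof.
move=> c0; apply/seteqP; split; first exact: subIsetl.
by move=> x Ax; split => //; rewrite /hplane /dot /= !mul0r addr0.
Qed.

(** A zero [w] arises from boundary planes parallel to the layers; the half-space then contains the
    whole layer. *)
Lemma heavy_layer (R : realType) (A : set (R * R)) (V : R) :
  A !=set0 -> compact A -> pconvex A -> V <= 2 * rarea A ->
  exists2 p, A p & forall w c, dot w p <= c -> 2 / 9 * V <= rarea (A `&` hplane w c).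
Proof.
move=> A0 cA vA VA; have [p Ap h] := planar_centerpoint A0 cA vA.
have a0 := rarea_ge0 A.
exists p => // w c wc; have [w0|w0] := eqVneq w 0.
  rewrite w0 hplane0; first by clear -VA a0; move: (rarea A) VA a0 => a; lra.
  by move: wc; rewrite w0 /dot /= !mul0r addr0.
apply: le_trans (h w c w0 wc).
by clear -VA a0; move: (rarea A) VA a0 => a; lra.
Qed.

(** Free of mixed-integer volumes, so that both conclusions can use it, one after a shift of the
    layers. The half-space of [u] and [c] meets layer i in the half-plane of [u.2] with bound c - i
    u.1. *)
Lemma three_layers_centerpoint (R : realType) (A0 A1 A2 : set (R * R)) :
  A0 !=set0 -> A1 !=set0 -> A2 !=set0 -> compact A0 -> compact A1 -> compact A2 ->
  pconvex A0 -> pconvex A1 -> pconvex A2 ->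
  (forall a b, A0 a -> A2 b -> A1 (2^-1 *: (a + b))) ->
  exists2 y, three_layers A0 A1 A2 y & forall (u : R * (R * R)) c,
    u != 0 -> u.1 * y.1 + u.2.1 * y.2.1 + u.2.2 * y.2.2 <= c ->
    2 / 9 * (rarea A0 + rarea A1 + rarea A2) <= rarea (A0 `&` hplane u.2 c) +
      rarea (A1 `&` hplane u.2 (c - u.1)) + rarea (A2 `&` hplane u.2 (c - 2 * u.1)).
Proof.
move=> n0 n1 n2 c0 c1 c2 v0 v1 v2 mid.
have ge0 := @rarea_ge0 R.
set a0 := rarea A0; set a1 := rarea A1; set a2 := rarea A2; set V := a0 + a1 + a2.
have [h0|h0] := leP V (2 * a0).
  have [p Ap H] := heavy_layer n0 c0 v0 h0.
  exists (0, p); first by left; left.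
  move=> u c _ /=; rewrite mulr0 add0r => /H.
  by move=> /le_trans; apply; rewrite -addrA lerDl addr_ge0.
have [h1|h1] := leP V (2 * a1).
  have [p Ap H] := heavy_layer n1 c1 v1 h1.
  exists (1, p); first by left; right.
  move=> u c _ /=; rewrite mulr1 -addrA addrC -lerBrDr => /H.
  by move=> /le_trans; apply; rewrite addrAC lerDr addr_ge0.
have [h2|h2] := leP V (2 * a2).
  have [p Ap H] := heavy_layer n2 c2 v2 h2.
  exists (2, p); first by right.
  move=> u c _ /=; rewrite (mulrC u.1) -addrA addrC -lerBrDr => /H.
  by move=> /le_trans; apply; rewrite lerDr addr_ge0.
have [|||p Ap H] := layers_centerpoint n1 c0 c1 c2 v1 mid.
- by move: h0; rewrite /V /a0 /a1 /a2; clear; move: (rarea _) (rarea _) (rarea _) => *; lra.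
- by move: h1; rewrite /V /a0 /a1 /a2; clear; move: (rarea _) (rarea _) (rarea _) => *; lra.
- by move: h2; rewrite /V /a0 /a1 /a2; clear; move: (rarea _) (rarea _) (rarea _) => *; lra.
have a0p : 0 <= a0 := ge0 _. have a1p : 0 <= a1 := ge0 _. have a2p : 0 <= a2 := ge0 _.
exists (1, p); first by left; right.
move=> u c u0 /=; rewrite mulr1 -addrA addrC -lerBrDr -/(dot u.2 p) => hp.
(* For [u.2 = 0] the half-space contains layer 1 and, according to the sign of [u.1], layer 2 or
   layer 0. This is more than half of the mass, as no layer carries half. *)
have [w0|w0] := eqVneq u.2 0; last first.
  have := H u.2 (c - u.1) u.1 w0 hp; rewrite subrK.
  by have -> : c - u.1 - u.1 = c - 2 * u.1 by ring.
rewrite w0 in hp *; rewrite /dot /= !mul0r addr0 subr_ge0 in hp.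
have un : u.1 != 0.
  by apply: contra u0 => /eqP h; rewrite [u]surjective_pairing h w0.
rewrite [X in _ <= _ + X + _](_ : _ = a1); last by rewrite hplane0// subr_ge0.
have [u_lt0|u_gt0|u_eq0] := ltgtP u.1 0; last by rewrite u_eq0 eqxx in un.
  rewrite [X in _ <= _ + X](_ : _ = a2); last by rewrite hplane0//; clear -hp u_lt0; lra.
  have := ge0 (A0 `&` hplane 0 c); move: h0 a0p a1p a2p; rewrite /V; clear.
  by move: (rarea _) a0 a1 a2 => *; lra.
rewrite [X in _ <= X + _ + _](_ : _ = a0); last by rewrite hplane0//; clear -hp u_gt0; lra.
have := ge0 (A2 `&` hplane 0 (c - 2 * u.1)); move: h2 a0p a1p a2p; rewrite /V; clear.
by move: (rarea _) a0 a1 a2 => *; lra.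
Qed.

Lemma esum_pick (R : realType) (f : int -> \bar R) (D : set int) (z : int) :
  (forall z, 0 <= f z)%E -> D z ->
  (\esum_(i in D) f i = f z + \esum_(i in D `&` ~` [set z]) f i)%E.
Proof.
move=> f0 Dz; rewrite (esumID [set z])//.
have -> : D `&` [set z] = [set z].
  by apply/seteqP; split => [i [_ ->]//|i ->].
by rewrite esum_set1.
Qed.

Lemma esum_three (R : realType) (f : int -> \bar R) (n : int) :
  (forall z, 0 <= f z)%E ->
  (\esum_(z in [set: int]) f z = f n + (f (n + 1)%R + (f (n + 2)%R +
    \esum_(z in setT `&` ~` [set n] `&` ~` [set n + 1]%R `&` ~` [set n + 2]%R) f z)))%E.
Proof.
move=> f0; rewrite (@esum_pick R f setT n)//.
rewrite (@esum_pick R f _ (n + 1))//; last by split => //= h; lia.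
by rewrite (@esum_pick R f _ (n + 2))//; split; first split; rewrite //= => h; lia.
Qed.

Lemma esum_three_ge (R : realType) (f : int -> \bar R) (n : int) :
  (forall z, 0 <= f z)%E ->
  (f n + f (n + 1)%R + f (n + 2)%R <= \esum_(z in [set: int]) f z)%E.
Proof.
move=> f0; rewrite (esum_three n f0) -addeA !leeD2l//.
by rewrite leeDl// esum_ge0.
Qed.

Lemma esum_three_eq (R : realType) (f : int -> \bar R) (n : int) :
  (forall z, 0 <= f z)%E -> (forall z, z <> n -> z <> n + 1 -> z <> n + 2 -> f z = 0%E) ->
  (\esum_(z in [set: int]) f z = f n + f (n + 1)%R + f (n + 2)%R)%E.
Proof.
move=> f0 fz; rewrite (esum_three n f0) esum1 ?adde0 ?addeA//.
by move=> z [[[_ h1] h2] h3]; exact: fz.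
Qed.

Lemma slice_halfspace (R : realType) (E : set (R * (R * R))) (u : R * (R * R))
    (c : R) (z : int) :
  int_slice (E `&` [set y | u.1 * y.1 + u.2.1 * y.2.1 + u.2.2 * y.2.2 <= c]) z =
  int_slice E z `&` hplane u.2 (c - u.1 * z%:~R).
Proof.
by apply/seteqP; rewrite /int_slice /hplane /dot; split => x /= [Ex h]; split => //;
  move: h; rewrite -addrA addrC lerBrDr.
Qed.

Lemma volume_three_ge (R : realType) (E H : set (R * (R * R))) (A0 A1 A2 : set (R * R))
    (u : R * (R * R)) (c : R) (n : int) (k : R) :
  int_slice E n = A0 -> int_slice E (n + 1) = A1 -> int_slice E (n + 2) = A2 ->
  fin_area A0 -> fin_area A1 -> fin_area A2 ->
  H = [set y | u.1 * y.1 + u.2.1 * y.2.1 + u.2.2 * y.2.2 <= c] ->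
  k <= rarea (A0 `&` hplane u.2 (c - u.1 * n%:~R)) +
    rarea (A1 `&` hplane u.2 (c - u.1 * (n + 1)%:~R)) +
    rarea (A2 `&` hplane u.2 (c - u.1 * (n + 2)%:~R)) ->
  (k%:E <= mixed_integer_volume (E `&` H))%E.
Proof.
move=> E0 E1 E2 f0 f1 f2 -> hk.
have g0 := fin_areaIl f0 (measurable_hplane u.2 (c - u.1 * n%:~R)).
have g1 := fin_areaIl f1 (measurable_hplane u.2 (c - u.1 * (n + 1)%:~R)).
have g2 := fin_areaIl f2 (measurable_hplane u.2 (c - u.1 * (n + 2)%:~R)).
apply: le_trans (esum_three_ge n _); last by move=> z; exact: area_ge0.
rewrite !slice_halfspace E0 E1 E2.
by rewrite -(rareaK g0.2) -(rareaK g1.2) -(rareaK g2.2) -!EFinD lee_fin.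
Qed.

Lemma convex_set_pconvex (R : realType) (A : set (R * R)) : convex_set A -> pconvex A.
Proof. by move=> cA a b t Aa Ab t01; rewrite combE; exact: convex_setE. Qed.

Lemma three_layers_slices (R : realType) (A0 A1 A2 : set (R * R)) :
  [/\ int_slice (three_layers A0 A1 A2) 0 = A0,
      int_slice (three_layers A0 A1 A2) (0 + 1) = A1 &
      int_slice (three_layers A0 A1 A2) (0 + 2) = A2].
Proof.
split; apply/seteqP; split => x; rewrite /int_slice /three_layers /setX /=.
- case=> [[[]|[/eqP]]|[/eqP]] //; first by rewrite eq_sym oner_eq0.
  by rewrite eq_sym pnatr_eq0.
- by move=> h; left; left.
- case=> [[[/eqP]|[]]|[/eqP]] //; first by rewrite oner_eq0.
  by rewrite -[1]/(1%:R) -[2]/(2%:R) eqr_nat.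
- by move=> h; left; right.
- case=> [[[/eqP]|[/eqP]]|[]] //; first by rewrite pnatr_eq0.
  by rewrite (_ : 1 = 1%:R :> R)// eqr_nat.
- by move=> h; right.
Qed.

Lemma layers_depth (R : realType) (A0 A1 A2 : set (R * R)) :
  convex_body A0 -> convex_body A1 -> convex_body A2 ->
  (area A0 + area A1 + area A2 = 1)%E ->
  half_minkowski_sum A0 A2 `<=` A1 ->
  exists2 y : R * (R * R), three_layers A0 A1 A2 y &
    ((2 / 9)%R%:E <= halfspace_depth (three_layers A0 A1 A2) y)%E.
Proof.
move=> [n0 c0 v0] [n1 c1 v1] [n2 c2 v2] V1 mid.
have f0 := fin_area_compact c0; have f1 := fin_area_compact c1.
have f2 := fin_area_compact c2.
have mid' a b : A0 a -> A2 b -> A1 (2^-1 *: (a + b)).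
  by move=> Aa Ab; apply: mid; exists a => //; exists b.
have [y Sy H] := three_layers_centerpoint n0 n1 n2 c0 c1 c2 (convex_set_pconvex v0)
  (convex_set_pconvex v1) (convex_set_pconvex v2) mid'.
exists y => //; apply/ereal_infP => _ [G [[u [c [u0 GE]]] Gy] <-].
have rV : rarea A0 + rarea A1 + rarea A2 = 1.
  by apply: EFin_inj; rewrite !EFinD (rareaK f0.2) (rareaK f1.2) (rareaK f2.2).
have [E0 E1 E2] := three_layers_slices A0 A1 A2.
apply: (volume_three_ge E0 E1 E2 f0 f1 f2 GE).
rewrite GE in Gy; have := H u c u0 Gy; rewrite rV mulr1.
by rewrite !add0r mulr0 subr0 mulr1 [u.1 * 2%:~R]mulrC.
Qed.

Lemma convex_int_set_three (Z : set int) (f : int -> nat) :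
  (forall x y z, Z x -> Z z -> x < y -> y < z -> Z y) -> set_bij Z `I_3 f ->
  exists n : int, forall z, Z z <-> [\/ z = n, z = n + 1 | z = n + 2].
Proof.
move=> cZ [fZ fi fs].
have [a Za fa] := fs 0%N isT; have [b Zb fb] := fs 1%N isT.
have [c Zc fc] := fs 2%N isT.
have Zf z : Z z <-> [\/ z = a, z = b | z = c].
  split; last by case=> ->.
  move=> Zz; have := fZ z Zz; have inj w : Z w -> f z = f w -> z = w.
    by move=> Zw; apply: fi; rewrite inE.
  case E : (f z) => [|[|[|//]]] _; [constructor 1|constructor 2|constructor 3];
    by apply: inj => //; rewrite E.
have ab : a <> b by move=> h; move: fb; rewrite -h fa.
have ac : a <> c by move=> h; move: fc; rewrite -h fa.
have bc : b <> c by move=> h; move: fc; rewrite -h fb.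
clear Za Zb Zc fa fb fc.
have sorted (p q r : int) : (forall z, Z z <-> [\/ z = p, z = q | z = r]) ->
    p < q -> q < r -> exists n : int, forall z, Z z <-> [\/ z = n, z = n + 1 | z = n + 2].
  clear Zf ab ac bc fZ fi fs => ZE pq qr.
  have Zp : Z p by apply/ZE; constructor 1.
  have Zq : Z q by apply/ZE; constructor 2.
  have Zr : Z r by apply/ZE; constructor 3.
  have q1 : q = p + 1.
    have [h|h] := ltP (p + 1) q; last by lia.
    by have /ZE[] := cZ p (p + 1) q Zp Zq ltac:(lia) h; lia.
  have r1 : r = p + 2.
    have [h|h] := ltP (q + 1) r; last by lia.
    by have /ZE[] := cZ q (q + 1) r Zq Zr ltac:(lia) h; lia.
  by exists p => z; rewrite -q1 -r1.
have perm (p q r : int) : (forall z, [\/ z = a, z = b | z = c] <-> [\/ z = p, z = q | z = r]) ->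
    forall z, Z z <-> [\/ z = p, z = q | z = r].
  by move=> h z; rewrite Zf h.
have tac (p q r : int): (forall z, [\/ z = a, z = b | z = c] <-> [\/ z = p, z = q | z = r]) ->
    p < q -> q < r -> exists n : int, forall z, Z z <-> [\/ z = n, z = n + 1 | z = n + 2].
  by move=> h; apply: sorted; exact: perm.
have or3E (x y z w : int) : [\/ w = x, w = y | w = z] <-> w = x \/ w = y \/ w = z.
  split; first by case; tauto.
  by case=> [?|[?|?]]; [constructor 1|constructor 2|constructor 3].
(* The bijection provides no order, so all six are treated. *)
have [abl|bal] : a < b \/ b < a by lia.
  have [bcl|cbl] : b < c \/ c < b by lia.
    by apply: (tac a b c) => //.
  have [acl|cal] : a < c \/ c < a by lia.
    by apply: (tac a c b) => // z; rewrite !or3E; tauto.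
  by apply: (tac c a b) => // z; rewrite !or3E; tauto.
have [acl|cal] : a < c \/ c < a by lia.
  by apply: (tac b a c) => // z; rewrite !or3E; tauto.
have [bcl|cbl] : b < c \/ c < b by lia.
  by apply: (tac b c a) => // z; rewrite !or3E; tauto.
by apply: (tac c b a) => // z; rewrite !or3E; tauto.
Qed.

Lemma compact_int_slice (R : realType) (C : set (R * (R * R))) (z : int) :
  compact C -> compact (int_slice C z).
Proof.
move=> cC.
have -> : int_slice C z = snd @` (C `&` (fst @^-1` [set (z%:~R : R)])).
  apply/seteqP; split => [x Cx|_ [[a x] [Cx /= aE]] <-].
    by exists (z%:~R, x).
  by rewrite /int_slice /= -aE.
apply: continuous_compact; first by apply: continuous_subspaceT => y; exact: cvg_snd.
apply: compact_closedI => //; apply: closed_comp; first by move=> y _; exact: cvg_fst.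
exact: closed_eq.
Qed.

Lemma int_slice_interp (R : realType) (C : set (R * (R * R))) (x y z : int) (a b : R * R)
    (t : R) :
  convex_set C -> int_slice C x a -> int_slice C z b -> 0 <= t <= 1 ->
  y%:~R = (1 - t) * x%:~R + t * z%:~R -> int_slice C y ((1 - t) *: a + t *: b).
Proof.
move=> vC Ca Cb t01 yE.
by have := convex_setE vC Ca Cb t01; rewrite /int_slice /= yE.
Qed.

Lemma pconvex_int_slice (R : realType) (C : set (R * (R * R))) (z : int) :
  convex_set C -> pconvex (int_slice C z).
Proof.
move=> vC a b t Ca Cb t01; rewrite combE.
by apply: (int_slice_interp vC Ca Cb t01); rewrite -mulrDl subrK mul1r.
Qed.

Lemma rarea_gt0 (R : realType) (A : set (R * R)) :
  compact A -> (0 < area A)%E <-> 0 < rarea A.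
Proof.
by move=> cA; rewrite -(rareaK (fin_area_compact cA).2) lte_fin.
Qed.

Lemma rarea_gt0_nonempty (R : realType) (A : set (R * R)) : 0 < rarea A -> A !=set0.
Proof.
move=> A0; apply/set0P/eqP => AE; move: A0.
by rewrite AE /rarea /area measure0 ltxx.
Qed.

(** Contracting slice [x] towards a single point [q] of slice [z] places a copy scaled by 1 - t in
    slice [y]. *)
Lemma positive_slices_convex (R : realType) (C : set (R * (R * R))) (x y z : int) :
  compact C -> convex_set C -> (0 < area (int_slice C x))%E ->
  (0 < area (int_slice C z))%E -> x < y -> y < z -> (0 < area (int_slice C y))%E.
Proof.
move=> cC vC.
have cs w : compact (int_slice C w) by exact: compact_int_slice.
move=> /(rarea_gt0 (cs x)) x0 /(rarea_gt0 (cs z))/rarea_gt0_nonempty[q Cq] xy yz.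
apply/(rarea_gt0 (cs y)).
have xz : 0 < (z - x)%:~R :> R by rewrite ltr0z; lia.
have yz' : 0 < (z - y)%:~R :> R by rewrite ltr0z; lia.
have xy' : 0 < (y - x)%:~R :> R by rewrite ltr0z; lia.
rewrite !intrB in xz yz' xy'.
pose t : R := (y%:~R - x%:~R) / (z%:~R - x%:~R).
have zxn := lt0r_neq0 xz.
have t0 : 0 <= t by rewrite divr_ge0 ?ltW.
have t1 : t < 1 by rewrite ltr_pdivrMr// mul1r ltrD2r -subr_gt0.
have t01 : 0 <= t <= 1 by rewrite t0 ltW.
have s0 : 0 < 1 - t by rewrite subr_gt0.
have hom b : int_slice C x b -> int_slice C y ((1 - t) *: b + t *: q).
  move=> Cb; apply: (int_slice_interp vC Cb Cq t01).
  by rewrite /t; field.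
apply: lt_le_trans (rarea_homothety s0 (fin_area_compact (cs x)).1
  (fin_area_compact (cs y)) hom).
by rewrite mulr_gt0// exprn_gt0.
Qed.

Lemma convex_slices_depth (R : realType) (C : set (R * (R * R))) :
  compact C -> convex_set C ->
  ([set z : int | (0 < area (int_slice C z))%E] #= `I_3)%card ->
  exists y : R * (R * R),
    (C `&` [set t : R * (R * R) | exists z : int, t.1 = (z%:~R)%R]) y /\
    forall H : set (R * (R * R)), closed_halfspace H -> H y ->
      ((2 / 9)%R%:E * mixed_integer_volume C <= mixed_integer_volume (C `&` H))%E.
Proof.
move=> cC vC /card_set_bijP[f bf].
have [n Zn] := convex_int_set_three
  (fun x y z hx hz => @positive_slices_convex R C x y z cC vC hx hz) bf.
have cs w : compact (int_slice C w) by exact: compact_int_slice.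
have fsl w := fin_area_compact (cs w).
have pos w : [\/ w = n, w = n + 1 | w = n + 2] -> int_slice C w !=set0.
  by move=> /Zn /(rarea_gt0 (cs w))/rarea_gt0_nonempty.
have vs w : pconvex (int_slice C w) by exact: pconvex_int_slice.
have mid a b : int_slice C n a -> int_slice C (n + 2) b ->
    int_slice C (n + 1) (2^-1 *: (a + b)).
  move=> Ca Cb; have t01 : 0 <= (2^-1 : R) <= 1 by clear; apply/andP; split; lra.
  have := @int_slice_interp R C n (n + 1) (n + 2) a b 2^-1 vC Ca Cb t01.
  have -> : 1 - 2^-1 = 2^-1 :> R by clear; lra.
  by move=> h; rewrite scalerDr; apply: h; rewrite !intrD; clear; move: (n%:~R : R) => k; lra.
have [y Sy Hy] := three_layers_centerpoint (pos _ (Or31 _ _ (erefl n)))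
  (pos _ (Or32 _ _ (erefl (n + 1)))) (pos _ (Or33 _ _ (erefl (n + 2))))
  (cs _) (cs _) (cs _) (vs _) (vs _) (vs _) mid.
(* The layers 0, 1, 2 are moved back to the heights n, n + 1, n + 2. *)
exists (y.1 + n%:~R, y.2); split.
  move: Sy; rewrite /three_layers /setX /=; case: (y) => i p /=.
  case=> [[[-> Ap]|[-> Ap]]|[-> Ap]].
  - by rewrite add0r; split => //; exists n.
  - move: Ap; rewrite /int_slice /= intrD [_%:~R + _]addrC => Ap; split => //.
    by exists (n + 1); rewrite intrD addrC.
  - move: Ap; rewrite /int_slice /= intrD [_%:~R + _]addrC => Ap; split => //.
    by exists (n + 2); rewrite intrD addrC.
move=> H [u [c [u0 HE]]] HC.
(* Other slices may be nonempty, but their area is zero. *)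
have mv : mixed_integer_volume C =
    (rarea (int_slice C n) + rarea (int_slice C (n + 1)) + rarea (int_slice C (n + 2)))%:E.
  have zero z : z <> n -> z <> n + 1 -> z <> n + 2 -> area (int_slice C z) = 0%E.
    move=> z0 z1 z2; apply/eqP; rewrite eq_le area_ge0 andbT leNgt; apply/negP.
    by move=> /Zn[].
  have := esum_three_eq (fun z => area_ge0 (int_slice C z)) zero.
  rewrite -(rareaK (fsl n).2) -(rareaK (fsl (n + 1)).2) -(rareaK (fsl (n + 2)).2).
  exact.
rewrite mv -EFinM.
apply: (@volume_three_ge R C H _ _ _ u c n _ (erefl _) (erefl _) (erefl _) (fsl _) (fsl _) (fsl _) HE).
have hy : u.1 * y.1 + u.2.1 * y.2.1 + u.2.2 * y.2.2 <= c - u.1 * n%:~R.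
  by move: HC; rewrite HE /= lerBrDr mulrDr; clear;
    move: (u.1 * _) (u.1 * _) (u.2.1 * _) (u.2.2 * _) => p q r s; lra.
have := Hy u _ u0 hy.
have -> : c - u.1 * (n + 1)%:~R = c - u.1 * n%:~R - u.1 by rewrite intrD; ring.
by have -> : c - u.1 * (n + 2)%:~R = c - u.1 * n%:~R - 2 * u.1 by rewrite intrD; ring.
Qed.

Local Open Scope ereal_scope.

Theorem theorem1 (R : realType) :
  (forall A0 A1 A2 : set (R * R),
     convex_body A0 -> convex_body A1 -> convex_body A2 ->
     area A0 + area A1 + area A2 = 1 ->
     half_minkowski_sum A0 A2 `<=` A1 ->
     exists2 y : R * (R * R), three_layers A0 A1 A2 y &
       (2 / 9)%R%:E <= halfspace_depth (three_layers A0 A1 A2) y)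
  /\
  (forall C : set (R * (R * R)),
     compact C -> convex_set C ->
     ([set z : int | (0 < area (int_slice C z))%E] #= `I_3)%card ->
     exists y : R * (R * R),
       (C `&` [set t : R * (R * R) | exists z : int, t.1 = (z%:~R)%R]) y /\
       forall H : set (R * (R * R)), closed_halfspace H -> H y ->
         (2 / 9)%R%:E * mixed_integer_volume C <=
           mixed_integer_volume (C `&` H)).
Proof. by split; [exact: layers_depth|exact: convex_slices_depth]. Qed.
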